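(* Let $Q$ be a finite connected quiver and let $\Lambda=\widehat{KQ}/\overline{\langle R\rangle}$ be a finite dimensional algebra with a minimal set $R$ of relations. Let $k\in Q_0$ be a source of $Q$ such that the simple projective $\Lambda$-module $P_k$ is non-injective, and let $T_k:=\tau^-P_k\oplus\Lambda/P_k$ be the APR tilting module. If $\operatorname{id}P_k\le2$, then there is an algebra isomorphism $$\operatorname{End}_\Lambda(T_k)\cong\mathcal P(\widetilde\mu_k(Q_\Lambda,W_\Lambda,C_\Lambda)).$$
   Context: $K$ is an algebraically closed field. All modules are left modules; the composition $fg$ of morphisms means first $f$, then $g$. For a quiver $Q$, $Q_0$ and $Q_1$ are the sets of vertices and arrows; an arrow or path $a$ goes from $s(a)$ to $e(a)$, and paths are composed from left to right ($ab$ means first $a$, then $b$). $P_i=\Lambda e_i$ is the indecomposable projective at $i$; $\tau^-$ is the inverse Auslander–Reiten translation; $\Lambda/P_k$ is the direct sum of the $P_i$ with $i\ne k$; $\operatorname{id}$ is injective dimension. Complete path algebra: $\widehat{KQ}=\prod_{i\ge0}KQ_i$, where $KQ_i$ is the span of paths of length $i$; bars denote closure in the radical-adic topology. A relation is a (possibly infinite) formal linear combination of paths of length at least 2 with a common start and a common end. A set $R$ of relations is minimal if $r\notin\overline{\langle R\setminus\{r\}\rangle}$ for all $r\in R$. QP: a pair $(Q,W)$, $Q$ a finite quiver (possibly with loops and 2-cycles), $W$ (the potential) in $\prod_{i\ge2}KQ_{i,\rm cyc}$, where $KQ_{i,\rm cyc}$ is spanned by cycles of length $i$. The cyclic derivative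 $\partial_a$ is the continuous linear map with $\partial_a(a_1\cdots a_d)=\sum_{a_i=a}a_{i+1}\cdots a_da_1\cdots a_{i-1}$ on cycles. The Jacobian algebra is $\mathcal P(Q,W)=\widehat{KQ}/\overline{\langle\partial_aW\mid a\in Q_1\rangle}$. A cut is a subset $C\subset Q_1$ such that each cycle appearing in $W$ contains exactly one arrow of $C$. The truncated Jacobian algebra is $\mathcal P(Q,W,C)=\mathcal P(Q,W)/\overline{\langle C\rangle}=\widehat{KQ_C}/\overline{\langle\partial_cW\mid c\in C\rangle}$, where $Q_C$ has vertices $Q_0$ and arrows $Q_1\setminus C$. QP associated with $\Lambda$: $(Q_\Lambda)_0=Q_0$, $(Q_\Lambda)_1=Q_1\sqcup C_\Lambda$ with $C_\Lambda=\{\rho_r:e(r)\to s(r)\mid r\in R\}$, and $W_\Lambda=\sum_{r\in R}\rho_rr$. The set $C_\Lambda$ is a cut. Mutation: $\widetilde\mu_k(Q_\Lambda,W_\Lambda,C_\Lambda)=(Q',W',C')$ is the following QP with cut. $Q'$ is obtained from $Q_\Lambda$ by replacing each arrow $a:k\to v$ by a new arrow $a^*:v\to k$, each arrow $b:u\to k$ by a new arrow $b^*:k\to u$, and adding a new arrow $[ba]:u\to v$ for each pair $u\xrightarrow{b}k\xrightarrow{a}v$. (As $k$ is a source of $Q$, the arrows of $Q_\Lambda$ ending at $k$ are the $\rho_r$ with $s(r)=k$.) The potential is $$W'=\Big[\sum_{r\in R}\rho_rr\Big]+\sum_{\substack{a\in Q_1,\ r\in R\\ s(a)=k=s(r)}}[\rho_ra]a^*\rho_r^*,$$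 where $[\,\cdot\,]$ replaces each composition $ba$ through $k$ (i.e. $e(b)=k=s(a)$) by the arrow $[ba]$. The cut is $$C'=\{\rho_r\mid r\in R,\ s(r)\ne k\}\sqcup\{[\rho_ra]\mid a\in Q_1,\ r\in R,\ s(a)=k=s(r)\}.$$ *)

(* Defs.v *)
From HB Require Import structures.
From mathcomp Require Import all_boot all_order all_algebra.
From mathcomp Require Import boolp classical_sets.

Set Implicit Arguments.
Unset Strict Implicit.
Unset Printing Implicit Defensive.

Import GRing.Theory.

Local Open Scope classical_set_scope.
Local Open Scope ring_scope.
Local Open Scope quotient_scope.

(* K-algebras as rings with a central ring morphism from K; unlike [algType],
   this does not ask for 1 != 0, which would otherwise have to be proved for
   every quotient and endomorphism ring. *)
HB.mixin Record isKAlgebra (K : pzRingType) A of GRing.PzRing A := {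
  kmap : {rmorphism K -> A};
  kmapC : forall (c : K) (x : A), kmap c * x = x * kmap c
}.
#[short(type="kalgType")]
HB.structure Definition KAlgebra (K : pzRingType) :=
  {A of isKAlgebra K A & GRing.PzRing A}.

Definition kalg_iso (K : pzRingType) (A B : kalgType K) : Prop :=
  exists f : {rmorphism A -> B},
    bijective f /\ forall c : K, f (kmap c) = kmap c.

Definition finite_dimensional (K : pzRingType) (A : kalgType K) : Prop :=
  exists (n : nat) (b : 'I_n -> A),
    forall x, exists c : 'I_n -> K, x = \sum_(i < n) kmap (c i) * b i.

Definition two_sided_ideal (A : pzRingType) (I : set A) : Prop :=
  [/\ I 0, forall x y, I x -> I y -> I (x - y),
      forall a x, I x -> I (a * x) & forall a x, I x -> I (x * a)].

Record ideal (A : pzRingType) := Ideal {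
  ideal_set :> A -> Prop;
  idealP : two_sided_ideal ideal_set
}.

Definition gen_ideal (A : pzRingType) (S : set A) : set A :=
  smallest (@two_sided_ideal A) S.

Lemma gen_ideal_ideal (A : pzRingType) (S : set A) :
  two_sided_ideal (gen_ideal S).
Proof.
split.
- by move=> I [[]].
- move=> x y Ix Iy I IS; have [[_ h _ _] _] := IS.
  by apply: h; [apply: Ix|apply: Iy].
- by move=> a x Ix I IS; have [[_ _ h _] _] := IS; apply: h; apply: Ix.
- by move=> a x Ix I IS; have [[_ _ _ h] _] := IS; apply: h; apply: Ix.
Qed.

Section QuotientAlgebra.
Variables (K : pzRingType) (A : kalgType K) (I : ideal A).

Lemma ideal0 : I 0. Proof. by case: (idealP I). Qed.
Lemma idealB x y : I x -> I y -> I (x - y).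
Proof. by case: (idealP I) => _ + _ _; apply. Qed.
Lemma idealMl a x : I x -> I (a * x).
Proof. by case: (idealP I) => _ _ + _; apply. Qed.
Lemma idealMr a x : I x -> I (x * a).
Proof. by case: (idealP I) => _ _ _; apply. Qed.
Lemma idealN x : I x -> I (- x).
Proof. by rewrite -sub0r; apply: idealB; exact: ideal0. Qed.
Lemma idealD x y : I x -> I y -> I (x + y).
Proof. by move=> Ix Iy; rewrite -[y]opprK; apply/idealB/idealN. Qed.

Definition eq_mod_ideal (x y : A) : bool := `[< I (x - y) >].

Lemma eq_mod_ideal_refl : reflexive eq_mod_ideal.
Proof. by move=> x; apply/asboolP; rewrite subrr; exact: ideal0. Qed.
Lemma eq_mod_ideal_sym : symmetric eq_mod_ideal.
Proof.
by move=> x y; apply/asboolP/asboolP => h; rewrite -opprB; exact: idealN.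
Qed.
Lemma eq_mod_ideal_trans : transitive eq_mod_ideal.
Proof.
move=> y x z /asboolP xy /asboolP yz; apply/asboolP.
by have := idealD xy yz; rewrite addrA subrK.
Qed.

Canonical eq_mod_ideal_equiv := EquivRel eq_mod_ideal
  eq_mod_ideal_refl eq_mod_ideal_sym eq_mod_ideal_trans.

Definition quot_alg : Type := {eq_quot eq_mod_ideal}.
HB.instance Definition _ := Choice.on quot_alg.
HB.instance Definition _ := EqQuotient.on quot_alg.

Lemma quot_algP (x y : A) : \pi_quot_alg x = \pi_quot_alg y <-> I (x - y).
Proof.
split; first by move/eqquotP/asboolP.
by move=> h; apply/eqquotP/asboolP.
Qed.

Lemma quot_ind (P : quot_alg -> Prop) :
  (forall x, P (\pi_quot_alg x)) -> forall u, P u.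
Proof. by move=> h u; rewrite -[u]reprK. Qed.

Lemma quot_repr (x : A) : I (repr (\pi_quot_alg x) - x).
Proof. by apply/quot_algP; rewrite reprK. Qed.

Definition quot_add (u v : quot_alg) := \pi_quot_alg (repr u + repr v).
Definition quot_opp (u : quot_alg) := \pi_quot_alg (- repr u).
Definition quot_mul (u v : quot_alg) := \pi_quot_alg (repr u * repr v).

Lemma quot_addE x y :
  quot_add (\pi_quot_alg x) (\pi_quot_alg y) = \pi_quot_alg (x + y).
Proof.
apply/quot_algP; rewrite opprD addrACA.
by apply: idealD; exact: quot_repr.
Qed.
Lemma quot_oppE x : quot_opp (\pi_quot_alg x) = \pi_quot_alg (- x).
Proof. by apply/quot_algP; rewrite -opprD; apply/idealN/quot_repr. Qed.
Lemma quot_mulE x y :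
  quot_mul (\pi_quot_alg x) (\pi_quot_alg y) = \pi_quot_alg (x * y).
Proof.
apply/quot_algP; set x' := repr _; set y' := repr _.
have -> : x' * y' - x * y = x' * (y' - y) + (x' - x) * y.
  by rewrite mulrBr mulrBl addrA subrK.
by apply: idealD; [apply: idealMl|apply: idealMr]; exact: quot_repr.
Qed.

Fact quot_addA : associative quot_add.
Proof. by elim/quot_ind=> x; elim/quot_ind=> y; elim/quot_ind=> z; rewrite !quot_addE addrA. Qed.
Fact quot_addC : commutative quot_add.
Proof. by elim/quot_ind=> x; elim/quot_ind=> y; rewrite !quot_addE addrC. Qed.
Fact quot_add0 : left_id (\pi_quot_alg 0) quot_add.
Proof. by elim/quot_ind=> x; rewrite !quot_addE add0r. Qed.
Fact quot_addN : left_inverse (\pi_quot_alg 0) quot_opp quot_add.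
Proof. by elim/quot_ind=> x; rewrite quot_oppE quot_addE addNr. Qed.
HB.instance Definition _ :=
  GRing.isZmodule.Build quot_alg quot_addA quot_addC quot_add0 quot_addN.

Fact quot_mulA : associative quot_mul.
Proof. by elim/quot_ind=> x; elim/quot_ind=> y; elim/quot_ind=> z; rewrite !quot_mulE mulrA. Qed.
Fact quot_mul1l : left_id (\pi_quot_alg 1) quot_mul.
Proof. by elim/quot_ind=> x; rewrite !quot_mulE mul1r. Qed.
Fact quot_mul1r : right_id (\pi_quot_alg 1) quot_mul.
Proof. by elim/quot_ind=> x; rewrite !quot_mulE mulr1. Qed.
Fact quot_mulDl : left_distributive quot_mul quot_add.
Proof. by elim/quot_ind=> x; elim/quot_ind=> y; elim/quot_ind=> z; rewrite !(quot_mulE, quot_addE) mulrDl. Qed.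
Fact quot_mulDr : right_distributive quot_mul quot_add.
Proof. by elim/quot_ind=> x; elim/quot_ind=> y; elim/quot_ind=> z; rewrite !(quot_mulE, quot_addE) mulrDr. Qed.
HB.instance Definition _ := GRing.Zmodule_isPzRing.Build quot_alg
  quot_mulA quot_mul1l quot_mul1r quot_mulDl quot_mulDr.

Lemma quot_piD : {morph \pi_quot_alg : x y / x + y}.
Proof. by move=> x y; exact/esym/quot_addE. Qed.
Lemma quot_piM : {morph \pi_quot_alg : x y / x * y}.
Proof. by move=> x y; exact/esym/quot_mulE. Qed.
Definition quot_pi (x : A) : quot_alg := \pi_quot_alg x.
Fact quot_pi_zmod : zmod_morphism quot_pi.
Proof.
move=> x y; rewrite /quot_pi quot_piD; congr (_ + _).
exact/esym/quot_oppE.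
Qed.
Fact quot_pi_monoid : monoid_morphism quot_pi.
Proof. by split; [|exact: quot_piM]. Qed.
HB.instance Definition _ :=
  GRing.isZmodMorphism.Build A quot_alg quot_pi quot_pi_zmod.
HB.instance Definition _ :=
  GRing.isMonoidMorphism.Build A quot_alg quot_pi quot_pi_monoid.

Definition quot_kmap : {rmorphism K -> quot_alg} :=
  quot_pi \o (kmap : {rmorphism K -> A}).
Fact quot_kmapC (c : K) (u : quot_alg) : quot_kmap c * u = u * quot_kmap c.
Proof. by elim/quot_ind: u => x; rewrite -!quot_piM kmapC. Qed.
HB.instance Definition _ := isKAlgebra.Build K quot_alg quot_kmapC.

End QuotientAlgebra.

Section Modules.
Variable A : pzRingType.

Definition surj (U V : Type) (f : U -> V) : Prop := forall y, exists x, f x = y.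

Definition exact (U V W : lmodType A) (f : U -> V) (g : V -> W) : Prop :=
  forall y, g y = 0 <-> exists x, f x = y.

Definition injective_module (E : lmodType A) : Prop :=
  forall (U V : lmodType A) (i : {linear U -> V}) (f : {linear U -> E}),
    injective i -> exists g : {linear V -> E}, forall x, g (i x) = f x.

Definition projective_module (P : lmodType A) : Prop :=
  forall (U V : lmodType A) (q : {linear U -> V}) (f : {linear P -> V}),
    surj q -> exists g : {linear P -> U}, forall x, q (g x) = f x.

Definition inj_dim_le (n : nat) (M : lmodType A) : Prop :=
  exists (E : nat -> lmodType A) (eps : {linear M -> E 0%N})
         (d : forall i, {linear E i -> E i.+1}),
    [/\ forall i, injective_module (E i),
        forall i, (n < i)%N -> forall x : E i, x = 0,
        injective eps,
        exact eps (d 0%N) &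
        forall i, exact (d i) (d i.+1)].

(* P1 -f1-> P0 -f0-> M -> 0 is exact, and both f0 and f1 : P1 -> Ker f0 are
   projective covers, i.e. essential epimorphisms from projective modules. *)
Definition minimal_presentation (P1 P0 M : lmodType A)
    (f1 : {linear P1 -> P0}) (f0 : {linear P0 -> M}) : Prop :=
  [/\ projective_module P1 /\ projective_module P0,
      surj f0,
      exact f1 f0,
      forall (U : lmodType A) (g : {linear U -> P0}),
        surj (f0 \o g) -> surj g &
      forall (U : lmodType A) (g : {linear U -> P1}),
        exact (f1 \o g) f0 -> surj g].

Definition hom (U V : lmodType A) : Type := {linear U -> V}.

Section Hom.
Variables U V : lmodType A.
HB.instance Definition _ := gen_eqMixin (hom U V).
HB.instance Definition _ := gen_choiceMixin (hom U V).

Definition hom_fun (f : hom U V) : U -> V := (f : {linear U -> V}).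
Coercion hom_fun : hom >-> Funclass.

Lemma hom_eq (f g : hom U V) : (forall x, f x = g x) -> f = g.
Proof.
case: f => f [f1 f2]; case: g => g [g1 g2] fg.
have {fg} efg : f = g by apply/funext.
subst g; case: f1 f2 => f1 [f2]; case: g1 g2 => g1 [g2].
by rewrite (Prop_irrelevance f1 g1) (Prop_irrelevance f2 g2).
Qed.

Lemma homDE (f : hom U V) x y : f (x + y) = f x + f y.
Proof. exact: (linearD (f : {linear U -> V})). Qed.
Lemma homZE (f : hom U V) a x : f (a *: x) = a *: f x.
Proof. exact: (linearZZ (f : {linear U -> V})). Qed.

Definition hom_add (f g : hom U V) : hom U V :=
  ((f : {linear U -> V}) \+ (g : {linear U -> V})) : {linear U -> V}.
Definition hom_opp (f : hom U V) : hom U V :=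
  (\- (f : {linear U -> V})) : {linear U -> V}.
Definition hom_zero : hom U V := (\0 : {linear U -> V}).

Fact hom_addA : associative hom_add.
Proof. by move=> f g h; apply: hom_eq => x; exact: addrA. Qed.
Fact hom_addC : commutative hom_add.
Proof. by move=> f g; apply: hom_eq => x; exact: addrC. Qed.
Fact hom_add0 : left_id hom_zero hom_add.
Proof. by move=> f; apply: hom_eq => x; exact: add0r. Qed.
Fact hom_addN : left_inverse hom_zero hom_opp hom_add.
Proof. by move=> f; apply: hom_eq => x; exact: addNr. Qed.
HB.instance Definition _ :=
  GRing.isZmodule.Build (hom U V) hom_addA hom_addC hom_add0 hom_addN.

Definition mk_hom (f : U -> V) (f_linear : linear f) : hom U V :=
  HB.pack_for {linear U -> V} f (GRing.isLinear.Build A U V *:%R f f_linear).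

End Hom.

(* For a finite index type the direct sum is the product. *)
Section DirectSum.
Variables (I : finType) (M : I -> lmodType A).

Definition dsum : Type := forall i, M i.
HB.instance Definition _ := gen_eqMixin dsum.
HB.instance Definition _ := gen_choiceMixin dsum.

Definition dsum_add (x y : dsum) : dsum := fun i => x i + y i.
Definition dsum_opp (x : dsum) : dsum := fun i => - x i.
Definition dsum_zero : dsum := fun=> 0.
Definition dsum_scale (a : A) (x : dsum) : dsum := fun i => a *: x i.

Fact dsum_addA : associative dsum_add.
Proof. by move=> x y z; apply: functional_extensionality_dep => i; exact: addrA. Qed.
Fact dsum_addC : commutative dsum_add.
Proof. by move=> x y; apply: functional_extensionality_dep => i; exact: addrC. Qed.
Fact dsum_add0 : left_id dsum_zero dsum_add.
Proof. by move=> x; apply: functional_extensionality_dep => i; exact: add0r. Qed.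
Fact dsum_addN : left_inverse dsum_zero dsum_opp dsum_add.
Proof. by move=> x; apply: functional_extensionality_dep => i; exact: addNr. Qed.
HB.instance Definition _ :=
  GRing.isZmodule.Build dsum dsum_addA dsum_addC dsum_add0 dsum_addN.

Fact dsum_scaleA a b x : dsum_scale a (dsum_scale b x) = dsum_scale (a * b) x.
Proof. by apply: functional_extensionality_dep => i; exact: scalerA. Qed.
Fact dsum_scale1 : left_id 1 dsum_scale.
Proof. by move=> x; apply: functional_extensionality_dep => i; exact: scale1r. Qed.
Fact dsum_scaleDr : right_distributive dsum_scale +%R.
Proof. by move=> a x y; apply: functional_extensionality_dep => i; exact: scalerDr. Qed.
Fact dsum_scaleDl x : {morph dsum_scale^~ x : a b / a + b}.
Proof. by move=> a b; apply: functional_extensionality_dep => i; exact: scalerDl. Qed.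
HB.instance Definition _ := GRing.Zmodule_isLmodule.Build A dsum
  dsum_scaleA dsum_scale1 dsum_scaleDr dsum_scaleDl.

End DirectSum.

(* The left ideal A e, as a submodule of the regular module, for e idempotent:
   x is in A e iff x e = x. *)
Section LeftIdeal.
Variable e : A.

Definition in_left_ideal : pred A^o := fun x => x * e == x.

Fact in_left_ideal_submod : subsemimod_closed in_left_ideal.
Proof.
split; last first.
  by move=> a x /eqP xe; rewrite unfold_in -[X in X == _]mulrA [X in a * X]xe.
split; first by rewrite unfold_in mul0r.
by move=> x y /eqP xe /eqP ye; rewrite unfold_in mulrDl xe ye.
Qed.
HB.instance Definition _ :=
  GRing.isSubmodClosed.Build A A^o in_left_ideal in_left_ideal_submod.

Record left_ideal := LeftIdeal {
  left_ideal_val :> A^o;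
  left_idealP : left_ideal_val \in in_left_ideal
}.
HB.instance Definition _ := [isSub for left_ideal_val].
HB.instance Definition _ := [Choice of left_ideal by <:].
HB.instance Definition _ := [SubChoice_isSubLmodule of left_ideal by <:].

End LeftIdeal.

End Modules.

Section Transpose.
Variable A : pzRingType.

(* Right A-modules are left modules over the converse ring A^c. The left
   A-module Hom(P, A) of a right module P has (a f)(x) = a f(x). *)
Section RightDual.
Variable P : lmodType A^c.

Definition rdual : Type := hom P A^c^o.
HB.instance Definition _ := GRing.Zmodule.on rdual.

Fact rdual_scale_linear (a : A) (f : rdual) :
  linear (fun x => (a * (f x : A)) : A^c^o).
Proof.
move=> b x y; rewrite [f _](homDE f) (homZE f) mulrDr.
congr (_ + _); exact: (@mulrA A a (f x) b).
Qed.
Definition rdual_scale (a : A) (f : rdual) : rdual :=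
  mk_hom (rdual_scale_linear a f).

Fact rdual_scaleA a b f : rdual_scale a (rdual_scale b f) = rdual_scale (a * b) f.
Proof. by apply: hom_eq => x; exact: (@mulrA A a b (f x)). Qed.
Fact rdual_scale1 : left_id 1 rdual_scale.
Proof. by move=> f; apply: hom_eq => x; exact: (@mul1r A (f x)). Qed.
Fact rdual_scaleDr : right_distributive rdual_scale +%R.
Proof. by move=> a f g; apply: hom_eq => x; exact: (@mulrDr A a (f x) (g x)). Qed.
Fact rdual_scaleDl f : {morph rdual_scale^~ f : a b / a + b}.
Proof. by move=> a b; apply: hom_eq => x; exact: (@mulrDl A a b (f x)). Qed.
HB.instance Definition _ := GRing.Zmodule_isLmodule.Build A rdual
  rdual_scaleA rdual_scale1 rdual_scaleDr rdual_scaleDl.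

End RightDual.

(* N is a transpose of the right module X: the cokernel of
   Hom(f1, A) : Hom(P0, A) -> Hom(P1, A) for a minimal projective
   presentation P1 -f1-> P0 -> X -> 0. *)
Definition is_transpose (X : lmodType A^c) (N : lmodType A) : Prop :=
  exists (P1 P0 : lmodType A^c) (f1 : {linear P1 -> P0}) (f0 : {linear P0 -> X})
         (p : {linear rdual P1 -> N}),
    [/\ minimal_presentation f1 f0, surj p &
        forall g : rdual P1,
          p g = 0 <-> exists h : rdual P0, forall x, g x = h (f1 x)].

End Transpose.

Section AlgebraModules.
Variables (K : comPzRingType) (A : kalgType K).

(* The right module D M = Hom_K(M, K), with (f a)(m) = f(a m). *)
Section KDual.
Variable M : lmodType A.

Record kdual := KDual {
  kdual_fun :> M -> K;
  kdualD : forall x y, kdual_fun (x + y) = kdual_fun x + kdual_fun y;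
  kdualZ : forall (c : K) x, kdual_fun ((kmap c : A) *: x) = c * kdual_fun x
}.
HB.instance Definition _ := gen_eqMixin kdual.
HB.instance Definition _ := gen_choiceMixin kdual.

Lemma kdual_eq (f g : kdual) : (forall x, f x = g x) -> f = g.
Proof.
case: f g => f fD fZ [g gD gZ] /= /funext fg; subst g.
by rewrite (Prop_irrelevance fD gD) (Prop_irrelevance fZ gZ).
Qed.

Definition kdual_add (f g : kdual) : kdual.
Proof.
exists (fun x => f x + g x) => [x y|c x]; first by rewrite !kdualD addrACA.
by rewrite !kdualZ mulrDr.
Defined.
Definition kdual_opp (f : kdual) : kdual.
Proof.
by exists (fun x => - f x) => [x y|c x]; rewrite ?kdualD ?opprD // kdualZ mulrN.
Defined.
Definition kdual_zero : kdual.
Proof. by exists (fun=> 0) => [x y|c x]; rewrite ?addr0 ?mulr0. Defined.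
Definition kdual_scale (a : A^c) (f : kdual) : kdual.
Proof.
exists (fun x => f ((a : A) *: x)) => [x y|c x]; first by rewrite scalerDr kdualD.
by rewrite -kdualZ !scalerA kmapC.
Defined.

Fact kdual_addA : associative kdual_add.
Proof. by move=> f g h; apply: kdual_eq => x; exact: addrA. Qed.
Fact kdual_addC : commutative kdual_add.
Proof. by move=> f g; apply: kdual_eq => x; exact: addrC. Qed.
Fact kdual_add0 : left_id kdual_zero kdual_add.
Proof. by move=> f; apply: kdual_eq => x; exact: add0r. Qed.
Fact kdual_addN : left_inverse kdual_zero kdual_opp kdual_add.
Proof. by move=> f; apply: kdual_eq => x; exact: addNr. Qed.
HB.instance Definition _ :=
  GRing.isZmodule.Build kdual kdual_addA kdual_addC kdual_add0 kdual_addN.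

Fact kdual_scaleA a b f : kdual_scale a (kdual_scale b f) = kdual_scale (a * b) f.
Proof. by apply: kdual_eq => x /=; rewrite scalerA. Qed.
Fact kdual_scale1 : left_id 1 kdual_scale.
Proof. by move=> f; apply: kdual_eq => x /=; rewrite scale1r. Qed.
Fact kdual_scaleDr : right_distributive kdual_scale +%R.
Proof. by move=> a f g; apply: kdual_eq => x. Qed.
Fact kdual_scaleDl f : {morph kdual_scale^~ f : a b / a + b}.
Proof. by move=> a b; apply: kdual_eq => x /=; rewrite scalerDl kdualD. Qed.
HB.instance Definition _ := GRing.Zmodule_isLmodule.Build A^c kdual
  kdual_scaleA kdual_scale1 kdual_scaleDr kdual_scaleDl.

End KDual.

(* N is isomorphic to the inverse Auslander-Reiten translate Tr D M. *)
Definition is_tau_inv (M N : lmodType A) : Prop :=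
  is_transpose (kdual M : lmodType A^c) N.

(* End_A(T); the product f * g is first f, then g. *)
Section Endomorphisms.
Variable T : lmodType A.

Definition endo : Type := hom T T.
HB.instance Definition _ := GRing.Zmodule.on endo.

Definition endo_one : endo := (idfun : {linear T -> T}).
Definition endo_mul (f g : endo) : endo :=
  ((g : {linear T -> T}) \o (f : {linear T -> T})) : {linear T -> T}.

Fact endo_mulA : associative endo_mul.
Proof. by move=> f g h; apply: hom_eq. Qed.
Fact endo_mul1l : left_id endo_one endo_mul.
Proof. by move=> f; apply: hom_eq. Qed.
Fact endo_mul1r : right_id endo_one endo_mul.
Proof. by move=> f; apply: hom_eq. Qed.
Fact endo_mulDl : left_distributive endo_mul +%R.
Proof. by move=> f g h; apply: hom_eq => x; exact: (homDE h). Qed.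
Fact endo_mulDr : right_distributive endo_mul +%R.
Proof. by move=> f g h; apply: hom_eq. Qed.
HB.instance Definition _ := GRing.Zmodule_isPzRing.Build endo
  endo_mulA endo_mul1l endo_mul1r endo_mulDl endo_mulDr.

Fact endo_kmap_linear (c : K) : linear (fun x : T => (kmap c : A) *: x).
Proof. by move=> a x y; rewrite scalerDr !scalerA kmapC. Qed.
Definition endo_kmap (c : K) : endo := mk_hom (endo_kmap_linear c).

Fact endo_kmap_zmod : zmod_morphism endo_kmap.
Proof.
move=> a b; apply: hom_eq => x.
by rewrite [LHS](_ : _ = (kmap (a - b) : A) *: x) // rmorphB scalerBl.
Qed.
Fact endo_kmap_monoid : monoid_morphism endo_kmap.
Proof.
split; first by apply: hom_eq => x; rewrite [LHS](_ : _ = (kmap 1 : A) *: x) //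
  rmorph1 scale1r.
move=> a b; apply: hom_eq => x.
rewrite [LHS](_ : _ = (kmap (a * b) : A) *: x) // mulrC rmorphM -scalerA.
by [].
Qed.
HB.instance Definition _ :=
  GRing.isZmodMorphism.Build K endo endo_kmap endo_kmap_zmod.
HB.instance Definition _ :=
  GRing.isMonoidMorphism.Build K endo endo_kmap endo_kmap_monoid.
Fact endo_kmapC (c : K) (f : endo) : endo_kmap c * f = f * endo_kmap c.
Proof. by apply: hom_eq => x; exact: (homZE f). Qed.
HB.instance Definition _ := isKAlgebra.Build K endo endo_kmapC.

End Endomorphisms.
End AlgebraModules.

Record quiver := Quiver {
  vert : finType;
  arr : finType;
  src : arr -> vert;
  tgt : arr -> vert
}.

Definition quiver_connected (Q : quiver) : Prop :=
  forall x y : vert Q,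
    connect (fun u v => [exists a : arr Q,
      ((src a == u) && (tgt a == v)) || ((src a == v) && (tgt a == u))]) x y.

Definition is_source (Q : quiver) (k : vert Q) : Prop :=
  forall a : arr Q, tgt a != k.

Section Paths.
Variable Q : quiver.

Fixpoint is_path (x : vert Q) (s : seq (arr Q)) : bool :=
  if s is a :: s' then (src a == x) && is_path (tgt a) s' else true.

(* A path is its starting vertex with the sequence of its arrows, from left to
   right; (x, [::]) is the trivial path at x. *)
Definition qpath : Type :=
  {p : vert Q * seq (arr Q) | is_path p.1 p.2}.

Definition pstart (p : qpath) : vert Q := (val p).1.
Definition parrows (p : qpath) : seq (arr Q) := (val p).2.
Definition plen (p : qpath) : nat := size (parrows p).
Definition path_end (x : vert Q) (s : seq (arr Q)) : vert Q :=
  last x (map (@tgt Q) s).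
Definition pend (p : qpath) : vert Q := path_end (pstart p) (parrows p).

Lemma is_path_cat x s1 s2 :
  is_path x (s1 ++ s2) = is_path x s1 && is_path (path_end x s1) s2.
Proof. by elim: s1 x => //= a s1 IH x; rewrite IH andbA. Qed.

Lemma path_end_cat x s1 s2 :
  path_end x (s1 ++ s2) = path_end (path_end x s1) s2.
Proof. by rewrite /path_end map_cat last_cat. Qed.

Lemma qpath_eq (p q : qpath) :
  pstart p = pstart q -> parrows p = parrows q -> p = q.
Proof.
move=> h1 h2; apply: val_inj; move: h1 h2; rewrite /pstart /parrows.
by case: (val p) (val q) => [? ?] [? ?] /= -> ->.
Qed.

Fact ptake_subproof i (p : qpath) : is_path (pstart p) (take i (parrows p)).
Proof.
have : is_path (pstart p) (parrows p) by exact: (valP p).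
by rewrite -{1}(cat_take_drop i (parrows p)) is_path_cat => /andP[].
Qed.
Fact pdrop_subproof i (p : qpath) :
  is_path (path_end (pstart p) (take i (parrows p))) (drop i (parrows p)).
Proof.
have : is_path (pstart p) (parrows p) by exact: (valP p).
by rewrite -{1}(cat_take_drop i (parrows p)) is_path_cat => /andP[].
Qed.

(* The first i arrows of p, and the remaining ones. *)
Definition ptake i (p : qpath) : qpath := Sub (_, _) (ptake_subproof i p).
Definition pdrop i (p : qpath) : qpath := Sub (_, _) (pdrop_subproof i p).

Definition trivial_path (x : vert Q) : qpath := Sub (x, [::]) isT.

Fact arrow_path_subproof (a : arr Q) : is_path (src a) [:: a].
Proof. by rewrite /= eqxx. Qed.
Definition arrow_path (a : arr Q) : qpath :=
  Sub (src a, [:: a]) (arrow_path_subproof a).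

Lemma plen_take i p : plen (ptake i p) = minn i (plen p).
Proof. by rewrite /plen /parrows /= size_take_min. Qed.
Lemma plen_drop i p : plen (pdrop i p) = (plen p - i)%N.
Proof. by rewrite /plen /parrows /= size_drop. Qed.
Lemma ptake_take i j p : (i <= j)%N -> ptake i (ptake j p) = ptake i p.
Proof. by move=> ij; apply: qpath_eq => //; rewrite /parrows /= take_takel. Qed.
Lemma pdrop_drop i j p : pdrop j (pdrop i p) = pdrop (i + j) p.
Proof.
apply: qpath_eq; last by rewrite /parrows /= drop_drop addnC.
by rewrite /pstart /parrows /= takeD path_end_cat.
Qed.
Lemma pdrop_take i j p : pdrop i (ptake (i + j) p) = ptake j (pdrop i p).
Proof.
apply: qpath_eq; last by rewrite /parrows /= take_drop addnC.
by rewrite /pstart /parrows /= take_takel // leq_addr.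
Qed.
Lemma ptake_size p : ptake (plen p) p = p.
Proof. by apply: qpath_eq => //; rewrite /parrows /= take_size. Qed.
Lemma pdrop0 p : pdrop 0 p = p.
Proof. by apply: qpath_eq; rewrite /pstart /parrows /= ?take0 ?drop0. Qed.

End Paths.

Section CompletePathAlgebra.
Variables (K : comPzRingType) (Q : quiver).

(* A formal series, i.e. an element of \prod_i K Q_i, as the function giving
   the coefficient of each path. *)
Definition cpa : Type := qpath Q -> K.
HB.instance Definition _ := gen_eqMixin cpa.
HB.instance Definition _ := gen_choiceMixin cpa.

Definition cpa_add (f g : cpa) : cpa := fun p => f p + g p.
Definition cpa_opp (f : cpa) : cpa := fun p => - f p.
Definition cpa_zero : cpa := fun=> 0.
Definition cpa_mul (f g : cpa) : cpa :=
  fun p => \sum_(i < (plen p).+1) f (ptake i p) * g (pdrop i p).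
Definition cpa_const (c : K) : cpa := fun p => if plen p == 0%N then c else 0.

Fact cpa_addA : associative cpa_add.
Proof. by move=> f g h; apply/funext => p; exact: addrA. Qed.
Fact cpa_addC : commutative cpa_add.
Proof. by move=> f g; apply/funext => p; exact: addrC. Qed.
Fact cpa_add0 : left_id cpa_zero cpa_add.
Proof. by move=> f; apply/funext => p; exact: add0r. Qed.
Fact cpa_addN : left_inverse cpa_zero cpa_opp cpa_add.
Proof. by move=> f; apply/funext => p; exact: addNr. Qed.
HB.instance Definition _ :=
  GRing.isZmodule.Build cpa cpa_addA cpa_addC cpa_add0 cpa_addN.

Fact cpa_mulA : associative cpa_mul.
Proof.
move=> f g h; apply/funext => p; rewrite /cpa_mul.
pose F i m := f (ptake i p) * g (ptake (m - i) (pdrop i p)) * h (pdrop m p).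
transitivity (\sum_(0 <= i < (plen p).+1) \sum_(0 <= m < (plen p).+1 | (i <= m)%N)
    F i m).
  rewrite big_mkord; apply: eq_bigr => -[i /=]; rewrite ltnS => le_ip _.
  rewrite -(big_mkord xpredT (fun j => g (ptake j (pdrop i p)) *
    h (pdrop j (pdrop i p)))) /= big_distrr /= plen_drop.
  rewrite -(big_nat_widenl i 0 _ xpredT) //.
  have -> : \sum_(i <= m < (plen p).+1) F i m =
      \sum_(0 <= j < (plen p - i).+1) F i (j + i)%N.
    by rewrite -{1}[i]add0n big_addn subSn.
  apply: eq_bigr => j _; rewrite /F addnK pdrop_drop mulrA.
  by rewrite [(j + i)%N]addnC.
rewrite (exchange_big_dep xpredT) //= big_mkord; apply: eq_bigr => -[m /=].
rewrite ltnS => le_mp _; rewrite plen_take (minn_idPl le_mp).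
rewrite -(big_mkord xpredT (fun i => f (ptake i (ptake m p)) *
    g (pdrop i (ptake m p)))) /= big_distrl /=.
rewrite (@big_nat_widen _ _ _ 0 m.+1 (plen p).+1) //=.
apply: eq_big => [i|i]; first by rewrite ltnS.
by move=> le_im; rewrite /F ptake_take // -{3}(subnKC le_im) pdrop_take.
Qed.

Fact cpa_mulCl (c : K) f : cpa_mul (cpa_const c) f = fun p => c * f p.
Proof.
apply/funext => p; rewrite /cpa_mul big_ord_recl big1 /= => [|i _].
  by rewrite addr0 /cpa_const plen_take min0n eqxx pdrop0.
rewrite /cpa_const plen_take gtn_eqF ?mul0r // leq_min /=.
exact: leq_ltn_trans (ltn_ord i).
Qed.
Fact cpa_mulCr (c : K) f : cpa_mul f (cpa_const c) = fun p => f p * c.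
Proof.
apply/funext => p; rewrite /cpa_mul big_ord_recr big1 /= => [|i _].
  by rewrite add0r /cpa_const plen_drop subnn ptake_size.
by rewrite /cpa_const plen_drop subn_eq0 leqNgt ltn_ord mulr0.
Qed.
Fact cpa_mul1l : left_id (cpa_const 1) cpa_mul.
Proof. by move=> f; rewrite cpa_mulCl; apply/funext => p; rewrite mul1r. Qed.
Fact cpa_mul1r : right_id (cpa_const 1) cpa_mul.
Proof. by move=> f; rewrite cpa_mulCr; apply/funext => p; rewrite mulr1. Qed.
Fact cpa_mulDl : left_distributive cpa_mul +%R.
Proof.
move=> f g h; apply/funext => p; transitivity (\sum_(i < (plen p).+1)
  (f (ptake i p) * h (pdrop i p) + g (ptake i p) * h (pdrop i p))).
  by apply: eq_bigr => i _; exact: mulrDl.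
by rewrite big_split.
Qed.
Fact cpa_mulDr : right_distributive cpa_mul +%R.
Proof.
move=> f g h; apply/funext => p; transitivity (\sum_(i < (plen p).+1)
  (f (ptake i p) * g (pdrop i p) + f (ptake i p) * h (pdrop i p))).
  by apply: eq_bigr => i _; exact: mulrDr.
by rewrite big_split.
Qed.
HB.instance Definition _ := GRing.Zmodule_isPzRing.Build cpa
  cpa_mulA cpa_mul1l cpa_mul1r cpa_mulDl cpa_mulDr.

Fact cpa_const_zmod : zmod_morphism cpa_const.
Proof.
move=> a b; apply/funext => p.
transitivity (cpa_const a p - cpa_const b p); last by [].
by rewrite /cpa_const; case: (_ == _); rewrite ?subr0.
Qed.
Fact cpa_const_monoid : monoid_morphism cpa_const.
Proof.
split=> // a b; rewrite [RHS]cpa_mulCl; apply/funext => p.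
by rewrite /cpa_const /=; case: (_ == _); rewrite ?mulr0.
Qed.
HB.instance Definition _ :=
  GRing.isZmodMorphism.Build K cpa cpa_const cpa_const_zmod.
HB.instance Definition _ :=
  GRing.isMonoidMorphism.Build K cpa cpa_const cpa_const_monoid.
Fact cpa_constC (c : K) (f : cpa) : cpa_const c * f = f * cpa_const c.
Proof.
by rewrite [LHS]cpa_mulCl [RHS]cpa_mulCr; apply/funext => p; rewrite mulrC.
Qed.
HB.instance Definition _ := isKAlgebra.Build K cpa cpa_constC.

Definition path_series (p : qpath Q) : cpa := fun q => (q == p)%:R.

(* The coefficient of the path from x with arrow sequence s, and 0 when this
   is not a path. *)
Definition coef (f : cpa) (x : vert Q) (s : seq (arr Q)) : K :=
  oapp f 0 (insub (x, s)).

(* The n-th power \prod_(i >= n) K Q_i of the radical \prod_(i >= 1) K Q_i. *)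
Definition radical_power (n : nat) : set cpa :=
  [set f | forall p, (plen p < n)%N -> f p = 0].

Definition radical_closure (S : set cpa) : set cpa :=
  [set f | forall n, exists2 g, S g & radical_power n (f - g)].

Lemma radical_powerD n f g :
  radical_power n f -> radical_power n g -> radical_power n (f + g).
Proof.
move=> hf hg p lt_pn; transitivity (f p + g p); first by [].
by rewrite hf // hg // addr0.
Qed.
Lemma radical_powerN n f : radical_power n f -> radical_power n (- f).
Proof. by move=> hf p lt_pn; transitivity (- f p); rewrite // hf // oppr0. Qed.
Lemma radical_powerMl n f g : radical_power n g -> radical_power n (f * g).
Proof.
move=> hg p lt_pn; apply: big1 => i _; rewrite hg ?mulr0 // plen_drop.
by apply: leq_ltn_trans lt_pn; exact: leq_subr.
Qed.
Lemma radical_powerMr n f g : radical_power n f -> radical_power n (f * g).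
Proof.
move=> hf p lt_pn; apply: big1 => i _; rewrite hf ?mul0r // plen_take.
by apply: leq_ltn_trans lt_pn; exact: geq_minr.
Qed.

Lemma radical_closure_ideal (S : set cpa) :
  two_sided_ideal S -> two_sided_ideal (radical_closure S).
Proof.
case=> S0 SB SMl SMr; split.
- by move=> n; exists 0 => //; rewrite subrr.
- move=> x y Sx Sy n; have [x' Sx' hx] := Sx n; have [y' Sy' hy] := Sy n.
  exists (x' - y'); first exact: SB.
  rewrite [X in radical_power n X](_ : _ = (x - x') - (y - y')).
    by apply: radical_powerD => //; exact: radical_powerN.
  by rewrite !opprD !opprK addrACA.
- move=> a x Sx n; have [x' Sx' hx] := Sx n; exists (a * x'); first exact: SMl.
  by rewrite -mulrBr; exact: radical_powerMl.
- move=> a x Sx n; have [x' Sx' hx] := Sx n; exists (x' * a); first exact: SMr.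
  by rewrite -mulrBl; exact: radical_powerMr.
Qed.

Definition closed_ideal (S : set cpa) : ideal cpa :=
  Ideal (radical_closure_ideal (gen_ideal_ideal S)).

(* For W supported on cycles: a cycle with a marked occurrence of a is v a u,
   and it contributes the path u v to the cyclic derivative. *)
Definition cyclic_derivative (a : arr Q) (W : cpa) : cpa :=
  fun q => \sum_(i < (plen q).+1)
    let u := ptake i q in let v := pdrop i q in
    coef W (pstart v) (parrows v ++ a :: parrows u).

End CompletePathAlgebra.

(* Given a map of vertices and a replacement of arrows of Q' by sequences of
   arrows of Q, undefined for some arrows, the series on Q' whose coefficient at
   a path is that of f at its replacement, and 0 where this is undefined. *)
Section Substitution.
Variables (K : comPzRingType) (Q Q' : quiver).
Variables (h : vert Q' -> vert Q) (e : arr Q' -> option (seq (arr Q))).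

Fixpoint subst_arrows (s : seq (arr Q')) : option (seq (arr Q)) :=
  if s is a :: s' then
    if e a is Some t then omap (cat t) (subst_arrows s') else None
  else Some [::].

Definition pullback (f : cpa K Q) : cpa K Q' :=
  fun q => oapp (coef f (h (pstart q))) 0 (subst_arrows (parrows q)).

End Substitution.

(* Raw data (Q, W, C): neither that W is a combination of cycles nor that C is a
   cut is recorded. *)
Record qp_cut (K : comPzRingType) := QPCut {
  qp_quiver : quiver;
  qp_pot : cpa K qp_quiver;
  qp_arrows : pred (arr qp_quiver)
}.
Arguments qp_pot {K} _ _.
Arguments qp_arrows {K} _ _.

Section TruncatedJacobian.
Variables (K : comPzRingType) (X : qp_cut K).

Definition cut_quiver : quiver :=
  @Quiver (vert (qp_quiver X)) {a : arr (qp_quiver X) | ~~ qp_arrows X a}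
    (fun a => src (val a)) (fun a => tgt (val a)).

(* The part of a series on Q supported on the paths of Q_C. *)
Definition cut_restrict : cpa K (qp_quiver X) -> cpa K cut_quiver :=
  @pullback K (qp_quiver X) cut_quiver id (fun a => Some [:: val a]).

(* For a cut C this is the quotient of the Jacobian algebra by the closed ideal
   generated by C: each cycle of W has exactly one arrow in C, so the derivatives
   along C have no arrow of C, and the other ones lie in the ideal of C. *)
Definition trunc_jacobian : Type :=
  quot_alg (closed_ideal [set f | exists2 c, qp_arrows X c &
    f = cut_restrict (cyclic_derivative c (qp_pot X))]).
HB.instance Definition _ := KAlgebra.on trunc_jacobian.

End TruncatedJacobian.

(* For a general vertex k this is the (pre)mutation of a quiver without loops
   at k. *)
Section Mutation.
Variables (K : comPzRingType) (X : qp_cut K).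
Local Notation Q := (qp_quiver X).
Variable k : vert Q.

Definition arr_away : Type := {a : arr Q | (src a != k) && (tgt a != k)}.
Definition arr_out : Type := {a : arr Q | src a == k}.
Definition arr_in : Type := {b : arr Q | tgt b == k}.
HB.instance Definition _ := Finite.on arr_away.
HB.instance Definition _ := Finite.on arr_out.
HB.instance Definition _ := Finite.on arr_in.

Definition mut_arr : finType :=
  (arr_away + (arr_out + (arr_in + arr_in * arr_out)))%type.

Definition mut_old (a : arr_away) : mut_arr := inl a.
(* a^* : v -> k for a : k -> v *)
Definition mut_out (a : arr_out) : mut_arr := inr (inl a).
(* b^* : k -> u for b : u -> k *)
Definition mut_in (b : arr_in) : mut_arr := inr (inr (inl b)).
(* [b a] : u -> v *)
Definition mut_comp (b : arr_in) (a : arr_out) : mut_arr := inr (inr (inr (b, a))).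

Definition mut_src (x : mut_arr) : vert Q :=
  match x with
  | inl a => src (val a)
  | inr (inl a) => tgt (val a)
  | inr (inr (inl _)) => k
  | inr (inr (inr (b, _))) => src (val b)
  end.

Definition mut_tgt (x : mut_arr) : vert Q :=
  match x with
  | inl a => tgt (val a)
  | inr (inl _) => k
  | inr (inr (inl b)) => src (val b)
  | inr (inr (inr (_, a))) => tgt (val a)
  end.

Definition mut_quiver : quiver := @Quiver (vert Q) mut_arr mut_src mut_tgt.

Definition mut_expand (x : mut_arr) : option (seq (arr Q)) :=
  match x with
  | inl a => Some [:: val a]
  | inr (inl _) => None
  | inr (inr (inl _)) => None
  | inr (inr (inr (b, a))) => Some [:: val b; val a]
  end.

(* The series [f], for f supported on paths that neither start nor end at k: on
   these, replacing each b a by [b a] is injective, with inverse the expansion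
   of the arrows [b a] in the paths without starred arrows. *)
Definition mut_bracket : cpa K Q -> cpa K mut_quiver :=
  @pullback K Q mut_quiver id mut_expand.

Definition mut_arrow_series (x : mut_arr) : cpa K mut_quiver :=
  path_series K (@arrow_path mut_quiver x).

(* When X is the quiver with potential associated with an algebra and k is a
   source of the quiver of that algebra, the arrows b ending at k are the rho_r
   with s(r) = k, and the arrows starting at k are arrows of that quiver. *)
Definition mut_pot : cpa K mut_quiver :=
  mut_bracket (qp_pot X) +
  \sum_(b : arr_in) \sum_(a : arr_out)
    mut_arrow_series (mut_comp b a) * mut_arrow_series (mut_out a) *
    mut_arrow_series (mut_in b).

(* The arrows of C away from k, and the [b a] with b in C. *)
Definition mut_cut (x : mut_arr) : bool :=
  match x with
  | inl a => qp_arrows X (val a)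
  | inr (inl _) => false
  | inr (inr (inl _)) => false
  | inr (inr (inr (b, _))) => qp_arrows X (val b)
  end.

Definition mut_qp : qp_cut K := @QPCut K mut_quiver mut_pot mut_cut.

End Mutation.

Record quiver_relation (K : comPzRingType) (Q : quiver) := Relation {
  rel_src : vert Q;
  rel_tgt : vert Q;
  rel_series :> cpa K Q;
  rel_supp : forall p, rel_series p != 0 ->
    [/\ pstart p = rel_src, pend p = rel_tgt & (2 <= plen p)%N]
}.

Section Presentation.
Variables (K : comPzRingType) (Q : quiver) (R : finType).
Variable r : R -> quiver_relation K Q.

Definition minimal_relations : Prop :=
  forall i,
    ~ radical_closure (gen_ideal [set f | exists2 j, j != i & f = rel_series (r j)])
        (rel_series (r i)).

Definition bound_algebra : Type :=
  quot_alg (closed_ideal [set f | exists i, f = rel_series (r i)]).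
HB.instance Definition _ := KAlgebra.on bound_algebra.

Definition vertex_idempotent (i : vert Q) : bound_algebra :=
  \pi_bound_algebra (path_series K (trivial_path i)).

Definition indec_projective (i : vert Q) : lmodType bound_algebra :=
  left_ideal (vertex_idempotent i).

(* tau^- P_k (+) Lambda / P_k, for N = tau^- P_k *)
Definition apr_module (k : vert Q) (N : lmodType bound_algebra) :
    lmodType bound_algebra :=
  (N * dsum (fun i : {i : vert Q | i != k} => indec_projective (val i)))%type.

(* The arrow rho_r : e(r) -> s(r) is inr r. *)
Definition assoc_quiver : quiver :=
  @Quiver (vert Q) (arr Q + R)%type
    (fun x => match x with inl a => src a | inr i => rel_tgt (r i) end)
    (fun x => match x with inl a => tgt a | inr i => rel_src (r i) end).

(* Series on Q as series on Q_Lambda. *)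
Definition assoc_incl : cpa K Q -> cpa K assoc_quiver :=
  @pullback K Q assoc_quiver id
    (fun x => match x with inl a => Some [:: a] | inr _ => None end).

Definition assoc_pot : cpa K assoc_quiver :=
  \sum_(i : R) path_series K (@arrow_path assoc_quiver (inr i)) * assoc_incl (r i).

Definition assoc_cut (x : arr Q + R) : bool :=
  match x with inl _ => false | inr _ => true end.

Definition assoc_qp : qp_cut K := @QPCut K assoc_quiver assoc_pot assoc_cut.

End Presentation.

(* Main.v *)
Require Import Defs.
From HB Require Import structures.
From mathcomp Require Import all_boot all_order all_algebra.
From mathcomp Require Import boolp classical_sets.

(** Write I for the closed ideal of the relations, Lambda for the quotient by I
    and e_v for the trivial path at v. As Lambda is finite-dimensional, I
    contains a power of the radical (finite_dim_radical_nilpotent), so that all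
    infinite sums can be cut off. As k is a source, P_k = Lambda e_k is
    one-dimensional. The minimal presentation of its dual has the terms
    e_k Lambda and the sum of the e_(t(a)) Lambda over the arrows a out of k.
    Hence N, the inverse translate of P_k, is generated by elements nn_a with
    e_(t(a)) nn_a = nn_a, subject to the only relation that the sum of the
    a nn_a vanishes (tau_inverse_presentation). The sum of the other P_i is
    Lambda (1 - e_k), generated by 1 - e_k.

    Endomorphisms of the sum T of the two come in three kinds: right
    multiplication by series on Lambda (1 - e_k); for each arrow a out of k, the
    map a* that sends p to p nn_a; and for each relation r_i starting at k, the
    map rho_i* that sends nn_a to minus the left derivative lder a r_i. The last
    one is well defined since the sum of the a (lder a r_i) is r_i, which is zero
    in Lambda. The composite of a* and rho_i* is right multiplication by minus
    lder a r_i. These are exactly the generators and the relations of the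
    truncated Jacobian algebra of the mutation: the derivatives of the potential
    along the cut are the relations not starting at k and the elements
    lder a r_i + a* rho_i* (jacobian_relationP). This common structure is the
    notion of mutated_system. In every mutated system, products of generators
    reduce to normal forms
      x + sum x_a a* + sum rho_i* y_i + sum rho_i* z_ia a*,
    where the coefficients come from series over Q. Therefore the isomorphism
    follows (jacobian_iso) once each endomorphism of T is a normal form and a
    normal form that vanishes as an endomorphism has coefficients in I, up to
    the idempotents involved.

    The first point (endo_system_surj) holds because an endomorphism is given
    by the images of the generators, and because derivatives of elements of I
    along the arrows out of k are combinations of the lder a r_i modulo I
    (lder_ideal). The second point (endo_system_inj) is where the injective
    dimension enters: if the sum over i of the (lder a r_i) y_i lies in I for
    all arrows a out of k, then the y_i lie in I, up to the idempotent at the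
    end of r_i (second_syzygy_free). In other words, the minimal projective
    resolution of the dual of P_k has a monomorphism from its term of index two
    to its term of index one. Dually, the minimal injective coresolution of P_k
    has an epimorphism onto its term of index two. Comparison with the given
    coresolution of length two shows that the image of this map is a direct
    summand; it contains the socle by minimality of the relations
    (minimal_rel_comb), so it is everything. Finally, as P_k is non-injective,
    there is an arrow out of k, which pins down the scalar by which a normal
    form acts on N. *)

Set Implicit Arguments.
Unset Strict Implicit.
Unset Printing Implicit Defensive.

Import GRing.Theory.
Local Open Scope ring_scope.
Local Open Scope classical_set_scope.

(** * Series over the paths of a quiver and their left derivatives *)

Section Series.
Variables (K : comPzRingType) (Q : quiver).
Implicit Types (f g : cpa K Q) (p q : qpath Q) (a : arr Q) (v : vert Q).

Definition vertex_series v : cpa K Q := path_series K (trivial_path v).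
Definition arrow_series a : cpa K Q := path_series K (arrow_path a).
Local Notation vx := vertex_series.
Local Notation ar := arrow_series.

Lemma cpa_ext f g : (forall p, f p = g p) -> f = g.
Proof. by move=> fg; apply/funext. Qed.
Lemma cpaDE f g p : (f + g) p = f p + g p. Proof. by []. Qed.
Lemma cpaBE f g p : (f - g) p = f p - g p. Proof. by []. Qed.
Lemma cpa0E p : (0 : cpa K Q) p = 0. Proof. by []. Qed.
Lemma cpaME f g p :
  (f * g) p = \sum_(i < (plen p).+1) f (ptake i p) * g (pdrop i p).
Proof. by []. Qed.
Lemma cpa_sumE (I : Type) (s : seq I) (P : pred I) (F : I -> cpa K Q) p :
  (\sum_(i <- s | P i) F i) p = \sum_(i <- s | P i) F i p.
Proof. by elim/big_rec2: _ => // i y1 y2 _ <-. Qed.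
Lemma cpaZE (c : K) f p : (kmap c * f) p = c * f p.
Proof. by have /(congr1 (fun h => h p)) := cpa_mulCl c f. Qed.
Lemma cpa_kmapE (c : K) p :
  (kmap c : cpa K Q) p = if plen p == 0%N then c else 0.
Proof. by []. Qed.

Lemma plen_eq0 p : (plen p == 0%N) = (p == trivial_path (pstart p)).
Proof.
apply/eqP/eqP => [/size0nil h|->//].
exact: qpath_eq.
Qed.

Lemma vertex_seriesE v p : vx v p = (p == trivial_path v)%:R.
Proof. by []. Qed.
Lemma arrow_seriesE a p : ar a p = (p == arrow_path a)%:R.
Proof. by []. Qed.
Lemma trivial_path_eq u v : (trivial_path u == trivial_path v) = (u == v).
Proof. by apply/eqP/eqP => [/(congr1 (@pstart Q))|->]. Qed.
Lemma vertex_arrow0 a v : ar a (trivial_path v) = 0.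
Proof. by rewrite arrow_seriesE; case: eqP => // /(congr1 (@plen Q)). Qed.

Lemma vxM v f p : (vx v * f) p = (pstart p == v)%:R * f p.
Proof.
rewrite cpaME big_ord_recl big1 /= => [|i _].
  rewrite addr0 pdrop0 vertex_seriesE; congr ((nat_of_bool _)%:R * _).
  by apply/eqP/eqP => [/(congr1 (@pstart Q))|<-]//; apply: qpath_eq;
     rewrite /parrows //= take0.
rewrite vertex_seriesE; case: eqP => [/(congr1 (@plen Q))|_].
  by rewrite plen_take (minn_idPl _) //=; exact: ltn_ord i.
by rewrite mul0r.
Qed.

Lemma Mvx f v p : (f * vx v) p = f p * (pend p == v)%:R.
Proof.
rewrite cpaME big_ord_recr big1 /= => [|i _].
  rewrite add0r ptake_size vertex_seriesE; congr (_ * (nat_of_bool _)%:R).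
  apply/eqP/eqP => [/(congr1 (@pstart Q))|<-].
    by rewrite /pstart /= /plen take_size.
  by apply: qpath_eq; rewrite /pstart /parrows /= /plen ?take_size ?drop_size.
rewrite vertex_seriesE; case: eqP => [/(congr1 (@plen Q))|_].
  by rewrite plen_drop => /eqP; rewrite subn_eq0 leqNgt ltn_ord.
by rewrite mulr0.
Qed.

Lemma sum_vertex_series : \sum_v vx v = 1.
Proof.
apply/funext => p; rewrite cpa_sumE.
have -> : (1 : cpa K Q) p = (plen p == 0%N)%:R.
  by have := cpa_kmapE 1 p; rewrite rmorph1; case: (_ == _).
rewrite (bigD1 (pstart p)) //= big1 ?addr0 => [|v vp].
  by rewrite vertex_seriesE -plen_eq0.
rewrite vertex_seriesE; case: (p =P trivial_path v) => // pv.
by rewrite pv eqxx in vp.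
Qed.

Lemma vx_ar v a : vx v * ar a = if src a == v then ar a else 0.
Proof.
apply/funext => p; rewrite vxM arrow_seriesE.
case: (p =P arrow_path a) => [->|pa]; rewrite ?mulr0 /=.
  rewrite [pstart _]/(src a); case: (src a =P v) => _; rewrite ?mul0r //.
  by rewrite mul1r arrow_seriesE eqxx.
by case: (_ == v) => //; rewrite arrow_seriesE; case: eqP pa.
Qed.
Lemma ar_vx a v : ar a * vx v = if tgt a == v then ar a else 0.
Proof.
apply/funext => p; rewrite Mvx arrow_seriesE.
case: (p =P arrow_path a) => [->|pa]; rewrite ?mul0r /=.
  rewrite [pend _]/(tgt a); case: (tgt a =P v) => _; rewrite ?mulr0 //.
  by rewrite mulr1 arrow_seriesE eqxx.
by case: (_ == v) => //; rewrite arrow_seriesE; case: eqP pa.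
Qed.
Lemma vx_vx u v : vx u * vx v = if u == v then vx u else 0.
Proof.
apply/funext => p; rewrite vxM vertex_seriesE.
case: (u =P v) => [<-|uv].
  rewrite vertex_seriesE; case: (p =P trivial_path u) => [->|]; rewrite ?mulr0 //.
  by rewrite eqxx mulr1.
case: (p =P trivial_path v) => [->|]; rewrite ?mulr0 //= /pstart /= eq_sym.
by case: eqP uv => //; rewrite mul0r.
Qed.

(** The value is arbitrary unless p starts at the end of a. *)
Definition pcons a p : qpath Q := insubd p (src a, a :: parrows p).

Lemma val_pcons a p : pstart p = tgt a ->
  val (pcons a p) = (src a, a :: parrows p).
Proof.
move=> pa; rewrite val_insubd /= eqxx /= -pa.
by have /= -> := valP p.
Qed.

Lemma pcons_start a p : pstart p = tgt a -> pstart (pcons a p) = src a.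
Proof. by move=> pa; rewrite /pstart val_pcons. Qed.
Lemma pcons_arrows a p :
  pstart p = tgt a -> parrows (pcons a p) = a :: parrows p.
Proof. by move=> pa; rewrite /parrows val_pcons. Qed.
Lemma pcons_len a p : pstart p = tgt a -> plen (pcons a p) = (plen p).+1.
Proof. by move=> pa; rewrite /plen pcons_arrows. Qed.

Variant path_spec p : Prop :=
  | PathNil v of p = trivial_path v
  | PathCons a q of pstart q = tgt a & p = pcons a q.

Lemma qpathP p : path_spec p.
Proof.
case Ep: (parrows p) => [|a s].
  by apply: (@PathNil _ (pstart p)); exact: qpath_eq.
have: is_path (pstart p) (parrows p) by exact: (valP p).
rewrite Ep /= => /andP[/eqP ap hs].
have hq : is_path (tgt a, s).1 (tgt a, s).2 by [].
apply: (@PathCons _ a (Sub (tgt a, s) hq)) => //.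
by apply: qpath_eq; rewrite ?pcons_start ?pcons_arrows.
Qed.

Lemma series_coefE f p : coef f (pstart p) (parrows p) = f p.
Proof.
rewrite /coef; have -> : (pstart p, parrows p) = val p.
  by rewrite /pstart /parrows; case: (val p).
by rewrite valK.
Qed.

(** Left division by a: each series is its constant part plus the sum of the
    a * lder a f. This expansion is what inductions over the length of paths
    run on, and the derivatives along a cut are left divisions as well. *)
Definition lder a f : cpa K Q :=
  fun p => if pstart p == tgt a then f (pcons a p) else 0.

Lemma lderE a f p : pstart p = tgt a -> lder a f p = f (pcons a p).
Proof. by rewrite /lder => ->; rewrite eqxx. Qed.

Fact lder_is_zmod_morphism a : zmod_morphism (lder a).
Proof.
move=> f g; apply/funext => p; rewrite cpaBE /lder.
by case: eqP => // _; rewrite subr0.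
Qed.
HB.instance Definition _ a :=
  GRing.isZmodMorphism.Build (cpa K Q) (cpa K Q) (lder a)
    (lder_is_zmod_morphism a).

Lemma lderZ a c f : lder a (kmap c * f) = kmap c * lder a f.
Proof.
apply/funext => p; rewrite cpaZE /lder.
by case: eqP; rewrite ?mulr0 // cpaZE.
Qed.

Lemma lder_start a f : vx (tgt a) * lder a f = lder a f.
Proof.
apply/funext => p; rewrite vxM /lder.
by case: eqP; rewrite ?mul1r ?mul0r.
Qed.

Lemma pcons_eq_arrow a b p : pstart p = tgt a ->
  (pcons a p == arrow_path b) = (a == b) && (p == trivial_path (tgt a)).
Proof.
move=> pa; apply/eqP/andP => [h|[/eqP ab /eqP ->]].
  have := congr1 (@parrows Q) h; rewrite pcons_arrows // => -[ab h2].
  rewrite -ab; by rewrite eqxx; split => //; apply/eqP; apply: qpath_eq.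
apply: qpath_eq; rewrite ?pcons_start ?pcons_arrows ?ab //.
Qed.

Lemma ptake_pcons a p i :
  pstart p = tgt a -> ptake i.+1 (pcons a p) = pcons a (ptake i p).
Proof.
move=> pa; apply: qpath_eq.
  by rewrite (pcons_start (p := ptake i p)) // -(pcons_start pa).
rewrite (pcons_arrows (p := ptake i p)) //.
by rewrite [LHS](_ : _ = take i.+1 (parrows (pcons a p))) // pcons_arrows.
Qed.
Lemma pdrop_pcons a p i :
  pstart p = tgt a -> pdrop i.+1 (pcons a p) = pdrop i p.
Proof.
move=> pa; apply: qpath_eq; last first.
  by rewrite [LHS](_ : _ = drop i.+1 (parrows (pcons a p))) // pcons_arrows.
rewrite [LHS](_ : _ = path_end (pstart (pcons a p)) (take i.+1 (parrows (pcons a p)))) //.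
by rewrite pcons_arrows // /path_end /= -pa.
Qed.
Lemma ptake0 p : ptake 0 p = trivial_path (pstart p).
Proof. by apply: qpath_eq; rewrite /parrows /= ?take0. Qed.

(** A path of f g that starts with a has its first arrow in f, unless the
    part in f is trivial; so this twisted Leibniz rule holds. *)
Lemma lderM a f g :
  lder a (f * g) = lder a f * g + kmap (f (trivial_path (src a))) * lder a g.
Proof.
apply/funext => p; rewrite cpaDE cpaZE.
case: (pstart p =P tgt a) => [pa|pa]; last first.
  rewrite /lder; case: eqP => // _; rewrite mulr0 addr0.
  rewrite cpaME big1 // => i _.
  by case: eqP => //; rewrite mul0r.
rewrite !lderE // cpaME pcons_len // big_ord_recl /= addrC ptake0 pcons_start // pdrop0.
congr (_ + _); rewrite cpaME; apply: eq_bigr => i _.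
by rewrite lderE // ptake_pcons // pdrop_pcons.
Qed.

Lemma lder_vx a v : lder a (vx v) = 0.
Proof.
apply/funext => p; rewrite /lder; case: eqP => // pa.
rewrite vertex_seriesE; case: eqP => // /(congr1 (@plen Q)).
by rewrite pcons_len.
Qed.
Lemma lder_ar a b : lder a (ar b) = if a == b then vx (tgt b) else 0.
Proof.
apply/funext => p; rewrite /lder; case: eqP => pa.
  rewrite arrow_seriesE pcons_eq_arrow //.
  by case: (a =P b) => //= ->.
case: eqP => // ab; rewrite vertex_seriesE.
by case: eqP pa => // -> []; rewrite ab.
Qed.
Lemma lder_arM a b f :
  lder a (ar b * f) = if a == b then vx (tgt b) * f else 0.
Proof.
rewrite lderM lder_ar vertex_arrow0 rmorph0 mul0r addr0.
by case: eqP => // _; rewrite mul0r.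
Qed.
Lemma lder_vxM a v f :
  lder a (vx v * f) = if src a == v then lder a f else 0.
Proof.
rewrite lderM lder_vx mul0r add0r vertex_seriesE trivial_path_eq.
by case: eqP => _; rewrite ?rmorph1 ?rmorph0 ?mul1r ?mul0r.
Qed.
Lemma lder_kmap a c : lder a (kmap c) = 0.
Proof.
apply/funext => p; rewrite /lder; case: eqP => // pa.
by rewrite cpa_kmapE pcons_len.
Qed.

Lemma series_ext f g :
  (forall v, f (trivial_path v) = g (trivial_path v)) ->
  (forall a, lder a f = lder a g) -> f = g.
Proof.
move=> h1 h2; apply/funext => p; case: (qpathP p) => [v ->|a q qa ->] //.
by rewrite -!lderE // h2.
Qed.

Lemma trivM f g v :
  (f * g) (trivial_path v) = f (trivial_path v) * g (trivial_path v).
Proof.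
rewrite cpaME big_ord1 ptake0 pdrop0; congr (f _ * _); exact: qpath_eq.
Qed.

Lemma series_decomp f :
  f = \sum_v kmap (f (trivial_path v)) * vx v + \sum_a ar a * lder a f.
Proof.
apply: series_ext => [v|a].
  rewrite cpaDE !cpa_sumE [X in _ + X]big1 => [|a _]; last first.
    by rewrite trivM vertex_arrow0 mul0r.
  rewrite addr0 (bigD1 v) //= big1 => [|u uv].
    by rewrite addr0 cpaZE vertex_seriesE eqxx mulr1.
  by rewrite cpaZE vertex_seriesE trivial_path_eq eq_sym (negPf uv) mulr0.
rewrite raddfD /= !raddf_sum /= big1 ?add0r => [|v _]; last first.
  by rewrite lderZ lder_vx mulr0.
rewrite (bigD1 a) //= big1 ?addr0 => [|b ba].
  by rewrite lder_arM eqxx lder_start.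
by rewrite lder_arM eq_sym (negPf ba).
Qed.

Lemma lder_sum_ar v c (F : arr Q -> cpa K Q) :
  lder c (\sum_(a | src a == v) ar a * F a) =
  if src c == v then vx (tgt c) * F c else 0.
Proof.
rewrite raddf_sum /=; case: eqP => [/eqP cv|cv].
  rewrite (bigD1 c) //= lder_arM eqxx big1 ?addr0 // => b /andP[_ bc].
  by rewrite lder_arM eq_sym (negPf bc).
rewrite big1 // => b /eqP bv; rewrite lder_arM.
by case: (c =P b) => // cb; rewrite cb in cv.
Qed.

Lemma vertex_decomp v f :
  vx v * f = kmap (f (trivial_path v)) * vx v +
             \sum_(a | src a == v) ar a * lder a f.
Proof.
apply: series_ext => [u|c].
  rewrite cpaDE cpa_sumE [X in _ + X]big1 => [|a _]; last first.
    by rewrite trivM vertex_arrow0 mul0r.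
  rewrite addr0 cpaZE trivM vertex_seriesE trivial_path_eq.
  by case: eqP => [->|_]; rewrite ?mul1r ?mulr1 ?mul0r ?mulr0.
rewrite raddfD /= lder_sum_ar lderZ lder_vx mulr0 add0r lder_vxM.
by rewrite lder_start.
Qed.

Lemma radical_power0 n : radical_power n (0 : cpa K Q).
Proof. by []. Qed.
Lemma radical_power_le m n f : (m <= n)%N -> radical_power n f -> radical_power m f.
Proof. by move=> mn hf p pm; apply: hf; exact: leq_trans mn. Qed.
Lemma radical_power_lder n a f : radical_power n.+1 f -> radical_power n (lder a f).
Proof.
move=> hf p pn; rewrite /lder; case: eqP => // pa.
by apply: hf; rewrite pcons_len.
Qed.
Lemma radical_powerM m n f g :
  radical_power m f -> radical_power n g -> radical_power (m + n) (f * g).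
Proof.
move=> hf hg p pmn; rewrite cpaME big1 // => i _.
case: (ltnP i m) => im.
  rewrite hf ?mul0r // plen_take; exact: leq_ltn_trans (geq_minl _ _) im.
rewrite [X in _ * X]hg ?mulr0 // plen_drop ltn_subLR; last first.
  by rewrite -ltnS ltn_ord.
by rewrite (leq_trans pmn) // leq_add2r.
Qed.
Lemma radical_power_ar a : radical_power 1 (ar a).
Proof.
move=> p; rewrite ltnS leqn0 arrow_seriesE => /eqP p0.
by case: eqP => // pa; move: p0; rewrite pa.
Qed.
Lemma radical_power_sum (I : Type) (s : seq I) (P : pred I) (F : I -> cpa K Q) n :
  (forall i, P i -> radical_power n (F i)) ->
  radical_power n (\sum_(i <- s | P i) F i).
Proof.
move=> h; elim/big_rec: _ => // i x Pi hx; apply: radical_powerD => //; exact: h.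
Qed.
Lemma radical_power1P f :
  radical_power 1 f <-> forall v, f (trivial_path v) = 0.
Proof.
split=> [h v|h p]; first exact: h.
by rewrite ltnS leqn0 plen_eq0 => /eqP ->.
Qed.

End Series.

(** * Morphisms out of the complete path algebra *)

Section Universal.
Variables (K : comPzRingType) (Q : quiver) (A : kalgType K).
Local Notation vx := (vertex_series K).
Local Notation ar := (arrow_series K).

(** By induction on the length m of the prefixes already split off: a prefix
    w of length n - m kills all the series of order m, so that only finitely
    many expansion steps matter. This is uniqueness in the universal
    property. *)
Lemma eq_continuous_morph (phi psi : {rmorphism cpa K Q -> A}) n :
  (forall c, phi (kmap c) = kmap c) -> (forall c, psi (kmap c) = kmap c) ->
  (forall f, radical_power n f -> phi f = 0) ->
  (forall f, radical_power n f -> psi f = 0) ->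
  (forall v, phi (vx v) = psi (vx v)) -> (forall a, phi (ar a) = psi (ar a)) ->
  phi =1 psi.
Proof.
move=> phiK psiK phi0 psi0 hv ha.
suff H m w : (radical_power (n - m) w) -> (m <= n)%N -> phi w = psi w ->
    forall f, phi w * phi f = phi w * psi f.
  move=> f; have := H n 1; rewrite subnn !rmorph1 => /(_ _ _ _ f).
  by rewrite !mul1r; apply.
elim: m w => [|m IH] w.
  by rewrite subn0 => w0 _ _ f; rewrite phi0 ?mul0r.
move=> hw mn ew f; rewrite [f]series_decomp !rmorphD !rmorph_sum /= !mulrDr.
rewrite !mulr_sumr; congr (_ + _); apply: eq_bigr => x _.
  by rewrite !rmorphM /= phiK psiK hv.
rewrite !rmorphM /= !mulrA -ha -[phi w * _]rmorphM; apply: IH; last first.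
- by rewrite !rmorphM /= ew ha.
- exact: ltnW.
- rewrite -subSS subSn // -addn1.
  by apply: radical_powerM => //; exact: radical_power_ar.
Qed.

(** A series of order n is a finite sum of products of n arrows with series:
    expand n times to the left. *)
Lemma radical_power_morph0 (phi : {rmorphism cpa K Q -> A}) n :
  (forall c, phi (kmap c) = kmap c) ->
  (forall s : seq (arr Q), size s = n -> \prod_(a <- s) phi (ar a) = 0) ->
  forall f, radical_power n f -> phi f = 0.
Proof.
move=> phiK phi_nil f hf.
suff H m s : (size s + m)%N = n -> forall g, radical_power m g ->
    \prod_(a <- s) phi (ar a) * phi g = 0.
  by have := H n [::] erefl f hf; rewrite big_nil mul1r.
elim: m s => [|m IH] s sm g hg; first by rewrite phi_nil ?mul0r // -sm addn0.
rewrite [g]series_decomp [X in phi (X + _)]big1 ?add0r => [|v _]; last first.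
  by rewrite hg // rmorph0 mul0r.
rewrite rmorph_sum mulr_sumr big1 // => a _.
have := IH (rcons s a); rewrite size_rcons addSnnS => /(_ sm (lder a g)).
rewrite -cats1 big_cat big_seq1 /= rmorphM mulrA; apply.
exact: radical_power_lder.
Qed.

Variables (ep : vert Q -> A) (al : arr Q -> A) (n : nat).
Hypothesis ep_sum : \sum_v ep v = 1.
Hypothesis ep_orth : forall u v, ep u * ep v = if u == v then ep u else 0.
Hypothesis ep_al : forall a, ep (src a) * al a = al a.
Hypothesis al_ep : forall a, al a * ep (tgt a) = al a.
Hypothesis al_nil : forall s : seq (arr Q), size s = n -> \prod_(a <- s) al a = 0.

(** The truncation at length m of the substitution of al for the arrows;
    below, al is nilpotent of order n, so the truncation at n is already a
    ring morphism. *)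
Fixpoint eval_below (m : nat) (f : cpa K Q) : A :=
  if m is m'.+1 then \sum_v kmap (f (trivial_path v)) * ep v +
    \sum_a al a * eval_below m' (lder a f) else 0.

Fact eval_below_is_zmod_morphism m : zmod_morphism (eval_below m).
Proof.
elim: m => [|m IH] f g /=; first by rewrite subr0.
rewrite opprD addrACA -!sumrB; congr (_ + _); apply: eq_bigr => x _.
  by rewrite cpaBE rmorphB mulrBl.
by rewrite raddfB IH mulrBr.
Qed.
HB.instance Definition _ m :=
  GRing.isZmodMorphism.Build (cpa K Q) A (eval_below m)
    (eval_below_is_zmod_morphism m).

Lemma eval_belowZ m c f : eval_below m (kmap c * f) = kmap c * eval_below m f.
Proof.
elim: m f => [|m IH] f /=; first by rewrite mulr0.
rewrite mulrDr !mulr_sumr; congr (_ + _); apply: eq_bigr => x _.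
  by rewrite cpaZE rmorphM mulrA.
by rewrite lderZ IH !mulrA kmapC.
Qed.

Lemma eval_below_rad m f : radical_power m f -> eval_below m f = 0.
Proof.
elim: m f => [|m IH] f hf //=.
rewrite !big1 ?addr0 // => [a _|v _]; last by rewrite hf // rmorph0 mul0r.
by rewrite IH ?mulr0 //; exact: radical_power_lder.
Qed.

(** Expand n times to the left; the terms that remain have n factors in the
    image of al. *)
Lemma eval_belowS f : eval_below n.+1 f = eval_below n f.
Proof.
suff H m s : (size s + m)%N = n ->
    forall f, \prod_(a <- s) al a * eval_below m.+1 f =
              \prod_(a <- s) al a * eval_below m f.
  by have := H n [::] erefl f; rewrite big_nil !mul1r.
elim: m s => [|m IH] s sm g.
  by rewrite al_nil ?mul0r // -sm addn0.
rewrite [LHS]/= [RHS]/= !mulrDr !mulr_sumr; congr (_ + _).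
apply: eq_bigr => a _.
have := IH (rcons s a); rewrite size_rcons addSnnS => /(_ sm (lder a g)).
by rewrite -cats1 big_cat big_seq1 /= -!mulrA.
Qed.

Lemma eval_below_vxM m v f : eval_below m (vx v * f) = ep v * eval_below m f.
Proof.
case: m => [|m] /=; first by rewrite mulr0.
rewrite mulrDr !mulr_sumr; congr (_ + _); apply: eq_bigr => x _.
  rewrite trivM vertex_seriesE trivial_path_eq mulrA -kmapC -mulrA ep_orth eq_sym.
  by case: eqP => [->|_]; rewrite ?mul1r // mul0r rmorph0 mulr0 mul0r.
rewrite lder_vxM mulrA -[al x]ep_al mulrA ep_orth eq_sym.
by case: eqP => [->|_] //; rewrite raddf0 mulr0 !mul0r.
Qed.

Lemma eval_belowS_arM m a f :
  eval_below m.+1 (ar a * f) = al a * eval_below m f.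
Proof.
rewrite /= big1 ?add0r => [|v _]; last first.
  by rewrite trivM vertex_arrow0 mul0r rmorph0 mul0r.
rewrite (bigD1 a) //= big1 ?addr0 => [|b ba].
  by rewrite lder_arM eqxx eval_below_vxM mulrA al_ep.
by rewrite lder_arM (negPf ba) raddf0 mulr0.
Qed.

Definition eval_series : cpa K Q -> A := eval_below n.
HB.instance Definition _ := GRing.isZmodMorphism.Build (cpa K Q) A eval_series
  (eval_below_is_zmod_morphism n).

Lemma eval_series_arM a f : eval_series (ar a * f) = al a * eval_series f.
Proof. by rewrite /eval_series -eval_belowS eval_belowS_arM. Qed.

Lemma eval_series1 : eval_series 1 = 1.
Proof.
rewrite /eval_series -eval_belowS -(rmorph1 (kmap : {rmorphism K -> cpa K Q})) /=.
rewrite [X in _ + X]big1 ?addr0 => [|a _]; last first.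
  by rewrite lder_kmap raddf0 mulr0.
rewrite -ep_sum; apply: eq_bigr => v _.
by rewrite cpa_kmapE /= rmorph1 mul1r.
Qed.

(** Expand the left factor arrow by arrow. The arrows split off are kept as a
    prefix s, and after n of them everything vanishes. *)
Lemma eval_seriesM f g : eval_series (f * g) = eval_series f * eval_series g.
Proof.
suff H m s : (size s + m)%N = n ->
    forall f g, \prod_(a <- s) al a * eval_series (f * g) =
              \prod_(a <- s) al a * eval_below m f * eval_series g.
  by have := H n [::] erefl f g; rewrite big_nil !mul1r.
elim: m s {f g} => [|m IH] s sm f g.
  by rewrite al_nil ?mul0r // -sm addn0.
rewrite {1}[f]series_decomp mulrDl !mulr_suml raddfD !raddf_sum /=.
rewrite !mulrDr !mulrDl !mulr_sumr !mulr_suml; congr (_ + _).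
  apply: eq_bigr => v _.
  by rewrite -[_ * vx v * g]mulrA [eval_series _]eval_belowZ [eval_below _ _]eval_below_vxM !mulrA.
apply: eq_bigr => a _; rewrite -[ar a * _ * g]mulrA eval_series_arM.
have := IH (rcons s a); rewrite size_rcons addSnnS => /(_ sm (lder a f) g).
by rewrite -cats1 big_cat big_seq1 /= -!mulrA.
Qed.

HB.instance Definition _ := GRing.isMonoidMorphism.Build (cpa K Q) A eval_series
  (conj eval_series1 eval_seriesM).

(** The universal property of the complete path algebra, for nilpotent images
    of the arrows. *)
Lemma series_universal : exists phi : {rmorphism cpa K Q -> A},
  [/\ forall c, phi (kmap c) = kmap c,
      forall f, radical_power n f -> phi f = 0,
      forall v, phi (vx v) = ep v & forall a, phi (ar a) = al a].
Proof.
exists (eval_series : {rmorphism cpa K Q -> A}); split.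
- by move=> c; rewrite -[kmap c in LHS]mulr1 [LHS]eval_belowZ [X in _ * X]eval_series1 mulr1.
- exact: eval_below_rad.
- move=> v; rewrite -[vx v]mulr1 [LHS]eval_below_vxM [X in _ * X]eval_series1.
  by rewrite mulr1.
- by move=> a; rewrite -[ar a]mulr1 [LHS]eval_series_arM eval_series1 mulr1.
Qed.

End Universal.

(** * Closed ideals *)

Lemma gen_ideal_sub (A : pzRingType) (S : set A) (P : set A) :
  two_sided_ideal P -> (forall x, S x -> P x) -> forall x, gen_ideal S x -> P x.
Proof. by move=> iP SP x; apply; split. Qed.

Lemma sub_gen_ideal (A : pzRingType) (S : set A) x : S x -> gen_ideal S x.
Proof. by move=> Sx I [_]; apply. Qed.

Lemma ideal_sum (K : pzRingType) (A : kalgType K) (I : ideal A) (T : Type) (s : seq T)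
    (P : pred T) (F : T -> A) :
  (forall i, P i -> I (F i)) -> I (\sum_(i <- s | P i) F i).
Proof.
move=> h; elim/big_rec: _ => [|i x Pi Ix]; first exact: ideal0.
by apply: idealD => //; exact: h.
Qed.
Arguments ideal_sum {K A} I {T s P F}.

Lemma two_sided_idealD (A : pzRingType) (P : set A) x y :
  two_sided_ideal P -> P x -> P y -> P (x + y).
Proof.
case=> P0 PB _ _ Px Py; rewrite -[y]opprK; apply: (PB) => //.
by rewrite -sub0r; exact: PB.
Qed.
Lemma two_sided_ideal_sum (A : pzRingType) (P : set A) (T : Type) (s : seq T)
    (p : pred T) (F : T -> A) : two_sided_ideal P ->
  (forall i, p i -> P (F i)) -> P (\sum_(i <- s | p i) F i).
Proof.
move=> iP h; elim/big_rec: _ => [|i x Pi Ix]; first by case: iP.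
by apply: two_sided_idealD => //; exact: h.
Qed.

Section Scalars.
Variables (K : pzRingType) (A : kalgType K).
Lemma kmapM (c d : K) : (kmap (c * d) : A) = kmap c * kmap d.
Proof. exact: (rmorphM (kmap : {rmorphism K -> A})). Qed.
Lemma kmapD (c d : K) : (kmap (c + d) : A) = kmap c + kmap d.
Proof. exact: (rmorphD (kmap : {rmorphism K -> A})). Qed.
Lemma kmapN (c : K) : (kmap (- c) : A) = - kmap c.
Proof. exact: (rmorphN (kmap : {rmorphism K -> A})). Qed.
Lemma kmap0 : (kmap (0 : K) : A) = 0.
Proof. exact: (rmorph0 (kmap : {rmorphism K -> A})). Qed.
Lemma kmap1 : (kmap (1 : K) : A) = 1.
Proof. exact: (rmorph1 (kmap : {rmorphism K -> A})). Qed.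
Lemma kmap_sum (T : Type) (s : seq T) (P : pred T) (F : T -> K) :
  (kmap (\sum_(i <- s | P i) F i) : A) = \sum_(i <- s | P i) kmap (F i).
Proof. exact: (rmorph_sum (kmap : {rmorphism K -> A})). Qed.
End Scalars.

Section QuotientMap.
Variables (K : pzRingType) (A : kalgType K) (I : ideal A).
Lemma quot_piDE x y : quot_pi I (x + y) = quot_pi I x + quot_pi I y.
Proof. exact: (rmorphD (quot_pi I)). Qed.
Lemma quot_piBE x y : quot_pi I (x - y) = quot_pi I x - quot_pi I y.
Proof. exact: (rmorphB (quot_pi I)). Qed.
Lemma quot_piME x y : quot_pi I (x * y) = quot_pi I x * quot_pi I y.
Proof. exact: (rmorphM (quot_pi I)). Qed.
Lemma quot_pi0 : quot_pi I 0 = 0.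
Proof. exact: (rmorph0 (quot_pi I)). Qed.
Lemma quot_pi_sum (T : Type) (s : seq T) (P : pred T) (F : T -> A) :
  quot_pi I (\sum_(i <- s | P i) F i) = \sum_(i <- s | P i) quot_pi I (F i).
Proof. exact: (rmorph_sum (quot_pi I)). Qed.
Lemma quot_pi_eq0 x : quot_pi I x = 0 <-> I x.
Proof. by rewrite -quot_pi0 -[in X in _ <-> X](subr0 x); exact: quot_algP. Qed.
Lemma quot_pi_surj u : exists x, quot_pi I x = u.
Proof. by elim/quot_ind: u => x; exists x. Qed.
End QuotientMap.

Section Closed.
Variables (K : comPzRingType) (Q : quiver).
Implicit Types (S : set (cpa K Q)).

Lemma radical_power_ideal n : two_sided_ideal (@radical_power K Q n).
Proof.
split.
- exact: radical_power0.
- by move=> x y hx hy; apply: radical_powerD => //; exact: radical_powerN.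
- by move=> a x; exact: radical_powerMl.
- by move=> a x; exact: radical_powerMr.
Qed.

Lemma ideal_radical_power (I : ideal (cpa K Q)) n :
  two_sided_ideal [set f | exists2 g, I g & radical_power n (f - g)].
Proof.
split.
- by exists 0; [exact: ideal0|rewrite subrr].
- move=> x y [x' Ix hx] [y' Iy hy]; exists (x' - y'); first exact: idealB.
  rewrite (_ : _ - _ = (x - x') - (y - y')); last by rewrite !opprD !opprK addrACA.
  by have [_ + _ _] := radical_power_ideal n; apply.
- move=> a x [x' Ix hx]; exists (a * x'); first exact: idealMl.
  by rewrite -mulrBr; exact: radical_powerMl.
- move=> a x [x' Ix hx]; exists (x' * a); first exact: Defs.idealMr.
  by rewrite -mulrBl; exact: radical_powerMr.
Qed.

Lemma closed_ideal_gen S f : S f -> closed_ideal S f.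
Proof. by move=> Sf n; exists f; [exact: sub_gen_ideal|rewrite subrr]. Qed.

Lemma closed_idealP S f :
  (forall n, exists2 g, closed_ideal S g & radical_power n (f - g)) ->
  closed_ideal S f.
Proof.
move=> h n; have [g /(_ n)[g' Sg' hg'] hg] := h n; exists g' => //.
rewrite -(subrK g f) -addrA; exact: radical_powerD.
Qed.

Lemma closed_ideal_sub S n (P : set (cpa K Q)) :
  two_sided_ideal P -> (forall f, radical_power n f -> P f) ->
  (forall f, S f -> P f) -> forall f, closed_ideal S f -> P f.
Proof.
move=> iP Pn PS f /(_ n)[g Sg hg]; rewrite -(subrK g f).
apply: two_sided_idealD => //; first exact: Pn.
exact: gen_ideal_sub Sg.
Qed.

End Closed.

(** More vectors than generators are linearly dependent: the matrix of their
    coordinates has a nonzero left kernel. *)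
Lemma finite_dim_dependent (K : fieldType) (A : kalgType K) :
  finite_dimensional A -> exists d : nat, forall x : 'I_d -> A,
    exists2 u : 'I_d -> K, (exists j, u j != 0) & \sum_j kmap (u j) * x j = 0.
Proof.
case=> d [b hb]; exists d.+1 => x.
have [C hC] := choice (fun j => hb (x j)).
pose M : 'M[K]_(d.+1, d) := \matrix_(j, i) C j i.
have /rowV0Pn[u /sub_kermxP uM u0] : kermx M != 0.
  rewrite -mxrank_eq0 mxrank_ker -lt0n subn_gt0.
  by rewrite (leq_ltn_trans (rank_leq_col M)).
exists (u 0).
  have /existsP[j0 uj0] : [exists j, u 0 j != 0].
    apply: contraNT u0 => /existsPn h; apply/eqP/rowP => i.
    by rewrite mxE; apply/eqP; rewrite -[_ == _]negbK h.
  by exists j0.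
transitivity (\sum_i kmap ((u *m M) 0 i) * b i); last first.
  by rewrite uM big1 // => i _; rewrite mxE kmap0 mul0r.
under [RHS]eq_bigr => i _ do rewrite mxE kmap_sum mulr_suml.
rewrite exchange_big /=; apply: eq_bigr => j _.
rewrite hC mulr_sumr; apply: eq_bigr => i _.
by rewrite mxE kmapM mulrA.
Qed.

Section FiniteDim.
Variables (K : fieldType) (Q : quiver) (S : set (cpa K Q)).
Local Notation I := (closed_ideal S).

(** If the ideal contained no power of the radical, there would be series F_m
    of order m that stay outside the closed ideal up to some finite length.
    Choosing their orders to grow fast enough gives arbitrarily many classes
    which are independent: in a vanishing combination, the term of least
    order would be congruent to an element of the ideal modulo a high power
    of the radical. *)
Lemma finite_dim_radical_nilpotent :
  finite_dimensional (quot_alg I) ->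
  exists n, forall f, radical_power n f -> I f.
Proof.
move/finite_dim_dependent=> [d hd]; apply: contrapT => /forallNP hn.
have step m : exists fn : cpa K Q * nat, radical_power m fn.1 /\
    forall g, I g -> ~ radical_power fn.2 (fn.1 - g).
  have /existsNP[f /not_implyP[hf nIf]] := hn m.
  apply: contrapT => /forallNP h; apply: nIf; apply: closed_idealP => n.
  have /not_andP[//|/existsNP[g /not_implyP[Ig /contrapT hg]]] := h (f, n).
  by exists g.
have [F hF] := choice step.
(* m_j bounds the lengths at which the series F_(m_i) with i < j stay outside
   the ideal. *)
pose fix m j := if j is j'.+1 then maxn (m j') (F (m j')).2 else 0%N.
have m_mono i j : (i <= j)%N -> (m i <= m j)%N.
  move/subnK <-; elim: (j - i)%N => //= l IH.
  by rewrite (leq_trans IH) // leq_maxl.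
have [u [j0 uj0] hu] := hd (fun j => quot_pi I (F (m j)).1).
have Iu : I (\sum_j kmap (u j) * (F (m j)).1).
  apply/quot_pi_eq0; rewrite quot_pi_sum -[RHS]hu.
  by apply: eq_bigr => j _; rewrite quot_piME.
have [j uj min_j] : exists2 j, u j != 0 & forall i : 'I_d, (i < j)%N -> u i = 0.
  case: (@arg_minnP 'I_d j0 (fun j => u j != 0) (fun j : 'I_d => j : nat) uj0) => j uj hj.
  exists j => // i ij; apply/eqP; apply: contraTT ij => /hj.
  by rewrite -leqNgt.
have [_ hFj] := hF (m j).
apply: (hFj (kmap (u j)^-1 * \sum_i kmap (u i) * (F (m i)).1)).
  exact: idealMl.
rewrite (bigD1 j) //= mulrDr mulrA -kmapM mulVf // kmap1 mul1r.
rewrite opprD addrA subrr sub0r; apply: radical_powerN; apply: radical_powerMl.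
apply: radical_power_sum => i ij; case: (ltngtP i j) => [lt_ij|lt_ji|e_ij].
- by rewrite min_j // kmap0 mul0r.
- apply: radical_powerMl; have [+ _] := hF (m i); apply: radical_power_le.
  by rewrite (leq_trans _ (m_mono _ _ lt_ji)) //= leq_maxr.
- by rewrite (val_inj e_ij) eqxx in ij.
Qed.

End FiniteDim.

(** * Relations and the paths leaving a source *)

Section Source.
Variables (K : comPzRingType) (Q : quiver) (k : vert Q).
Hypothesis k_source : is_source k.
Local Notation vx := (vertex_series K).
Local Notation ar := (arrow_series K).

Lemma source_end (p : qpath Q) : pend p = k -> p = trivial_path k.
Proof.
rewrite /pend /path_end; move Ep: (parrows p) => s.
case/lastP: s Ep => [|s b] Ep; first by move=> pk; apply: qpath_eq.
rewrite map_rcons last_rcons => bk.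
by have := k_source b; rewrite bk eqxx.
Qed.

(** The trivial path is the only path that ends at a source. *)
Lemma Mvx_source (f : cpa K Q) : f * vx k = kmap (f (trivial_path k)) * vx k.
Proof.
apply/funext => p; rewrite Mvx cpaZE vertex_seriesE.
case: (p =P trivial_path k) => [->|pk]; first by rewrite (_ : pend _ = k) ?eqxx.
by case: eqP => [/source_end|]; rewrite ?mulr0.
Qed.
End Source.

Section Relations.
Variables (K : fieldType) (Q : quiver) (R : finType).
Variables (r : R -> quiver_relation K Q) (k : vert Q).
Local Notation vx := (vertex_series K).
Local Notation ar := (arrow_series K).
Local Notation I := (closed_ideal [set f | exists i, f = rel_series (r i)]).

Local Notation rs i := (rel_series (r i)).

Lemma rel_in_ideal i : I (rs i).
Proof. by apply: closed_ideal_gen; exists i. Qed.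

Lemma rel_rad2 i : radical_power 2 (rel_series (r i)).
Proof.
move=> p p2; apply/eqP; apply: contraTT p2 => /(@rel_supp _ _ (r i))[_ _].
by rewrite -leqNgt.
Qed.

Lemma ideal_rad2 f : I f -> radical_power 2 f.
Proof.
apply: closed_ideal_sub; first exact: radical_power_ideal.
  by move=> g; exact.
by move=> g [i ->]; exact: rel_rad2.
Qed.

Lemma rel_start i : vx (rel_src (r i)) * rs i = rs i.
Proof.
apply/funext => p; rewrite vxM.
have [->|/(@rel_supp _ _ (r i))[-> _ _]] := eqVneq (rel_series (r i) p) 0.
  by rewrite mulr0.
by rewrite eqxx mul1r.
Qed.
Lemma rel_end i : rs i * vx (rel_tgt (r i)) = rs i.
Proof.
apply/funext => p; rewrite Mvx.
have [->|/(@rel_supp _ _ (r i))[_ -> _]] := eqVneq (rel_series (r i) p) 0.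
  by rewrite mul0r.
by rewrite eqxx mulr1.
Qed.
Lemma lder_rel_src a i : src a != rel_src (r i) -> lder a (rs i) = 0.
Proof. by rewrite -(rel_start i) lder_vxM => /negPf ->. Qed.
Lemma lder_rel_end a i : lder a (rs i) * vx (rel_tgt (r i)) = lder a (rs i).
Proof. by rewrite -{2}(rel_end i) lderM (rel_rad2 i) // kmap0 mul0r addr0. Qed.
Lemma lder_rel_rad a i : radical_power 1 (lder a (rs i)).
Proof. exact/radical_power_lder/rel_rad2. Qed.

(** The coefficient at the arrow a of the image of y under the map from the
    second to the first term of a projective resolution of the right module
    dual to the simple projective at k: the relations r_i starting at k
    generate the kernel of the map given by the arrows out of k. *)
Definition rel_comb (y : R -> cpa K Q) (a : arr Q) : cpa K Q :=
  \sum_(i | rel_src (r i) == k) lder a (rs i) * y i.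

Lemma rel_combD y z a : rel_comb (fun i => y i + z i) a = rel_comb y a + rel_comb z a.
Proof. by rewrite /rel_comb -big_split; apply: eq_bigr => i _; rewrite mulrDr. Qed.
Lemma rel_combN y a : rel_comb (fun i => - y i) a = - rel_comb y a.
Proof. by rewrite /rel_comb -sumrN; apply: eq_bigr => i _; rewrite mulrN. Qed.
Lemma rel_combMr y f a : rel_comb (fun i => y i * f) a = rel_comb y a * f.
Proof. by rewrite /rel_comb mulr_suml; apply: eq_bigr => i _; rewrite mulrA. Qed.

Variable n : nat.
Hypothesis I_nil : forall f, radical_power n f -> I f.

(** The derivative of h r g along an arrow a out of k is h(e_k) (lder a r) g
    plus an element of the ideal. So the property holds for the ideal
    generated by the relations, and it passes to the closure because a power
    of the radical lies in I. *)
Lemma lder_ideal f : I f ->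
  exists y, forall a, src a = k -> I (lder a f - rel_comb y a).
Proof.
pose P : set (cpa K Q) := [set f | [/\ I f, f (trivial_path k) = 0 &
   exists y, forall a, src a = k -> I (lder a f - rel_comb y a)]].
have rcc (y : R -> cpa K Q) c a : rel_comb (fun i => kmap c * y i) a = kmap c * rel_comb y a.
  by rewrite /rel_comb mulr_sumr; apply: eq_bigr => i _; rewrite !mulrA kmapC.
have iP : two_sided_ideal P.
  split.
  - split; [exact: ideal0|by []|].
    exists (fun=> 0) => a _; rewrite raddf0 sub0r -rel_combN.
    rewrite /rel_comb big1; first exact: ideal0.
    by move=> i _; rewrite oppr0 mulr0.
  - move=> f1 f2 [If1 f10 [y1 h1]] [If2 f20 [y2 h2]]; split.
    + exact: idealB.
    + by rewrite cpaBE f10 f20 subrr.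
    + exists (fun i => y1 i + - y2 i) => a ak.
      rewrite rel_combD rel_combN.
      have -> : lder a (f1 - f2) - (rel_comb y1 a - rel_comb y2 a) =
          (lder a f1 - rel_comb y1 a) - (lder a f2 - rel_comb y2 a).
        by rewrite raddfB !opprD !opprK addrACA.
      by apply: idealB; [exact: h1|exact: h2].
  - move=> h g [Ig g0 [y hy]]; split; first exact: idealMl.
      by rewrite trivM g0 mulr0.
    exists (fun i => kmap (h (trivial_path k)) * y i) => a ak.
    rewrite rcc lderM ak -addrA -mulrBr; apply: idealD; first exact: idealMl.
    by apply: idealMl; exact: hy.
  - move=> h g [Ig g0 [y hy]]; split; first exact: Defs.idealMr.
      by rewrite trivM g0 mul0r.
    exists (fun i => y i * h) => a ak.
    rewrite rel_combMr lderM ak g0 kmap0 mul0r addr0 -mulrBl.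
    by apply: Defs.idealMr; exact: hy.
move=> If; have [g Sg hg] := If n.+1.
have [_ _ [y hy]] : P g.
  apply: gen_ideal_sub Sg => // _ [i ->]; split; first exact: rel_in_ideal.
    by rewrite (rel_rad2 i).
  exists (fun j => if j == i then 1 else 0) => a ak.
  rewrite /rel_comb; have [ik|ik] := eqVneq (rel_src (r i)) k; last first.
    have -> : lder a (rs i) = 0 by apply: lder_rel_src; rewrite ak eq_sym.
    rewrite sub0r; apply: idealN; apply: ideal_sum => j jk.
    suff -> : lder a (rs j) * (if j == i then 1 else 0) = 0 by exact: ideal0.
    by case: eqP => [ji|_]; rewrite ?mulr0 //; rewrite ji (negPf ik) in jk.
  rewrite (bigD1 i) ?ik //= eqxx mulr1 big1 => [|j /andP[_ /negPf ->]].
    by rewrite addr0 subrr; exact: (@ideal0 _ _ I).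
  by rewrite mulr0.
exists y => a ak; rewrite -(subrK g f) raddfD -addrA; apply: idealD; last exact: hy.
by apply: I_nil; exact: radical_power_lder.
Qed.

Hypothesis r_min : minimal_relations r.

(** If the coefficient c of y_j at the trivial path were nonzero, the sum of
    the r_i y_i could be solved for r_j: it lies in the radical times I, so
    r_j would be in the ideal S generated by the other relations, up to terms
    in the radical times I and in I times the radical. Iterating this puts
    r_j in the closure of S, against minimality. *)
Lemma minimal_rel_comb y : (forall a, src a = k -> I (rel_comb y a)) ->
  forall j, rel_src (r j) = k -> y j (trivial_path (rel_tgt (r j))) = 0.
Proof.
move=> hy j jk; apply/eqP; apply: contrapT => /negP c0.
set c := y j _ in c0.
pose f := \sum_(i | rel_src (r i) == k) rs i * y i.
have ef : f = \sum_(a | src a == k) ar a * rel_comb y a.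
  apply: series_ext => [v|a].
    rewrite /f !cpa_sumE !big1 // => [a _|i _]; rewrite trivM.
      by rewrite vertex_arrow0 mul0r.
    by rewrite (rel_rad2 i) // mul0r.
  rewrite lder_sum_ar [in LHS]raddf_sum /=.
  have -> : \sum_(i | rel_src (r i) == k) lder a (rs i * y i) = rel_comb y a.
    apply: eq_bigr => i _.
    by rewrite lderM (rel_rad2 i) // kmap0 mul0r addr0.
  have [ak|ak] := eqVneq (src a) k.
    rewrite /rel_comb mulr_sumr; apply: eq_bigr => i _.
    by rewrite mulrA lder_start.
  by rewrite /rel_comb big1 // => i /eqP ik; rewrite lder_rel_src ?mul0r // ik.
have yj : rs j * y j = kmap c * rs j +
    rs j * (y j - kmap c * vx (rel_tgt (r j))) .
  by rewrite mulrBr mulrA -[rs j * kmap c]kmapC -mulrA rel_end addrC subrK.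
pose S := [set f | exists2 i, i != j & f = rel_series (r i)].
(* All of I is approximated by S; the induction on m uses the elimination of
   r_j described above. *)
have H m : forall g, I g -> exists2 h, gen_ideal S h & radical_power m (g - h).
  pose P m : set (cpa K Q) :=
    [set g | exists2 h, gen_ideal S h & radical_power m (g - h)].
  have iP m' : two_sided_ideal (P m').
    exact: (ideal_radical_power (Ideal (gen_ideal_ideal S)) m').
  have Pm m' g : radical_power m' g -> P m' g.
    by move=> hg; exists 0; [case: (gen_ideal_ideal S)|rewrite subr0].
  have PS m' i : i != j -> P m' (rs i).
    move=> ij; exists (rs i); last by rewrite subrr.
    by apply: sub_gen_ideal; exists i.
  rewrite -/(P m); elim: m => [|m IH] g Ig; first exact: Pm.
  suff Pj : P m.+1 (rs j).
    apply: (closed_ideal_sub (iP m.+1) (Pm m.+1) _ Ig) => _ [i ->].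
    by have [->|/PS] := eqVneq i j.
  have Pr g1 g2 : I g1 -> radical_power 1 g2 -> P m.+1 (g1 * g2).
    move=> /IH[h Sh hh] h2.
    rewrite -(subrK h g1) mulrDl; apply: two_sided_idealD => //.
      by apply: Pm; rewrite -addn1; exact: radical_powerM.
    exists (h * g2); last by rewrite subrr.
    by have [_ _ _] := gen_ideal_ideal S; apply.
  have Pl g1 g2 : radical_power 1 g1 -> I g2 -> P m.+1 (g1 * g2).
    move=> h1 /IH[h Sh hh].
    rewrite -(subrK h g2) mulrDr; apply: two_sided_idealD => //.
      by apply: Pm; rewrite -add1n; exact: radical_powerM.
    exists (g1 * h); last by rewrite subrr.
    by have [_ _ + _] := gen_ideal_ideal S; apply.
  (* Solve the definition of f for r_j: f lies in the radical times I, the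
     other summands lie in S, and the last term lies in I times the
     radical. *)
  have -> : rs j = kmap c^-1 * (f - \sum_(i | (rel_src (r i) == k) && (i != j)) rs i * y i
      - rs j * (y j - kmap c * vx (rel_tgt (r j)))) :> cpa K Q.
    rewrite /f (bigD1 j) ?jk //= addrK yj addrK mulrA -kmapM mulVf //.
    by rewrite kmap1 mul1r.
  have [_ PB PMl PMr] := iP m.+1; apply: (PMl); apply: (PB); first apply: (PB).
  - rewrite ef; apply: two_sided_ideal_sum => // a /eqP ak.
    by apply: Pl; [exact: radical_power_ar|exact: hy].
  - apply: two_sided_ideal_sum => // i /andP[_ ij].
    by apply: (PMr); exact: PS.
  - have -> : rs j * (y j - kmap c * vx (rel_tgt (r j))) =
        rs j * (vx (rel_tgt (r j)) * (y j - kmap c * vx (rel_tgt (r j)))).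
      by rewrite mulrA rel_end.
    apply: Pr; first exact: rel_in_ideal.
    apply/radical_power1P => v; rewrite trivM cpaBE cpaZE !vertex_seriesE.
    rewrite trivial_path_eq; have [->|_] := eqVneq v; last by rewrite mul0r.
    by rewrite mulr1 subrr mulr0.
by apply: (r_min (i := j)) => m; exact: (H m _ (rel_in_ideal j)).
Qed.

Lemma minimal_rel_neq0 i : rel_series (r i) <> 0.
Proof.
move=> ri0; apply: (r_min (i := i)); rewrite ri0 => m; exists 0.
  by case: (gen_ideal_ideal [set f | exists2 j, j != i & f = rel_series (r j)]).
by rewrite subrr.
Qed.

(** A relation that ends at a source has no term, since its paths have length
    at least two; but a zero relation is redundant. *)
Lemma rel_tgt_source i : is_source k -> rel_tgt (r i) != k.
Proof.
move=> k_source; apply/eqP => ik; apply: (@minimal_rel_neq0 i).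
apply/funext => p; rewrite cpa0E; apply/eqP; apply: contrapT => /negP.
move=> /(@rel_supp _ _ (r i))[_]; rewrite ik => /(source_end k_source) ->.
by [].
Qed.

End Relations.

(** * Normal forms in algebras with reversed arrows at the source *)

Section NormalForm.
Variables (K : fieldType) (Q : quiver) (R : finType).
Variables (r : R -> quiver_relation K Q) (k : vert Q) (n : nat).
Local Notation vx := (vertex_series K).
Local Notation ar := (arrow_series K).
Local Notation rs i := (rel_series (r i)).

(** The data that the truncated Jacobian algebra of the mutation at k and the
    endomorphism algebra of the tilting module have in common: a morphism
    defined on the series of Q that kills the arrows out of k, one element
    for each reversed arrow a* and each new arrow rho_i*, and the relation
    that replaces the composite of a* and rho_i* by a derivative of r_i. *)
Record mutated_system (A : kalgType K) := MutatedSystem {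
  ms_map : {rmorphism cpa K Q -> A};
  ms_star : arr Q -> A;
  ms_rho : R -> A;
  ms_kmap : forall c, ms_map (kmap c) = kmap c;
  ms_nil : forall f, radical_power n f -> ms_map f = 0;
  ms_out : forall a, src a = k -> ms_map (ar a) = 0;
  ms_star_src : forall a, src a = k -> ms_map (vx (tgt a)) * ms_star a = ms_star a;
  ms_star_tgt : forall a, src a = k -> ms_star a * ms_map (vx k) = ms_star a;
  ms_rho_src : forall i, rel_src (r i) = k -> ms_map (vx k) * ms_rho i = ms_rho i;
  ms_rho_tgt : forall i, rel_src (r i) = k ->
    ms_rho i * ms_map (vx (rel_tgt (r i))) = ms_rho i;
  ms_rel : forall a i, src a = k -> rel_src (r i) = k ->
    ms_star a * ms_rho i = - ms_map (lder a (rs i))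
}.

Hypothesis k_source : is_source k.
Hypothesis rel_tgt_k : forall i, rel_tgt (r i) != k.

Variables (A : kalgType K) (D : mutated_system A).
Local Notation th := (ms_map D).
Local Notation st := (ms_star D).
Local Notation rh := (ms_rho D).

(** All products of generators reduce to these sums: a* b* and rho_i* rho_j*
    are not composable, and a* rho_i* comes from a series. A series after
    rho_i* or before a* is absorbed into a coefficient. *)
Definition nf (x : cpa K Q) (xa : arr Q -> cpa K Q) (y : R -> cpa K Q)
    (z : R -> arr Q -> cpa K Q) : A :=
  th x + \sum_(a | src a == k) th (xa a) * st a +
  (\sum_(i | rel_src (r i) == k) rh i * th (y i) +
   \sum_(i | rel_src (r i) == k) \sum_(a | src a == k) rh i * th (z i a) * st a).

Lemma nfD x1 xa1 y1 z1 x2 xa2 y2 z2 :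
  nf x1 xa1 y1 z1 + nf x2 xa2 y2 z2 =
  nf (x1 + x2) (fun a => xa1 a + xa2 a) (fun i => y1 i + y2 i)
     (fun i a => z1 i a + z2 i a).
Proof.
rewrite /nf addrACA [X in X + _]addrACA [X in _ + X]addrACA -!big_split /=.
rewrite -rmorphD.
congr (_ + _ + _); apply: eq_bigr => i _; first by rewrite rmorphD mulrDl.
rewrite rmorphD mulrDr -big_split; congr (_ + _); apply: eq_bigr => a _.
by rewrite rmorphD mulrDr mulrDl.
Qed.

Lemma nf_theta x : th x = nf x (fun=> 0) (fun=> 0) (fun _ _ => 0).
Proof.
rewrite /nf !big1 ?addr0 // => [i|i|a] _; last by rewrite rmorph0 mul0r.
  by rewrite big1 // => a _; rewrite rmorph0 mulr0 mul0r.
by rewrite rmorph0 mulr0.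
Qed.

(** A path of positive length from k begins with an arrow that is killed. *)
Lemma theta_source x : th (vx k * x) = kmap (x (trivial_path k)) * th (vx k).
Proof.
rewrite vertex_decomp rmorphD rmorphM ms_kmap rmorph_sum big1 /= ?addr0 // => a /eqP ak.
by rewrite rmorphM ms_out // mul0r.
Qed.

Lemma theta_rho f i : rel_src (r i) = k ->
  th f * rh i = kmap (f (trivial_path k)) * rh i.
Proof.
move=> ik; rewrite -(ms_rho_src D ik) mulrA -rmorphM (Mvx_source k_source).
by rewrite rmorphM ms_kmap -!mulrA.
Qed.

Lemma star_theta x a : src a = k ->
  st a * th x = kmap (x (trivial_path k)) * st a.
Proof.
move=> ak; rewrite -{1}(ms_star_tgt D ak) -mulrA -rmorphM theta_source.
by rewrite mulrA -kmapC -mulrA ms_star_tgt.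
Qed.

Lemma theta_vxM u v : u != v -> th (vx u) * th (vx v) = 0.
Proof. by move=> /negPf uv; rewrite -rmorphM vx_vx uv rmorph0. Qed.

Lemma star_star a b : src a = k -> src b = k -> st a * st b = 0.
Proof.
move=> ak bk; rewrite -(ms_star_tgt D ak) -(ms_star_src D bk) mulrA -(mulrA (st a)).
by rewrite theta_vxM ?mulr0 ?mul0r // eq_sym k_source.
Qed.

Lemma rho_rho i j : rel_src (r i) = k -> rel_src (r j) = k -> rh i * rh j = 0.
Proof.
move=> ik jk; rewrite -(ms_rho_tgt D ik) -(ms_rho_src D jk) mulrA -(mulrA (rh i)).
by rewrite theta_vxM ?mulr0 ?mul0r // rel_tgt_k.
Qed.

Lemma theta_nf (f : cpa K Q) x xa y z : let c : cpa K Q := kmap (f (trivial_path k)) in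
  th f * nf x xa y z =
  nf (f * x) (fun a => f * xa a) (fun i => c * y i) (fun i a => c * z i a).
Proof.
rewrite /nf !mulrDr !mulr_sumr rmorphM /=.
congr (_ + _ + (_ + _)); apply: eq_bigr => i /eqP ik.
- by rewrite rmorphM mulrA.
- by rewrite mulrA theta_rho // rmorphM ms_kmap mulrA -[rh i * _]kmapC.
- rewrite mulr_sumr; apply: eq_bigr => a _.
  by rewrite !mulrA theta_rho // rmorphM ms_kmap mulrA -[rh i * _]kmapC.
Qed.

Lemma star_nf b x xa y z : src b = k ->
  st b * nf x xa y z =
  nf (- rel_comb r k y b)
     (fun a => (if a == b then kmap (x (trivial_path k)) * vx (tgt b) else 0)
               - rel_comb r k (fun i => z i a) b)
     (fun=> 0) (fun _ _ => 0).
Proof.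
move=> bk; rewrite /nf.
rewrite [X in _ = _ + _ + (X + _)]big1 => [|i _]; last by rewrite rmorph0 mulr0.
rewrite [X in _ = _ + _ + (_ + X)]big1 => [|i _]; last first.
  by rewrite big1 // => a _; rewrite rmorph0 mulr0 mul0r.
rewrite !addr0 !mulrDr star_theta // !mulr_sumr.
rewrite [X in _ + X + _ = _]big1 ?addr0 => [|a /eqP ak]; last first.
  by rewrite mulrA star_theta // -mulrA star_star ?mulr0.
rewrite addrCA; congr (_ + _).
  rewrite rmorphN rmorph_sum -sumrN; apply: eq_bigr => i /eqP ik.
  by rewrite mulrA ms_rel // rmorphM mulNr.
have -> : kmap (x (trivial_path k)) * st b = \sum_(a | src a == k)
    th (if a == b then kmap (x (trivial_path k)) * vx (tgt b) else 0) * st a.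
  rewrite (bigD1 b) ?bk //= eqxx big1 ?addr0 => [|a /andP[_ /negPf ->]].
    by rewrite rmorphM ms_kmap -mulrA ms_star_src.
  by rewrite rmorph0 mul0r.
under [X in _ + X = _]eq_bigr => i _ do rewrite mulr_sumr.
rewrite (exchange_big_dep (fun a => src a == k)) //= -big_split /=.
apply: eq_bigr => a ak; rewrite rmorphB mulrBl; congr (_ + _).
rewrite rmorph_sum mulr_suml -sumrN; apply: eq_big => [i|i /andP[/eqP ik _]].
  by rewrite ak andbT.
by rewrite !mulrA ms_rel // rmorphM !mulNr.
Qed.

Lemma rho_nf j x xa y z : rel_src (r j) = k ->
  rh j * nf x xa y z =
  nf 0 (fun=> 0) (fun i => if i == j then x else 0)
     (fun i a => if i == j then xa a else 0).
Proof.
move=> jk; rewrite /nf rmorph0 add0r.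
rewrite [X in _ = X + _]big1 ?add0r => [|a _]; last by rewrite ?rmorph0 mul0r.
rewrite mulrDr [X in _ + X]mulrDr !mulr_sumr [X in _ + (X + _)]big1 => [|i /eqP ik].
  rewrite [X in _ + (_ + X)]big1 ?addr0 => [|i /eqP ik].
    rewrite mulrDr mulr_sumr [X in _ = X + _](bigD1 j) ?jk //= eqxx.
    rewrite [X in _ = _ + X + _]big1 ?addr0 => [|i /andP[_ /negPf ->]]; last first.
      by rewrite rmorph0 mulr0.
    congr (_ + _); rewrite (bigD1 j) ?jk //= eqxx.
    rewrite [X in _ = _ + X]big1 ?addr0 => [|i /andP[_ /negPf ->]]; last first.
      by rewrite big1 // => a _; rewrite rmorph0 mulr0 mul0r.
    by apply: eq_bigr => a _; rewrite mulrA.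
  by rewrite mulr_sumr big1 // => a _; rewrite !mulrA rho_rho ?mul0r.
by rewrite mulrA rho_rho ?mul0r.
Qed.

(** A lower bound m for the length of a product, where an arrow of Q counts
    two and a new arrow counts one, since a* rho_i* becomes a series of order
    one only. The bound survives left multiplication by generators. *)
Definition nf_weight (m : nat) (b : A) : Prop :=
  exists x xa y z,
    [/\ b = nf x xa y z, radical_power (uphalf m) x,
        forall a, radical_power m./2 (xa a),
        forall i, radical_power m./2 (y i) &
        forall i a, radical_power m.-1./2 (z i a)].

Definition mut_gen (b : A) : Prop :=
  [\/ exists2 f, radical_power 1 f & b = th f,
      exists2 a, src a = k & b = st a |
      exists2 i, rel_src (r i) = k & b = rh i].

Lemma nf_weight_gen m g b : mut_gen g -> nf_weight m b -> nf_weight m.+1 (g * b).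
Proof.
move=> hg [x [xa [y [z [-> hx hxa hy hz]]]]]; case: hg => [[f f1 ->]|[a ak ->]|[i ik ->]].
- rewrite theta_nf f1 // kmap0; do 4!eexists; split; first by [].
  + by apply: radical_power_le (radical_powerM f1 hx); rewrite uphalf_half; case: odd.
  + move=> a; apply: radical_power_le (radical_powerM f1 (hxa a)).
    by rewrite /= uphalf_half; case: odd.
  + by move=> i; rewrite /= mul0r.
  + by move=> i a; rewrite /= mul0r.
- rewrite star_nf //; do 4!eexists; split; first by [].
  + apply: radical_powerN; apply: radical_power_sum => i _.
    exact: radical_powerM (@lder_rel_rad _ _ _ r a i) (hy i).
  + move=> b'; apply: radical_powerD; last first.
      apply: radical_powerN; apply: radical_power_sum => i _.
      apply: radical_power_le (radical_powerM (@lder_rel_rad _ _ _ r a i) (hz i b')).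
      by case: m {hx hxa hy hz} => //= m; rewrite uphalf_half; case: odd.
    case: eqP => // _; case: m {hxa hy hz} hx => [|m] hx; first by move=> p.
    by rewrite hx // kmap0 mul0r.
  + by [].
  + by [].
- rewrite rho_nf //; do 4!eexists; split; first by [].
  + by [].
  + by [].
  + by move=> j /=; case: eqP.
  + by move=> j a /=; case: eqP.
Qed.

Lemma nf_weight_nil b : nf_weight n.+1.*2 b -> b = 0.
Proof.
case=> x [xa [y [z]]]; rewrite uphalf_double doubleK /= uphalf_double.
case=> -> hx hxa hy hz; rewrite /nf.
have nS (f : cpa K Q) : radical_power n.+1 f -> radical_power n f.
  exact: radical_power_le.
rewrite (ms_nil D (nS _ hx)) add0r big1 ?add0r => [|a _]; last first.
  by rewrite (ms_nil D (nS _ (hxa a))) mul0r.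
rewrite big1 ?add0r => [|i _]; last by rewrite (ms_nil D (nS _ (hy i))) mulr0.
rewrite big1 // => i _; rewrite big1 // => a _.
by rewrite (ms_nil D (hz i a)) mulr0 mul0r.
Qed.

(** Generators raise the weight of a normal form, and a normal form of weight
    2n + 2 has all its coefficients of order n. *)
Lemma mut_gen_nil (T : Type) (al : T -> A) (s : seq T) :
  (forall t, mut_gen (al t)) -> size s = n.+1.*2 -> \prod_(t <- s) al t = 0.
Proof.
move=> hal hs; apply: nf_weight_nil; rewrite -hs.
elim: s {hs} => [|t s IH]; last by rewrite big_cons; exact: nf_weight_gen.
rewrite big_nil -(rmorph1 th) nf_theta; do 4!eexists; split; first by [].
all: by [].
Qed.

Definition is_nf (b : A) : Prop := exists x xa y z, b = nf x xa y z.

Lemma is_nfD b1 b2 : is_nf b1 -> is_nf b2 -> is_nf (b1 + b2).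
Proof.
move=> [x1 [xa1 [y1 [z1 ->]]]] [x2 [xa2 [y2 [z2 ->]]]].
by rewrite nfD; do 4!eexists.
Qed.
Lemma is_nf_theta x : is_nf (th x).
Proof. by rewrite nf_theta; do 4!eexists. Qed.
Lemma is_nf_sum (T : Type) (s : seq T) (P : pred T) (F : T -> A) :
  (forall i, P i -> is_nf (F i)) -> is_nf (\sum_(i <- s | P i) F i).
Proof.
move=> h; elim/big_rec: _ => [|i x Pi hx].
  by rewrite -(rmorph0 th); exact: is_nf_theta.
by apply: is_nfD => //; exact: h.
Qed.
Lemma is_nf_gen g b : mut_gen g -> is_nf b -> is_nf (g * b).
Proof.
move=> hg [x [xa [y [z ->]]]].
have [|x' [xa' [y' [z' [-> _ _ _ _]]]]] := @nf_weight_gen 0 g (nf x xa y z) hg.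
  by exists x, xa, y, z; split.
by exists x', xa', y', z'.
Qed.

(** Normal forms are stable under left multiplication by the generators, so
    all polynomials in the arrows have one; modulo a power of the radical
    there is nothing else. *)
Lemma all_nf (Q' : quiver) (phi : {rmorphism cpa K Q' -> A}) m :
  (forall c, phi (kmap c) = kmap c) ->
  (forall f, radical_power m f -> phi f = 0) ->
  (forall v, is_nf (phi (vertex_series K v))) ->
  (forall a, mut_gen (phi (arrow_series K a))) ->
  forall f, is_nf (phi f).
Proof.
move=> phiK phi0 hv ha f.
suff [g /phi0 g0] : exists2 g, radical_power m g & is_nf (phi (f - g)).
  by rewrite rmorphB g0 subr0.
elim: m {phi0} f => [|m IH] f.
  by exists f => //; rewrite subrr rmorph0 -(rmorph0 th); exact: is_nf_theta.
have [g hg] := choice (fun a => let: ex_intro2 g h1 h2 := IH (lder a f) in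
  ex_intro (fun g => radical_power m g /\ is_nf (phi (lder a f - g))) g (conj h1 h2)).
exists (\sum_a arrow_series K a * g a).
  apply: radical_power_sum => a _; rewrite -add1n.
  by apply: radical_powerM; [exact: radical_power_ar|case: (hg a)].
rewrite {1}[f]series_decomp -addrA -sumrB rmorphD !rmorph_sum /=.
apply: is_nfD; apply: is_nf_sum => x _.
  have [x1 [xa1 [y1 [z1 e]]]] := hv x.
  by rewrite rmorphM phiK e -(ms_kmap D) theta_nf; do 4!eexists.
by rewrite -mulrBr rmorphM; apply: is_nf_gen => //; case: (hg x).
Qed.

End NormalForm.

(** * Pullbacks of series and derivatives along a cut *)

Section ShiftMorphism.
Variables (K : comPzRingType) (Q1 Q2 : quiver).
Variables (h : vert Q2 -> vert Q1) (e : arr Q2 -> option (arr Q1)).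
Variable phi : {additive cpa K Q1 -> cpa K Q2}.
Hypothesis e_src : forall a b, e a = Some b -> src b = h (src a).
Hypothesis phi_triv : forall f v, phi f (trivial_path v) = f (trivial_path (h v)).
Hypothesis phi_lder : forall f a,
  lder a (phi f) = if e a is Some b then phi (lder b f) else 0.

Lemma shift_kmapM c f : phi (kmap c * f) = kmap c * phi f.
Proof.
apply: cpa_ext => p; rewrite cpaZE; move en: (plen p) => n; elim: n p en f => [|n IH] p.
  move/eqP; rewrite plen_eq0 => /eqP -> f.
  by rewrite !phi_triv cpaZE.
case: (qpathP p) => [v -> //|a q qa ->]; rewrite pcons_len // => -[qn] f.
rewrite -!lderE // !phi_lder; case: (e a) => [b|]; last by rewrite cpa0E mulr0.
by rewrite lderZ IH.
Qed.

(** By induction on the length of the path at which both sides are evaluated,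
    with the Leibniz rule as the step: phi commutes with left division along
    the partial map e of arrows. *)
Lemma shiftM f g : phi (f * g) = phi f * phi g.
Proof.
apply: cpa_ext => p; move en: (plen p) => n; elim: n p en f g => [|n IH] p.
  move/eqP; rewrite plen_eq0 => /eqP -> f g.
  by rewrite trivM !phi_triv trivM.
case: (qpathP p) => [v -> //|a q qa ->]; rewrite pcons_len // => -[qn] f g.
rewrite -!lderE // lderM !phi_lder.
case E: (e a) => [b|]; last by rewrite mul0r mulr0 addr0.
rewrite lderM raddfD cpaDE IH // cpaDE shift_kmapM phi_triv.
by rewrite (e_src E).
Qed.

Lemma shift1 : phi 1 = 1.
Proof.
apply: series_ext => [v|a]; first by rewrite phi_triv.
rewrite phi_lder -(kmap1 (cpa K Q2)) lder_kmap; case: (e a) => // b.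
by rewrite -(kmap1 (cpa K Q1)) lder_kmap raddf0.
Qed.

Lemma shift_kmap c : phi (kmap c) = kmap c.
Proof. by rewrite -[kmap c in LHS]mulr1 shift_kmapM shift1 mulr1. Qed.

Lemma shift_rad n f : radical_power n f -> radical_power n (phi f).
Proof.
move=> hf p; elim: n p f hf => [|n IH] p f hf //.
case: (qpathP p) => [v -> _|a q qa ->]; first by rewrite phi_triv hf.
rewrite pcons_len // ltnS => qn; rewrite -lderE // phi_lder.
by case: (e a) => [b|] //; apply: IH => //; exact: radical_power_lder.
Qed.

Lemma shift_vx v : injective h -> phi (vertex_series K (h v)) = vertex_series K v.
Proof.
move=> h_inj; apply: series_ext => [u|a].
  by rewrite phi_triv !vertex_seriesE !trivial_path_eq (inj_eq h_inj).
by rewrite phi_lder lder_vx; case: (e a) => // b; rewrite lder_vx raddf0.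
Qed.

End ShiftMorphism.

Section Pullback.
Variables (K : comPzRingType) (Q Q' : quiver).
Variables (h : vert Q' -> vert Q) (e : arr Q' -> option (seq (arr Q))).
Hypothesis e_path : forall a t, e a = Some t ->
  [/\ is_path (h (src a)) t, path_end (h (src a)) t = h (tgt a) & t != [::]].
Hypothesis h_inj : injective h.
Local Notation pb := (@pullback K Q Q' h e).

Lemma coefD f g x s : coef (f + g : cpa K Q) x s = coef f x s + coef g x s.
Proof. by rewrite /coef; case: insub => //=; rewrite addr0. Qed.
Lemma coefN f x s : coef (- f : cpa K Q) x s = - coef f x s.
Proof. by rewrite /coef; case: insub => //=; rewrite oppr0. Qed.

Fact pullback_is_zmod_morphism : zmod_morphism pb.
Proof.
move=> f g; apply: cpa_ext => p; rewrite cpaBE /pullback.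
by case: (subst_arrows _ _) => [s|] /=; rewrite ?subr0 // coefD coefN.
Qed.
HB.instance Definition _ := GRing.isZmodMorphism.Build (cpa K Q) (cpa K Q') pb
  pullback_is_zmod_morphism.

Lemma pullback_triv f v : pb f (trivial_path v) = f (trivial_path (h v)).
Proof. exact: (series_coefE f (trivial_path (h v))). Qed.

Definition lders (t : seq (arr Q)) (f : cpa K Q) := foldl (fun g a => lder a g) f t.

Lemma coef_cons (f : cpa K Q) a s :
  coef f (src a) (a :: s) = coef (lder a f) (tgt a) s.
Proof.
rewrite {2}/coef; case: insubP => [q qp qE|nqp].
  have [qs qr] : pstart q = tgt a /\ parrows q = s by rewrite /pstart /parrows qE.
  by rewrite /= lderE // -series_coefE pcons_start // pcons_arrows // qr.
by rewrite /coef insubN //= eqxx.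
Qed.

Lemma coef_lders f x t s : is_path x t ->
  coef f x (t ++ s) = coef (lders t f) (path_end x t) s.
Proof.
elim: t x f => //= a t IH x f /andP[/eqP <- pt].
by rewrite coef_cons IH.
Qed.

Lemma lders_start x t f : t != [::] ->
  vertex_series K (path_end x t) * lders t f = lders t f.
Proof.
elim/last_ind: t => // t a _ _.
rewrite /path_end map_rcons last_rcons /lders foldl_rcons.
exact: lder_start.
Qed.

(** The pullback replaces each arrow a by the path e a; hence division by a
    amounts to division by all the arrows of e a, one after the other. *)
Lemma pullback_lder f a :
  lder a (pb f) = if e a is Some t then pb (lders t f) else 0.
Proof.
apply: cpa_ext => q; case E: (e a) => [t|]; last first.
  rewrite /lder; case: eqP => // qa.
  by rewrite /pullback pcons_arrows //= E.
have [pt et t0] := e_path E.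
case: (pstart q =P tgt a) => [qa|qa]; last first.
  transitivity (0 : K); first by rewrite /lder; case: eqP.
  rewrite /pullback; case: (subst_arrows _ _) => //= s.
  rewrite -(lders_start (h (src a)) f t0) et /coef.
  case: insubP => // u us uE /=; rewrite vxM {1}/pstart uE /=.
  by rewrite (inj_eq h_inj); case: eqP qa => //; rewrite mul0r.
rewrite lderE // /pullback pcons_arrows // pcons_start //= E.
case: (subst_arrows _ _) => //= s.
by rewrite coef_lders // et qa.
Qed.

Lemma subst_arrows_path x s t : is_path x s -> subst_arrows e s = Some t ->
  is_path (h x) t /\ path_end (h x) t = h (path_end x s).
Proof.
elim: s x t => [|a s IH] x t /=; first by move=> _ [<-].
case/andP=> /eqP <- ps; case E: (e a) => [ta|] //.
case E2: (subst_arrows e s) => [ts|] //= -[<-].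
have [p1 e1 _] := e_path E; have [p2 e2] := IH _ _ ps E2.
by rewrite is_path_cat p1 e1 p2 path_end_cat e1 e2.
Qed.

Lemma pullback_vxM v f : pb (vertex_series K (h v) * f) = vertex_series K v * pb f.
Proof.
apply: cpa_ext => q; rewrite vxM /pullback.
case: (subst_arrows _ _) => [s|] /=; last by rewrite mulr0.
rewrite /coef; case: insubP => [u us uE|_] /=; last by rewrite mulr0.
by rewrite vxM {1}/pstart uE /= (inj_eq h_inj).
Qed.

End Pullback.

Section CutDerivative.
Variables (K : comPzRingType) (X : qp_cut K).
Local Notation Q := (qp_quiver X).
Local Notation W := (qp_pot X).
Hypothesis W_cut : forall x, ~~ qp_arrows X x -> lder x W = 0.

Lemma cut_path (a : arr (cut_quiver X)) (t : seq (arr Q)) : Some [:: val a] = Some t ->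
  [/\ @is_path Q (src a) t, @path_end Q (src a) t = tgt a & t != [::]].
Proof. by case=> <- /=; rewrite eqxx. Qed.

(** A cyclic derivative rotates the potential. On a path without arrows of
    the cut, a rotation by a positive amount would come from a cycle of W
    that starts with an arrow outside the cut; W has no such terms, so that
    only the left division by c contributes. *)
Lemma cut_restrict_derivative c : radical_power 1 (lder c W) ->
  cut_restrict (cyclic_derivative c W) =
  cut_restrict (lder c W * vertex_series K (src c)).
Proof.
move=> c1; apply: cpa_ext => q; rewrite /cut_restrict /pullback /=.
have E : subst_arrows (fun a : arr (cut_quiver X) => Some [:: val a]) (parrows q) =
    Some (map val (parrows q)).
  by elim: (parrows q) => //= a s ->.
rewrite E /=.
have [pq' _] := @subst_arrows_path Q (cut_quiver X) id _ cut_path _ _ _ (valP q) E.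
rewrite /coef; case: insubP => // q' _ q'E /=.
have q's : all (fun x => ~~ qp_arrows X x) (parrows q').
  by rewrite /parrows q'E /= all_map; apply/allP => a _ /=; exact: (valP a).
rewrite /cyclic_derivative big_ord_recr big1 /= => [|i _].
  rewrite add0r Mvx.
  have -> : pstart (pdrop (plen q') q') = pend q'.
    by rewrite /pstart /= /plen take_size.
  have -> : parrows (pdrop (plen q') q') = [::].
    by rewrite {1}/parrows /= /plen drop_size.
  rewrite ptake_size /=.
  case: (pend q' =P src c) => [qc|qc]; last first.
    rewrite mulr0 /coef insubN //= negb_and; apply/orP; left.
    by apply/eqP => h; apply: qc.
  rewrite mulr1 qc coef_cons; case: (qpathP q') => [v ->|a p pa ->].
    by rewrite [LHS](series_coefE (lder c W) (trivial_path (tgt c))) !c1.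
  case: (tgt c =P src a) => [ca|ca].
    by rewrite -(pcons_start pa) in ca; rewrite ca series_coefE.
  rewrite [RHS]/lder pcons_start //; case: eqP => [/esym //|_].
  rewrite /coef insubN // pcons_arrows //= negb_and; apply/orP; left.
  by apply/eqP => /esym.
have ip : (i < plen q')%N by exact: ltn_ord.
case E1: (parrows (pdrop i q')) => [|x s].
  by have := plen_drop i q'; rewrite /plen E1 => /esym/eqP; rewrite subn_eq0 leqNgt ip.
have xq : x \in parrows q'.
  by apply: (@mem_drop i); rewrite -[drop _ _]/(parrows (pdrop i q')) E1 mem_head.
rewrite /coef; case: insubP => // u us uE /=.
have xs : src x = pstart u by move: us => /= /andP[/eqP]; rewrite /pstart uE.
have -> : W u = coef W (src x) (x :: s ++ c :: parrows (ptake i q')).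
  by rewrite -series_coefE xs /parrows uE.
by rewrite coef_cons W_cut ?(allP q's) // /coef; case: insub.
Qed.

End CutDerivative.

(** * The truncated Jacobian algebra of the mutation *)

Lemma kalg_iso_of_surj (K : pzRingType) (C A : kalgType K) (I : ideal C)
    (phi : {rmorphism C -> A}) :
  (forall c, phi (kmap c) = kmap c) -> (forall a, exists x, phi x = a) ->
  (forall x, phi x = 0 <-> I x) -> kalg_iso A (quot_alg I).
Proof.
move=> phiK phi_surj phi_ker; have [g gK] := choice phi_surj.
pose f a := quot_pi I (g a).
have fphi x : f (phi x) = quot_pi I x.
  by apply/quot_algP/phi_ker; rewrite rmorphB gK subrr.
have f_zmod : zmod_morphism f.
  by move=> a b; rewrite -[a]gK -[b]gK -rmorphB !fphi quot_piBE.
have f_monoid : monoid_morphism f.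
  split; first by rewrite -(rmorph1 phi) fphi.
  by move=> a b; rewrite -[a]gK -[b]gK -rmorphM !fphi quot_piME.
pose F : {rmorphism A -> quot_alg I} := HB.pack f
  (GRing.isZmodMorphism.Build _ _ f f_zmod) (GRing.isMonoidMorphism.Build _ _ f f_monoid).
exists F; split; last by move=> c; rewrite -phiK [LHS]fphi.
have [h hE] := choice (fun u => quot_pi_surj (I := I) u).
exists (phi \o h) => [a|u] /=.
  apply/eqP; rewrite -subr_eq0 -[X in _ - X]gK -rmorphB; apply/eqP/phi_ker.
  by apply/quot_algP; rewrite [LHS]hE.
by rewrite [LHS]fphi hE.
Qed.

Section MutatedQP.
Variables (K : fieldType) (Q : quiver) (R : finType).
Variables (r : R -> quiver_relation K Q) (k : vert Q).
Hypothesis k_source : is_source k.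
Hypothesis rel_tgt_k : forall i, rel_tgt (r i) != k.
Local Notation rs i := (rel_series (r i)).

Local Notation X := (assoc_qp r).
Local Notation QA := (assoc_quiver r).
Local Notation M := (@mut_qp K X k).
Local Notation QM := (qp_quiver M).
Local Notation incl := (@assoc_incl K Q R r).
Local Notation pot := (@assoc_pot K Q R r).
Local Notation bracket := (@mut_bracket K X k).
Local Notation QC := (cut_quiver M).

Lemma assoc_path (a : arr QA) (t : seq (arr Q)) :
  (match a with inl a' => Some [:: a'] | inr _ => None end) = Some t ->
  [/\ @is_path Q (src a) t, @path_end Q (src a) t = tgt a & t != [::]].
Proof. by case: a => // a [<-]; rewrite /= eqxx. Qed.

Lemma mut_path (a : arr QM) (t : seq (arr QA)) : mut_expand a = Some t ->
  [/\ @is_path QA (src a) t, @path_end QA (src a) t = tgt a & t != [::]].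
Proof.
case: a => [a|[a|[b|[[b hb] [a ha]]]]] //= [<-] /=; rewrite eqxx //=.
by move: ha hb => /= /eqP -> /eqP ->; rewrite eqxx.
Qed.

Lemma lder_incl_arr (a : arr Q) f :
  lder (inl a : arr QA) (incl f) = incl (lder a f).
Proof. exact: (pullback_lder assoc_path (@inj_id _) f (inl a : arr QA)). Qed.
Lemma lder_incl_rel (i : R) f : lder (inr i : arr QA) (incl f) = 0.
Proof. exact: (pullback_lder assoc_path (@inj_id _) f (inr i : arr QA)). Qed.

Lemma lder_bracket_away (a : arr_away (X := X) k) f :
  lder (mut_old a : arr QM) (bracket f) = bracket (lder (val a) f).
Proof. exact: (pullback_lder mut_path (@inj_id _) f (mut_old a : arr QM)). Qed.
Lemma lder_bracket_out (a : arr_out (X := X) k) f :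
  lder (mut_out a : arr QM) (bracket f) = 0.
Proof. exact: (pullback_lder mut_path (@inj_id _) f (mut_out a : arr QM)). Qed.
Lemma lder_bracket_in (a : arr_in (X := X) k) f :
  lder (mut_in a : arr QM) (bracket f) = 0.
Proof. exact: (pullback_lder mut_path (@inj_id _) f (mut_in a : arr QM)). Qed.
Lemma lder_bracket_comp (b : arr_in (X := X) k) (a : arr_out (X := X) k) f :
  lder (mut_comp b a : arr QM) (bracket f) =
  bracket (lder (val a) (lder (val b) f)).
Proof. exact: (pullback_lder mut_path (@inj_id _) f (mut_comp b a : arr QM)). Qed.

Fact bracket_zmod : zmod_morphism (@mut_bracket K X k).
Proof. exact: pullback_is_zmod_morphism. Qed.
Fact incl_zmod : zmod_morphism (incl).
Proof. exact: pullback_is_zmod_morphism. Qed.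
Fact cut_zmod : zmod_morphism (@cut_restrict K M).
Proof. exact: pullback_is_zmod_morphism. Qed.
HB.instance Definition _ := GRing.isZmodMorphism.Build _ _ _ bracket_zmod.
HB.instance Definition _ := GRing.isZmodMorphism.Build _ _ _ incl_zmod.
HB.instance Definition _ := GRing.isZmodMorphism.Build _ _ _ cut_zmod.

Lemma lder_cut (a : arr QC) f :
  lder a (cut_restrict f) = @cut_restrict K M (lder (val a) f).
Proof. exact: (pullback_lder (@cut_path _ M) (@inj_id _) f a). Qed.

Lemma lder_assoc_pot_arr (a : arr Q) : lder (inl a : arr QA) pot = 0.
Proof.
rewrite /assoc_pot raddf_sum big1 // => i _.
exact: (lder_arM (inl a : arr QA) (inr i : arr QA) (incl (rs i))).
Qed.

Lemma lder_assoc_pot_rel (i : R) :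
  lder (inr i : arr QA) pot = incl (rs i).
Proof.
rewrite /assoc_pot raddf_sum (bigD1 i) //= big1 => [|j ji].
  rewrite addr0 [LHS](lder_arM (inr i : arr QA) (inr i : arr QA)) eqxx.
  by rewrite -[in RHS]rel_start [RHS](@pullback_vxM K Q QA id _ (@inj_id _)).
rewrite [LHS](lder_arM (inr i : arr QA) (inr j : arr QA)).
by case: (_ =P _) => // -[ij]; rewrite ij eqxx in ji.
Qed.

Local Notation W := (@mut_pot K X k).
Local Notation mas := (@mut_arrow_series K X k).

Lemma lder_cubic (x : arr QM) :
  lder x (\sum_b \sum_a mas (mut_comp b a) * mas (mut_out a) * mas (mut_in b)) =
  if x is inr (inr (inr (b, a))) then mas (mut_out a) * mas (mut_in b) else 0.
Proof.
rewrite raddf_sum /=.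
under eq_bigr => b _ do (rewrite raddf_sum /=;
  under eq_bigr => a _ do rewrite -mulrA [lder _ _](lder_arM x (mut_comp b a : arr QM))).
have out0 : (forall b a, x <> mut_comp b a) ->
    \sum_b \sum_a (if x == mut_comp b a :> arr QM then
      vertex_series K (tgt (mut_comp b a : arr QM)) *
        (mas (mut_out a) * mas (mut_in b)) else 0) = 0 :> cpa K QM.
  by move=> h; rewrite big1 // => b _; rewrite big1 // => a _; case: eqP => // /h.
case: x out0 => [a|[a|[b|[b a]]]] out0; try by rewrite out0.
rewrite (bigD1 b) //= [X in _ + X]big1 ?addr0 => [|b' bb']; last first.
  rewrite big1 // => a' _; case: (_ =P _) => // -[h _].
  by rewrite h eqxx in bb'.
rewrite (bigD1 a) //= big1 ?addr0 => [|a' aa']; last first.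
  by case: (_ =P _) => // -[h]; rewrite h eqxx in aa'.
rewrite eqxx mulrA; congr (_ * _).
by rewrite [LHS](@vx_ar K QM (tgt (mut_comp b a : arr QM)) (mut_out a)) eqxx.
Qed.

(** In the potential the arrows of the cut come first: rho_i r_i for the
    relations away from k, and [rho_i a] followed by lder a r_i, plus the
    cubic terms [rho_i a] a* rho_i*. *)
Lemma lder_mut_pot (x : arr QM) : lder x W =
  match x with
  | inl a => if val a is inr i then bracket (incl (rs i)) else 0
  | inr (inr (inr (b, a))) =>
    if (val b, val a) is (inr i, inl a') then
      bracket (incl (lder a' (rs i))) + mas (mut_out a) * mas (mut_in b)
    else 0
  | _ => 0
  end.
Proof.
rewrite /mut_pot raddfD /= lder_cubic.
case: x => [[a ha]|[a|[b|[[b hb] [a ha]]]]].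
- rewrite addr0 [LHS]lder_bracket_away /=.
  by case: a ha => a ha /=; rewrite ?lder_assoc_pot_arr ?lder_assoc_pot_rel ?raddf0.
- by rewrite addr0; exact: lder_bracket_out.
- by rewrite addr0; exact: lder_bracket_in.
- rewrite [X in X + _]lder_bracket_comp /=.
  case: b hb => [b|i] hb; first by case/negP: (k_source b); exact: hb.
  case: a ha => [a|j] ha; last by case/negP: (rel_tgt_k j); exact: ha.
  by rewrite lder_assoc_pot_rel lder_incl_arr.
Qed.

(** The morphism that kills the arrows out of k and keeps the other ones. *)
Definition iota (f : cpa K Q) : cpa K QC := @cut_restrict K M (bracket (incl f)).

Fact iota_zmod : zmod_morphism iota.
Proof. by move=> f g; rewrite /iota !raddfB. Qed.
HB.instance Definition _ := GRing.isZmodMorphism.Build _ _ _ iota_zmod.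

Definition old_arrow (x : arr QC) : option (arr Q) :=
  match val x with inl a => if val a is inl a' then Some a' else None | _ => None end.

Lemma iota_triv f (v : vert Q) : iota f (@trivial_path QC v) = f (@trivial_path Q v).
Proof.
apply: etrans (@pullback_triv K QM QC id _ (bracket (incl f)) v) _.
apply: etrans (@pullback_triv K QA QM id _ (incl f) v) _.
exact: (@pullback_triv K Q QA id _ f v).
Qed.

Lemma iota_lder f x :
  lder x (iota f) = if old_arrow x is Some a then iota (lder a f) else 0.
Proof.
rewrite /iota lder_cut /old_arrow; case: (val x) => [[a ha]|[a|[b|[[b hb] [a ha]]]]].
- rewrite [X in cut_restrict X]lder_bracket_away /=.
  by case: a ha => a ha; rewrite ?lder_incl_arr ?lder_incl_rel ?raddf0.
- by rewrite [X in cut_restrict X]lder_bracket_out raddf0.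
- by rewrite [X in cut_restrict X]lder_bracket_in raddf0.
- rewrite [X in cut_restrict X]lder_bracket_comp /=.
  case: b hb => [b|i] hb; first by case/negP: (k_source b); exact: hb.
  by rewrite lder_incl_rel !raddf0.
Qed.

Lemma old_arrow_src x a : old_arrow x = Some a -> src a = src x :> vert Q.
Proof. by rewrite /old_arrow /=; case: (val x) => // -[[a'|]] //= _ [->]. Qed.

Fact iota_monoid : monoid_morphism iota.
Proof.
split.
  exact: (@shift1 K Q QC id old_arrow (iota : {additive _ -> _}) iota_triv iota_lder).
exact: (@shiftM K Q QC id old_arrow (iota : {additive _ -> _}) old_arrow_src iota_triv iota_lder).
Qed.
HB.instance Definition _ := GRing.isMonoidMorphism.Build _ _ _ iota_monoid.

Lemma iota_kmap c : iota (kmap c) = kmap c.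
Proof.
exact: (@shift_kmap K Q QC id old_arrow (iota : {additive _ -> _}) iota_triv iota_lder).
Qed.
Lemma iota_rad n f : radical_power n f -> radical_power n (iota f).
Proof.
exact: (@shift_rad K Q QC id old_arrow (iota : {additive _ -> _}) iota_triv iota_lder).
Qed.
Lemma iota_vx v : iota (vertex_series K v) = vertex_series K (v : vert QC).
Proof.
exact: (@shift_vx K Q QC id old_arrow (iota : {additive _ -> _}) iota_triv iota_lder v (@inj_id _)).
Qed.
Lemma iota_ar_old x a : old_arrow x = Some a -> iota (arrow_series K a) = arrow_series K x.
Proof.
move=> xa; apply: series_ext => [v|y].
  by rewrite iota_triv !vertex_arrow0.
rewrite iota_lder lder_ar; case: (y =P x) => [->|yx].
  rewrite xa lder_ar eqxx iota_vx; congr vertex_series.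
  by move: xa; rewrite /old_arrow /=; case: (val x) => // -[[a'|]] //= _ [->].
case E: (old_arrow y) => [b|] //; rewrite lder_ar.
case: (b =P a) => [ba|]; last by rewrite raddf0.
case: yx; apply: val_inj; move: xa E; rewrite ba /old_arrow.
case: (val x) => // -[[a1|//] h1] [e1]; case: (val y) => // -[[a2|//] h2] [e2].
by congr inl; apply: val_inj; rewrite /= e1 e2.
Qed.
Lemma iota_ar_out a : src a = k -> iota (arrow_series K a) = 0.
Proof.
move=> ak; apply: series_ext => [v|y]; first by rewrite iota_triv vertex_arrow0.
rewrite iota_lder raddf0; case E: (old_arrow y) => [b|] //; rewrite lder_ar.
case: (b =P a) => [ba|_]; last by rewrite raddf0.
move: E; rewrite ba /old_arrow; case: (val y) => // -[[a1|//] /= h1] [e1].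
by move: h1; rewrite e1 ak eqxx.
Qed.

Local Notation vx := (vertex_series K).
Local Notation ar := (arrow_series K).
Local Notation I := (closed_ideal [set f | exists i, f = rel_series (r i)]).
Local Notation cut := (@cut_restrict K M).
Local Notation S := [set f | exists2 c, qp_arrows M c &
    f = cut (cyclic_derivative c (qp_pot M))].
Local Notation IB := (closed_ideal S).

Lemma cutM f g : cut (f * g) = cut f * cut g.
Proof.
apply: (@shiftM K QM QC id (fun x => Some (val x)) (cut : {additive _ -> _})).
- by move=> a b [<-].
- by move=> h v; exact: (@pullback_triv K QM QC id).
- by move=> h a; exact: lder_cut.
Qed.

Lemma cut_vx (v : vert Q) : cut (vertex_series K (v : vert QM)) = vertex_series K (v : vert QC).
Proof.
apply: (@shift_vx K QM QC id (fun x => Some (val x)) (cut : {additive _ -> _})) => //.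
- by move=> h u; exact: (@pullback_triv K QM QC id).
- by move=> h a; exact: lder_cut.
Qed.

Lemma cut_ar (x : arr QC) : cut (arrow_series K (val x : arr QM)) = arrow_series K x.
Proof.
apply: series_ext => [v|y].
  rewrite vertex_arrow0; apply: etrans (@pullback_triv K QM QC id _ _ v) _.
  exact: vertex_arrow0.
rewrite lder_cut !lder_ar -val_eqE; case: eqP => [_|_]; last by rewrite raddf0.
exact: (cut_vx (tgt x)).
Qed.

(** Zero unless a starts at k. *)
Definition star_series (a : arr Q) : cpa K QC :=
  oapp (fun a' : arr_out (X := X) k => cut (mas (mut_out a'))) 0 (insub (inl a : arr QA)).
(** Zero unless the relation r_i starts at k. *)
Definition rho_series (i : R) : cpa K QC :=
  oapp (fun b : arr_in (X := X) k => cut (mas (mut_in b))) 0 (insub (inr i : arr QA)).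

Section System.
Variables (n : nat) (A : kalgType K) (D : mutated_system r k n A).

(** The cases with value 0 do not occur: such an arrow is in the cut, or it
    comes from an arrow of Q or a relation that ends at k. *)
Definition system_arrow (x : arr QC) : A :=
  match val x with
  | inl a => if val a is inl a' then ms_map D (ar a') else 0
  | inr (inl a) => if val a is inl a' then ms_star D a' else 0
  | inr (inr (inl b)) => if val b is inr i then ms_rho D i else 0
  | inr (inr (inr _)) => 0
  end.
End System.

Lemma star_series_arrow a : src a = k -> exists x : arr QC,
  [/\ star_series a = ar x, src x = tgt a, tgt x = k &
     forall n A (D : mutated_system r k n A), system_arrow D x = ms_star D a].
Proof.
move=> ak; have ak' : @src QA (inl a) == k by apply/eqP.
pose a' : arr_out (X := X) k := Sub (inl a : arr QA) ak'.
have xP : ~~ qp_arrows M (mut_out a') by [].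
pose x : arr QC := Sub (mut_out a' : arr QM) xP.
exists x; split => //.
rewrite -cut_ar /star_series insubT //=; congr (cut (mas (mut_out _))).
Qed.

Lemma rho_series_arrow i : rel_src (r i) = k -> exists x : arr QC,
  [/\ rho_series i = ar x, src x = k, tgt x = rel_tgt (r i) &
     forall n A (D : mutated_system r k n A), system_arrow D x = ms_rho D i].
Proof.
move=> ik; have ik' : @tgt QA (inr i) == k by apply/eqP.
pose b : arr_in (X := X) k := Sub (inr i : arr QA) ik'.
have xP : ~~ qp_arrows M (mut_in b) by [].
pose x : arr QC := Sub (mut_in b : arr QM) xP.
exists x; split => //.
rewrite -cut_ar /rho_series insubT //=; congr (cut (mas (mut_in _))).
Qed.

Lemma old_series_arrow a : src a != k -> exists x : arr QC,
  [/\ iota (ar a) = ar x, src x = src a, tgt x = tgt a &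
     forall n A (D : mutated_system r k n A), system_arrow D x = ms_map D (ar a)].
Proof.
move=> ak; have ak' : (@src QA (inl a) != k) && (@tgt QA (inl a) != k).
  by rewrite ak; exact: k_source.
pose a' : arr_away (X := X) k := Sub (inl a : arr QA) ak'.
have xP : ~~ qp_arrows M (mut_old a') by [].
pose x : arr QC := Sub (mut_old a' : arr QM) xP.
by exists x; split => //; exact: iota_ar_old.
Qed.

Variant cut_arrow_spec (x : arr QC) : Prop :=
  | CutOld a of src a != k & ar x = iota (ar a) &
      (forall n A (D : mutated_system r k n A), system_arrow D x = ms_map D (ar a)) &
      src x = src a & tgt x = tgt a
  | CutStar a of src a = k & ar x = star_series a &
      (forall n A (D : mutated_system r k n A), system_arrow D x = ms_star D a) &
      src x = tgt a & tgt x = k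
  | CutRho i of rel_src (r i) = k & ar x = rho_series i &
      (forall n A (D : mutated_system r k n A), system_arrow D x = ms_rho D i) &
      src x = k & tgt x = rel_tgt (r i).

Lemma cut_arrowP x : cut_arrow_spec x.
Proof.
have := cut_ar x; rewrite /system_arrow.
case: x => -[[a ha]|[[a ha]|[[b hb]|[[b hb] a]]]] xP.
- case: a ha xP => [a|i] ha xP; last by [].
  move=> _; have ak : src a != k by case/andP: (ha).
  pose y : arr_away (X := X) k := Sub (inl a : arr QA) ha.
  apply: (CutOld (a := a)) => //.
  exact/esym/(@iota_ar_old (Sub (mut_old y : arr QM) xP : arr QC)).
- case: a ha xP => [a|j] ha xP; last by case/negP: (rel_tgt_k j).
  move=> e; apply: (CutStar (a := a)) => //; first exact/eqP.
  rewrite -e /star_series insubT //=; congr (cut (mas (mut_out _))).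
- case: b hb xP => [b|i] hb xP; first by case/negP: (k_source b).
  move=> e; apply: (CutRho (i := i)) => //; first exact/eqP.
  rewrite -e /rho_series insubT //=; congr (cut (mas (mut_in _))).
- by case: b hb xP => [b|i] hb xP; first by case/negP: (k_source b).
Qed.

Lemma mut_pot_cut x : ~~ qp_arrows M x -> lder x (qp_pot M) = 0.
Proof.
rewrite [lder _ _](lder_mut_pot).
case: x => [[[a|i] ha]|[a|[b|[[[b|i] hb] [a ha]]]]] //.
Qed.

Lemma jacobian_relation_old i (c : arr_away (X := X) k) : val c = inr i ->
  cut (cyclic_derivative (mut_old c : arr QM) (qp_pot M)) = iota (rs i).
Proof.
move=> ci.
have e : lder (mut_old c : arr QM) (qp_pot M) = bracket (incl (rs i)).
  by rewrite [LHS](lder_mut_pot) /= ci.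
rewrite (cut_restrict_derivative mut_pot_cut); last first.
  rewrite e; apply/radical_power1P => v.
  apply: etrans (@pullback_triv K QA QM id _ _ v) _.
  apply: etrans (@pullback_triv K Q QA id _ _ v) _.
  by rewrite (rel_rad2 r).
rewrite cutM e [cut (vertex_series _ _)](cut_vx _) /= ci /=.
by rewrite -iota_vx -[RHS](congr1 iota (rel_end r i)) rmorphM.
Qed.

Lemma star_seriesE (d : arr_out (X := X) k) a : val d = inl a ->
  cut (mas (mut_out d)) = star_series a.
Proof. by move=> da; rewrite /star_series -da valK. Qed.
Lemma rho_seriesE (d : arr_in (X := X) k) i : val d = inr i ->
  cut (mas (mut_in d)) = rho_series i.
Proof. by move=> da; rewrite /rho_series -da valK. Qed.

Lemma rho_series_tgt i : rel_src (r i) = k ->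
  rho_series i * iota (vx (rel_tgt (r i))) = rho_series i.
Proof.
by case/rho_series_arrow => x [-> _ xt _]; rewrite iota_vx ar_vx xt eqxx.
Qed.
Lemma rho_series_src i : rel_src (r i) = k ->
  iota (vx k) * rho_series i = rho_series i.
Proof.
by case/rho_series_arrow => x [-> xs _ _]; rewrite iota_vx vx_ar xs eqxx.
Qed.
Lemma star_series_tgt a : src a = k -> star_series a * iota (vx k) = star_series a.
Proof.
by case/star_series_arrow => x [-> _ xt _]; rewrite iota_vx ar_vx xt eqxx.
Qed.
Lemma star_series_src a : src a = k ->
  iota (vx (tgt a)) * star_series a = star_series a.
Proof.
by case/star_series_arrow => x [-> xs _ _]; rewrite iota_vx vx_ar xs eqxx.
Qed.

Lemma jacobian_relation_comp i a (c : arr_in (X := X) k) (d : arr_out (X := X) k) :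
  val c = inr i -> val d = inl a -> rel_src (r i) = k ->
  cut (cyclic_derivative (mut_comp c d : arr QM) (qp_pot M)) =
  iota (lder a (rs i)) + star_series a * rho_series i.
Proof.
move=> ci da ik.
have e : lder (mut_comp c d : arr QM) (qp_pot M) =
    bracket (incl (lder a (rs i))) + mas (mut_out d) * mas (mut_in c).
  by rewrite [LHS](lder_mut_pot) /= ci da.
rewrite (cut_restrict_derivative mut_pot_cut); last first.
  rewrite e; apply: radical_powerD; last first.
    by apply: radical_powerMr; exact: (@radical_power_ar K QM (mut_out d)).
  apply/radical_power1P => v.
  apply: etrans (@pullback_triv K QA QM id _ _ v) _.
  apply: etrans (@pullback_triv K Q QA id _ _ v) _.
  exact: (lder_rel_rad r).
rewrite cutM e [cut (vertex_series _ _)](cut_vx _) raddfD /= cutM /= ci /=.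
rewrite (star_seriesE da) (rho_seriesE ci) mulrDl -iota_vx.
rewrite -mulrA rho_series_tgt //; congr (_ + _).
by rewrite -[RHS](congr1 iota (lder_rel_end r a i)) rmorphM.
Qed.

(** The truncated Jacobian algebra has two kinds of relations: the relations
    of Q that do not start at k, from the arrows rho_i, and one relation for
    each composite [rho_i a], which says that a* rho_i* is minus the
    derivative of r_i. *)
Lemma jacobian_relationP f : S f <->
  (exists2 i, rel_src (r i) != k & f = iota (rs i)) \/
  (exists a i, [/\ src a = k, rel_src (r i) = k &
     f = iota (lder a (rs i)) + star_series a * rho_series i]).
Proof.
split.
  case=> c; case: c => [[[a|i] ha]|[a|[b|[[[b|i] hb] [[a|j] ha]]]]] // _ ->.
  - left; exists i; first by case/andP: (ha).
    by rewrite (@jacobian_relation_old i (Sub (inr i : arr QA) ha)).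
  - right; exists a, i; split; [exact/eqP|exact/eqP|].
    by rewrite (@jacobian_relation_comp i a (Sub (inr i : arr QA) hb)
      (Sub (inl a : arr QA) ha)) //; exact/eqP.
  - by case/negP: (rel_tgt_k j).
case=> [[i ik ->]|[a [i [ak ik ->]]]].
  have hc : (@src QA (inr i) != k) && (@tgt QA (inr i) != k).
    by rewrite rel_tgt_k.
  pose c : arr_away (X := X) k := Sub (inr i : arr QA) hc.
  exists (mut_old c); first by [].
  by rewrite (@jacobian_relation_old i c).
have hc : @tgt QA (inr i) == k by apply/eqP.
have hd : @src QA (inl a) == k by apply/eqP.
exists (mut_comp (Sub (inr i : arr QA) hc : arr_in (X := X) k)
                 (Sub (inl a : arr QA) hd : arr_out (X := X) k)); first by [].
by rewrite (@jacobian_relation_comp i a).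
Qed.

(** A relation starting at k goes to zero, because all its paths start with
    an arrow out of k. *)
Lemma iota_ideal f : I f -> IB (iota f).
Proof.
move=> If; apply: closed_idealP => n; have [g Ig hg] := If n.
exists (iota g); last by rewrite -rmorphB; exact: iota_rad.
have iP : two_sided_ideal [set f | IB (iota f)].
  split.
  - by rewrite /mkset rmorph0; exact: ideal0.
  - by move=> x y Ix Iy; rewrite /mkset rmorphB; exact: idealB.
  - by move=> a x Ix; rewrite /mkset rmorphM; exact: idealMl.
  - by move=> a x Ix; rewrite /mkset rmorphM; exact: Defs.idealMr.
apply: (gen_ideal_sub iP) Ig => _ [i ->]; rewrite /mkset.
have [ik|ik] := eqVneq (rel_src (r i)) k; last first.
  by apply: closed_ideal_gen; apply/jacobian_relationP; left; exists i.
rewrite (_ : iota (rs i) = 0); first exact: ideal0.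
apply: series_ext => [v|x]; first by rewrite [LHS](iota_triv _ v) (rel_rad2 r).
rewrite iota_lder raddf0; case E: (old_arrow x) => [a|] //.
rewrite lder_rel_src ?raddf0 // ik; move: E; rewrite /old_arrow.
by case: (val x) => // -[[a'|//] /= ha] [<-]; case/andP: ha.
Qed.

Variable n : nat.
Hypothesis I_nil : forall f, radical_power n f -> I f.

Definition jacobian_map : {rmorphism cpa K Q -> quot_alg IB} :=
  (quot_pi IB : {rmorphism _ -> _}) \o (iota : {rmorphism _ -> _}).

Definition jacobian_system : mutated_system r k n (quot_alg IB).
Proof.
pose pi := quot_pi IB.
apply: (@MutatedSystem _ _ _ r k n _ jacobian_map (fun a => pi (star_series a))
  (fun i => pi (rho_series i))) => /=.
- by move=> c; rewrite iota_kmap.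
- by move=> f /I_nil/iota_ideal/quot_pi_eq0.
- by move=> a ak; rewrite iota_ar_out // quot_pi0.
- by move=> a ak; rewrite -quot_piME star_series_src.
- by move=> a ak; rewrite -quot_piME star_series_tgt.
- by move=> i ik; rewrite -quot_piME rho_series_src.
- by move=> i ik; rewrite -quot_piME rho_series_tgt.
- move=> a i ak ik; apply/eqP; rewrite -addr_eq0 addrC -quot_piME -quot_piDE.
  apply/eqP/quot_pi_eq0/closed_ideal_gen/jacobian_relationP; right.
  by exists a, i.
Defined.

Section Isomorphism.
Variables (A : kalgType K) (D : mutated_system r k n A).
Hypothesis D_ideal : forall f, I f -> ms_map D f = 0.
Hypothesis D_surj : forall a, is_nf D a.
Hypothesis D_inj : forall x xa y z, nf D x xa y z = 0 ->
  [/\ x (trivial_path k) = 0, I ((1 - vx k) * x),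
      forall a, src a = k -> I ((1 - vx k) * (xa a * vx (tgt a))),
      forall i, rel_src (r i) = k -> I (vx (rel_tgt (r i)) * y i) &
      forall i a, rel_src (r i) = k -> src a = k ->
        I (vx (rel_tgt (r i)) * z i a * vx (tgt a))].

Definition nf_series (x : cpa K Q) (xa : arr Q -> cpa K Q) (y : R -> cpa K Q)
    (z : R -> arr Q -> cpa K Q) : cpa K QC :=
  iota x + \sum_(a | src a == k) iota (xa a) * star_series a +
  (\sum_(i | rel_src (r i) == k) rho_series i * iota (y i) +
   \sum_(i | rel_src (r i) == k) \sum_(a | src a == k)
     rho_series i * iota (z i a) * star_series a).

Lemma quot_nf_series x xa y z :
  quot_pi IB (nf_series x xa y z) = nf jacobian_system x xa y z.
Proof.
rewrite /nf_series /nf !quot_piDE !quot_pi_sum; congr (_ + _ + (_ + _)).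
- by apply: eq_bigr => a _; rewrite quot_piME.
- by apply: eq_bigr => i _; rewrite quot_piME.
- apply: eq_bigr => i _; rewrite quot_pi_sum; apply: eq_bigr => a _.
  by rewrite !quot_piME.
Qed.

(** Each coefficient of a normal form matters only up to I and up to the
    idempotents at the ends of a* and rho_i*. Of a series starting at k only
    the constant term survives. These are the conditions in the conclusion of
    D_inj. *)
Lemma nf_jacobian0 x xa y z : nf D x xa y z = 0 -> nf jacobian_system x xa y z = 0.
Proof.
case/D_inj => x0 x1 hxa hy hz.
have J0 f : I f -> ms_map jacobian_system f = 0.
  by move=> /iota_ideal/quot_pi_eq0.
have split_k (f : cpa K Q) : f (trivial_path k) = 0 -> I ((1 - vx k) * f) ->
    ms_map jacobian_system f = 0.
  move=> f0 f1; rewrite -[f](subrK (vx k * f)) -[in X in X - _](mul1r f) -mulrBl.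
  by rewrite rmorphD J0 // add0r theta_source f0 kmap0 mul0r.
rewrite /nf split_k // add0r [X in X + _]big1 ?add0r => [|a /eqP ak]; last first.
  rewrite -(ms_star_src jacobian_system ak) mulrA -rmorphM split_k ?mul0r //.
    rewrite trivM vertex_seriesE trivial_path_eq eq_sym (negPf (k_source a)).
    by rewrite mulr0.
  exact: hxa.
rewrite big1 ?add0r => [|i /eqP ik]; last first.
  rewrite -(ms_rho_tgt jacobian_system ik) -mulrA -rmorphM J0 ?mulr0 //.
  exact: hy.
rewrite big1 // => i /eqP ik; rewrite big1 // => a /eqP ak.
rewrite -(ms_rho_tgt jacobian_system ik) -(ms_star_src jacobian_system ak).
rewrite mulrA -(mulrA (ms_rho _ _)) -rmorphM -(mulrA (ms_rho _ _)) -rmorphM.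
by rewrite J0 ?mulr0 ?mul0r //; exact: hz.
Qed.

Lemma system_arrow_gen (A' : kalgType K) (D' : mutated_system r k n A') x :
  mut_gen D' (system_arrow D' x).
Proof.
case: (cut_arrowP x) => [a ak _ -> _ _|a ak _ -> _ _|i ik _ -> _ _].
- by apply: Or31; exists (ar a); first exact: radical_power_ar.
- by apply: Or32; exists a.
- by apply: Or33; exists i.
Qed.

Lemma jacobian_arrow x : quot_pi IB (ar x) = system_arrow jacobian_system x.
Proof. by case: (cut_arrowP x) => [a _ -> -> _ _|a _ -> -> _ _|i _ -> -> _ _]. Qed.

(** The universal property gives phi from the series of the quiver without
    the cut to A, and phi kills the relations since A carries a mutated
    system. Modulo the relations each series is a normal form; phi sends
    normal forms to normal forms of A, so that surjectivity and injectivity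
    of the induced map are D_surj and D_inj. *)
Lemma jacobian_iso : kalg_iso A (quot_alg IB).
Proof.
have [phi [phiK phi0 phi_vx phi_ar]] : exists phi : {rmorphism cpa K QC -> A},
  [/\ forall c, phi (kmap c) = kmap c,
      forall f, radical_power n.+1.*2 f -> phi f = 0,
      forall v, phi (vertex_series K v) = ms_map D (vx (v : vert Q)) &
      forall a, phi (arrow_series K a) = system_arrow D a].
  apply: series_universal.
  - by rewrite -rmorph_sum sum_vertex_series rmorph1.
  - by move=> u v; rewrite -rmorphM vx_vx; case: eqP => // _; rewrite rmorph0.
  - move=> x; case: (cut_arrowP x) => [a _ _ -> -> _|a ak _ -> -> _|i ik _ -> -> _].
    + by rewrite -rmorphM vx_ar eqxx.
    + exact: ms_star_src.
    + exact: ms_rho_src.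
  - move=> x; case: (cut_arrowP x) => [a _ _ -> _ ->|a ak _ -> _ ->|i ik _ -> _ ->].
    + by rewrite -rmorphM ar_vx eqxx.
    + exact: ms_star_tgt.
    + exact: ms_rho_tgt.
  - move=> s; apply: (mut_gen_nil k_source rel_tgt_k (D := D)) => x.
    exact: system_arrow_gen.
have phi_iota : (phi \o (iota : {rmorphism _ -> _})) =1 ms_map D.
  apply: (@eq_continuous_morph _ _ _ _ _ n.+1.*2) => /=.
  - by move=> c; rewrite iota_kmap phiK.
  - exact: ms_kmap.
  - by move=> f hf; apply: phi0; exact: iota_rad.
  - move=> f hf; apply: (ms_nil D); apply: radical_power_le hf.
    by rewrite -addnn addSn ltnW // ltnS leq_addr.
  - by move=> v; rewrite iota_vx phi_vx.
  - move=> a; have [ak|/eqP ak] := eqVneq (src a) k.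
      by rewrite iota_ar_out // rmorph0 ms_out.
    have [x [-> _ _ <-]] := old_series_arrow (introN eqP ak).
    exact: phi_ar.
have phi_star a : src a = k -> phi (star_series a) = ms_star D a.
  by move=> /star_series_arrow [x [-> _ _ <-]].
have phi_rho i : rel_src (r i) = k -> phi (rho_series i) = ms_rho D i.
  by move=> /rho_series_arrow [x [-> _ _ <-]].
have phi_nf x xa y z : phi (nf_series x xa y z) = nf D x xa y z.
  rewrite /nf_series /nf !rmorphD !rmorph_sum; congr (_ + _ + (_ + _)).
  - exact: phi_iota.
  - by apply: eq_bigr => a /eqP ak; rewrite rmorphM phi_star // -phi_iota.
  - by apply: eq_bigr => i /eqP ik; rewrite rmorphM phi_rho // -phi_iota.
  - apply: eq_bigr => i /eqP ik; rewrite rmorph_sum; apply: eq_bigr => a /eqP ak.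
    by rewrite !rmorphM phi_star // phi_rho // -phi_iota.
have phi_IB f : IB f -> phi f = 0.
  apply: (@closed_ideal_sub _ _ _ n.+1.*2 [set f | phi f = 0]).
  - split.
    + by rewrite /mkset rmorph0.
    + by move=> x y x0 y0; rewrite /mkset rmorphB x0 y0 subrr.
    + by move=> a x x0; rewrite /mkset rmorphM x0 mulr0.
    + by move=> a x x0; rewrite /mkset rmorphM x0 mul0r.
  - exact: phi0.
  - move=> g /jacobian_relationP[[i ik ->]|[a [i [ak ik ->]]]]; rewrite /mkset.
      by rewrite [LHS]phi_iota D_ideal //; exact: rel_in_ideal.
    rewrite rmorphD rmorphM [X in X + _]phi_iota phi_star // phi_rho //.
    by rewrite ms_rel // subrr.
have J_nf : forall f, is_nf jacobian_system (quot_pi IB f).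
  have pi_ar s : \prod_(x <- s) quot_pi IB (ar x) =
      \prod_(x <- s) system_arrow jacobian_system x.
    by apply: eq_bigr => x _; exact: jacobian_arrow.
  apply: (all_nf k_source rel_tgt_k (D := jacobian_system)
    (phi := (quot_pi IB : {rmorphism _ -> _})) (m := n.+1.*2)).
  - by [].
  - apply: radical_power_morph0 => // s ss; rewrite [LHS]pi_ar.
    by apply: (mut_gen_nil k_source rel_tgt_k (D := jacobian_system)) => // x; exact: system_arrow_gen.
  - move=> v; have e : quot_pi IB (vertex_series K v) =
        ms_map jacobian_system (vx (v : vert Q)) by rewrite -(iota_vx v).
    by rewrite [X in is_nf _ X]e; exact: is_nf_theta.
  - by move=> x; rewrite [X in mut_gen _ X]jacobian_arrow; exact: system_arrow_gen.
apply: (kalg_iso_of_surj phiK).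
  move=> a; have [x [xa [y [z ->]]]] := D_surj a.
  by exists (nf_series x xa y z).
move=> f; split; last exact: phi_IB.
move=> phif0; have [x [xa [y [z e]]]] := J_nf f.
apply/quot_pi_eq0; rewrite e; apply: nf_jacobian0.
rewrite -phi_nf -(subrK f (nf_series _ _ _ _)) rmorphD phif0 addr0.
by apply: phi_IB; apply/quot_pi_eq0; rewrite quot_piBE quot_nf_series e subrr.
Qed.

End Isomorphism.
End MutatedQP.

(** * Duality over the ground field *)

Section FunctionalExtension.
Variables (K : fieldType) (Z : lmodType K).
Implicit Types S : set (Z * K).

(** Graphs of linear functionals on a subspace; as sets they can be fed to
    Zorn's lemma without building subspaces. *)
Definition linear_graph S : Prop :=
  [/\ S (0, 0), forall c p q, S p -> S q -> S (c *: p.1 + q.1, c * p.2 + q.2) &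
      forall c, S (0, c) -> c = 0].

Lemma linear_graph_extend S (v : Z) : linear_graph S -> (forall c, ~ S (v, c)) ->
  linear_graph [set p | exists t, S (p.1 - t *: v, p.2)].
Proof.
case=> S0 SD Sf Sv; split.
- by exists 0; rewrite scale0r subr0.
- move=> c p q [t hp] [u hq]; exists (c * t + u) => /=.
  have := SD c _ _ hp hq => /=; congr S; congr (_, _).
  by rewrite scalerBr scalerDl scalerA opprD addrACA.
- move=> c [t /=]; rewrite sub0r => h; have [t0|t0] := eqVneq t 0.
    by apply: Sf; move: h; rewrite t0 scale0r oppr0.
  case: (Sv (- t^-1 * c)); have := SD (- t^-1) _ _ h S0 => /=.
  by rewrite !addr0 scaleNr scalerN opprK scalerA mulVf // scale1r.
Qed.

Lemma linear_graph_total S0 : linear_graph S0 ->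
  exists2 S, linear_graph S & S0 `<=` S /\ forall v, exists c, S (v, c).
Proof.
move=> S0lin; pose P : set (set (Z * K)) := [set A | linear_graph (S0 `|` A)].
have [F FP Ftot|A [PA Amax]] := @Zorn_bigcup _ P.
  pose U := S0 `|` \bigcup_(X in F) X.
  have two p q : U p -> U q -> exists A, [/\ linear_graph (S0 `|` A),
      (S0 `|` A) p, (S0 `|` A) q & A `<=` U].
    case=> [Sp|[X FX Xp]] [Sq|[Y FY Yq]].
    - by exists set0; split; [rewrite setU0|left|left|move=> x []].
    - by exists Y; split; [exact: FP|left|right|move=> x Yx; right; exists Y].
    - by exists X; split; [exact: FP|right|left|move=> x Xx; right; exists X].
    - have [XY|YX] := Ftot _ _ FX FY.
        by exists Y; split; [exact: FP|right; exact: XY|right|move=> x Yx; right; exists Y].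
      by exists X; split; [exact: FP|right|right; exact: YX|move=> x Xx; right; exists X].
  have sub A : A `<=` U -> S0 `|` A `<=` U.
    by move=> AU x [|/AU]; first by left.
  split.
  - by left; case: S0lin.
  - move=> c p q Up Uq; have [A [[_ AD _] Ap Aq /sub AU]] := two _ _ Up Uq.
    by apply: AU; exact: AD.
  - by move=> c Uc; have [A [[_ _ Af] Ac _ _]] := two _ _ Uc Uc; exact: Af.
exists (S0 `|` A); first exact: PA.
split=> [x|v]; first by left.
apply: contrapT => /forallNP hv.
pose B : set (Z * K) := [set p | exists t, (S0 `|` A) (p.1 - t *: v, p.2)].
have AB : S0 `|` A `<=` B.
  by move=> -[x c] h; exists 0; rewrite scale0r subr0.
apply: (Amax B).
  split=> [x Ax|BA]; first by apply: AB; right.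
  apply: (hv 0); right; apply: BA; exists 1; rewrite /= scale1r subrr.
  by case: PA.
rewrite /P /=; suff -> : S0 `|` B = B by exact: linear_graph_extend.
by apply/seteqP; split=> x; [case=> // S0x; apply: AB; left|right].
Qed.

(** The pairs (d y, g y) form the graph of a functional on the image of d,
    and a maximal extension of this graph is defined everywhere. *)
Lemma functional_factor (Y : lmodType K) (d : Y -> Z) (g : Y -> K) :
  (forall c x y, d (c *: x + y) = c *: d x + d y) ->
  (forall c x y, g (c *: x + y) = c * g x + g y) ->
  (forall y, d y = 0 -> g y = 0) ->
  exists h : Z -> K,
    [/\ forall x y, h (x + y) = h x + h y, forall c x, h (c *: x) = c * h x &
        forall y, h (d y) = g y].
Proof.
move=> dL gL dg.
have g0 : g 0 = 0 by have := gL (-1) 0 0; rewrite scaler0 addr0 mulN1r addNr.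
have d0 : d 0 = 0 by have := dL (-1) 0 0; rewrite scaler0 addr0 scaleN1r addNr.
have S0lin : linear_graph [set p | exists y, p = (d y, g y)].
  split.
  - by exists 0; rewrite d0 g0.
  - by move=> c _ _ [x ->] [y ->]; exists (c *: x + y); rewrite dL gL.
  - by move=> c [y [/esym/dg -> ->]].
have [S [S0 SD Sf] [sub tot]] := linear_graph_total S0lin.
have [h hS] := choice tot; exists h.
have uniq x c1 c2 : S (x, c1) -> S (x, c2) -> c1 = c2.
  move=> h1 h2; have := SD (-1) _ _ h2 h1 => /=.
  rewrite scaleN1r addNr mulN1r => /Sf /eqP.
  by rewrite addrC subr_eq0 => /eqP.
split=> [x y|c x|y]; apply: uniq (hS _) _.
- by have := SD 1 _ _ (hS x) (hS y); rewrite /= scale1r mul1r.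
- by have := SD c _ _ (hS x) S0; rewrite /= !addr0.
- by apply: sub; exists y.
Qed.

End FunctionalExtension.

Section Restriction.
Variables (K : comPzRingType) (A : kalgType K) (M : lmodType A).
(** M with scalars restricted to K. *)
Definition kspace : Type := M.
HB.instance Definition _ := GRing.Zmodule.on kspace.
Definition kspace_scale (c : K) (x : kspace) : kspace := (kmap c : A) *: (x : M).
Fact kspace_scaleA a b x : kspace_scale a (kspace_scale b x) = kspace_scale (a * b) x.
Proof. by rewrite /kspace_scale scalerA kmapM. Qed.
Fact kspace_scale1 : left_id 1 kspace_scale.
Proof. by move=> x; rewrite /kspace_scale kmap1 scale1r. Qed.
Fact kspace_scaleDr : right_distributive kspace_scale +%R.
Proof. by move=> a x y; exact: scalerDr. Qed.
Fact kspace_scaleDl x : {morph kspace_scale^~ x : a b / a + b}.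
Proof. by move=> a b; rewrite /kspace_scale kmapD scalerDl. Qed.
HB.instance Definition _ := GRing.Zmodule_isLmodule.Build K kspace
  kspace_scaleA kspace_scale1 kspace_scaleDr kspace_scaleDl.
End Restriction.

Section ConverseAlgebra.
Variables (K : comPzRingType) (A : kalgType K).
Definition ckmap (c : K) : A^c := (kmap c : A).
Fact ckmap_zmod : zmod_morphism ckmap.
Proof. by move=> c d; rewrite /ckmap [LHS]kmapD kmapN. Qed.
Fact ckmap_monoid : monoid_morphism ckmap.
Proof.
split; first exact: kmap1.
by move=> c d; rewrite /ckmap mulrC; exact: (kmapM A d c).
Qed.
HB.instance Definition _ := GRing.isZmodMorphism.Build K A^c ckmap ckmap_zmod.
HB.instance Definition _ := GRing.isMonoidMorphism.Build K A^c ckmap ckmap_monoid.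
Fact ckmapC (c : K) (x : A^c) : ckmap c * x = x * ckmap c.
Proof. exact/esym/(kmapC c (x : A)). Qed.
HB.instance Definition _ := isKAlgebra.Build K A^c ckmapC.
End ConverseAlgebra.

Section RightKDual.
Variables (K : comPzRingType) (A : kalgType K) (X : lmodType A^c).

(** The left module D X = Hom_K(X, K) of a right module X; the product a f
    maps x to f(x a). *)
Record rkdual := RKDual {
  rkdual_fun :> X -> K;
  rkdualD : forall x y, rkdual_fun (x + y) = rkdual_fun x + rkdual_fun y;
  rkdualZ : forall (c : K) x, rkdual_fun ((ckmap A c) *: x) = c * rkdual_fun x
}.
HB.instance Definition _ := gen_eqMixin rkdual.
HB.instance Definition _ := gen_choiceMixin rkdual.

Lemma rkdual_eq (f g : rkdual) : (forall x, f x = g x) -> f = g.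
Proof.
case: f g => f fD fZ [g gD gZ] /= /funext fg; subst g.
by rewrite (Prop_irrelevance fD gD) (Prop_irrelevance fZ gZ).
Qed.

Definition rkdual_add (f g : rkdual) : rkdual.
Proof.
exists (fun x => f x + g x) => [x y|c x]; first by rewrite !rkdualD addrACA.
by rewrite !rkdualZ mulrDr.
Defined.
Definition rkdual_opp (f : rkdual) : rkdual.
Proof.
by exists (fun x => - f x) => [x y|c x]; rewrite ?rkdualD ?opprD // rkdualZ mulrN.
Defined.
Definition rkdual_zero : rkdual.
Proof. by exists (fun=> 0) => [x y|c x]; rewrite ?addr0 ?mulr0. Defined.
Definition rkdual_scale (a : A) (f : rkdual) : rkdual.
Proof.
exists (fun x => f ((a : A^c) *: x)) => [x y|c x]; first by rewrite scalerDr rkdualD.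
by rewrite -rkdualZ !scalerA; congr (f (_ *: _)); exact/esym/ckmapC.
Defined.

Fact rkdual_addA : associative rkdual_add.
Proof. by move=> f g h; apply: rkdual_eq => x; exact: addrA. Qed.
Fact rkdual_addC : commutative rkdual_add.
Proof. by move=> f g; apply: rkdual_eq => x; exact: addrC. Qed.
Fact rkdual_add0 : left_id rkdual_zero rkdual_add.
Proof. by move=> f; apply: rkdual_eq => x; exact: add0r. Qed.
Fact rkdual_addN : left_inverse rkdual_zero rkdual_opp rkdual_add.
Proof. by move=> f; apply: rkdual_eq => x; exact: addNr. Qed.
HB.instance Definition _ :=
  GRing.isZmodule.Build rkdual rkdual_addA rkdual_addC rkdual_add0 rkdual_addN.

Fact rkdual_scaleA a b f : rkdual_scale a (rkdual_scale b f) = rkdual_scale (a * b) f.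
Proof. by apply: rkdual_eq => x /=; rewrite scalerA. Qed.
Fact rkdual_scale1 : left_id 1 rkdual_scale.
Proof. by move=> f; apply: rkdual_eq => x /=; rewrite scale1r. Qed.
Fact rkdual_scaleDr : right_distributive rkdual_scale +%R.
Proof. by move=> a f g; apply: rkdual_eq => x. Qed.
Fact rkdual_scaleDl f : {morph rkdual_scale^~ f : a b / a + b}.
Proof. by move=> a b; apply: rkdual_eq => x /=; rewrite scalerDl rkdualD. Qed.
HB.instance Definition _ := GRing.Zmodule_isLmodule.Build A rkdual
  rkdual_scaleA rkdual_scale1 rkdual_scaleDr rkdual_scaleDl.

End RightKDual.

Section Duality.
Variables (K : fieldType) (A : kalgType K).

Lemma linear_kspace (B : kalgType K) (U V : lmodType B) (f : {linear U -> V})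
  (c : K) (x y : kspace U) :
  (f (c *: x + y) : kspace V) = c *: (f x : kspace V) + (f y : kspace V).
Proof. by rewrite [LHS]linearD [X in X + _]linearZ. Qed.

Lemma kdual_factor (Y Z : lmodType A) (d : {linear Y -> Z}) (g : kdual Y) :
  (forall y, d y = 0 -> g y = 0) -> exists h : kdual Z, forall y, h (d y) = g y.
Proof.
move=> dg; have [|||h [hD hZ hd]] := @functional_factor K (kspace Z) (kspace Y) d g.
- exact: linear_kspace.
- by move=> c x y; rewrite [LHS]kdualD; congr (_ + _); exact: kdualZ.
- exact: dg.
by exists (@KDual K A Z h hD hZ).
Qed.

Lemma rkdual_factor (Y Z : lmodType A^c) (d : {linear Y -> Z}) (g : rkdual Y) :
  (forall y, d y = 0 -> g y = 0) -> exists h : rkdual Z, forall y, h (d y) = g y.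
Proof.
move=> dg; have [|||h [hD hZ hd]] := @functional_factor K (kspace Z) (kspace Y) d g.
- exact: linear_kspace.
- by move=> c x y; rewrite [LHS]rkdualD; congr (_ + _); exact: rkdualZ.
- exact: dg.
by exists (@RKDual K A Z h hD hZ).
Qed.

Lemma rkdual_separates (Z : lmodType A^c) (x : Z) :
  (forall f : rkdual Z, f x = 0) -> x = 0.
Proof.
move=> hx; apply/eqP; apply: contrapT => /negP x0.
pose d (c : K^o) : kspace Z := c *: (x : kspace Z).
have [|||h [hD hZ hd]] := @functional_factor K (kspace Z) K^o d id.
- by move=> c a b; rewrite /d scalerDl scalerA.
- by [].
- move=> c /eqP; rewrite /d => /eqP cx; apply/eqP; apply: contrapT => /negP c0.
  case/negP: x0; apply/eqP.
  have := congr1 (fun z : kspace Z => c^-1 *: z) cx.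
  by rewrite scalerA mulVf // scale1r scaler0.
have := hx (@RKDual K A Z h hD hZ); rewrite /=.
have := hd 1; rewrite /d scale1r => -> /eqP.
by rewrite oner_eq0.
Qed.

Definition rkdual_map (Y Z : lmodType A^c) (d : {linear Y -> Z}) (f : rkdual Z) : rkdual Y.
Proof.
exists (fun y => f (d y)) => [x y|c x]; first by rewrite linearD rkdualD.
by rewrite linearZ rkdualZ.
Defined.
Lemma rkdual_map_linear (Y Z : lmodType A^c) (d : {linear Y -> Z}) :
  linear (rkdual_map d).
Proof.
move=> a f g; apply: rkdual_eq => x /=.
by congr (_ + _); rewrite [d (_ *: _)]linearZ.
Qed.
HB.instance Definition _ (Y Z : lmodType A^c) (d : {linear Y -> Z}) :=
  GRing.isLinear.Build A (rkdual Z) (rkdual Y) *:%R (rkdual_map d) (rkdual_map_linear d).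

Definition kdual_map (Y Z : lmodType A) (d : {linear Y -> Z}) (f : kdual Z) : kdual Y.
Proof.
exists (fun y => f (d y)) => [x y|c x]; first by rewrite linearD kdualD.
by rewrite linearZ kdualZ.
Defined.
Lemma kdual_map_linear (Y Z : lmodType A) (d : {linear Y -> Z}) :
  linear (kdual_map d).
Proof.
move=> a f g; apply: kdual_eq => x /=.
by congr (_ + _); rewrite [d (_ *: _)]linearZ.
Qed.
HB.instance Definition _ (Y Z : lmodType A) (d : {linear Y -> Z}) :=
  GRing.isLinear.Build A^c (kdual Z) (kdual Y) *:%R (kdual_map d) (kdual_map_linear d).

(** Maps from U to D F correspond to maps from F to the dual of U, by
    exchanging the two arguments. Duality turns the injection i into a
    surjection, along which the projective module F lifts. *)
Lemma injective_rkdual (F : lmodType A^c) : projective_module F ->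
  injective_module (rkdual F).
Proof.
move=> Fproj U V i f i_inj.
have fhD (x : F) u v : f (u + v) x = f u x + f v x by rewrite linearD.
have fhZ (x : F) c u : f ((kmap c : A) *: u) x = c * f u x.
  by rewrite linearZ /= -rkdualZ.
pose fh (x : F) : kdual U := KDual (fhD x) (fhZ x).
have fh_lin : linear fh.
  move=> a x y; apply: kdual_eq => u /=.
  by rewrite rkdualD; congr (_ + _); rewrite linearZ.
pose Fh : {linear F -> kdual U} := HB.pack fh (GRing.isLinear.Build _ _ _ _ fh fh_lin).
have surj_i : surj (kdual_map i).
  move=> g; have [|h hE] := @kdual_factor U V i g.
    by move=> y /eqP; rewrite -(linear0 i) => /eqP/i_inj ->; rewrite -(scale0r 0) -(kmap0 A) kdualZ mul0r.
  by exists h; apply: kdual_eq => u; exact: hE.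
have [G hG] := Fproj _ _ (kdual_map i : {linear _ -> _}) Fh surj_i.
have gD (v : V) x y : G (x + y) v = G x v + G y v by rewrite linearD.
have gZ (v : V) c x : G (ckmap A c *: x) v = c * G x v.
  by rewrite linearZ /= -kdualZ.
pose g (v : V) : rkdual F := RKDual (gD v) (gZ v).
have g_lin : linear g.
  move=> a x y; apply: rkdual_eq => u /=.
  by rewrite kdualD; congr (_ + _); rewrite linearZ.
pose Gl : {linear V -> rkdual F} := HB.pack g (GRing.isLinear.Build _ _ _ _ g g_lin).
exists Gl => u; apply: rkdual_eq => x /=.
exact: (congr1 (fun h : kdual U => h u) (hG x)).
Qed.

End Duality.

(** * Injective coresolutions and sums of cyclic projectives *)

Section Injectives.
Variable A : pzRingType.

Section Image.
Variables (Y Z : lmodType A) (d : {linear Y -> Z}).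
Definition in_image : pred Z := fun z => `[< exists y, d y = z >].
Fact in_image_submod : subsemimod_closed in_image.
Proof.
split; last by move=> a _ /asboolP[y <-]; apply/asboolP; exists (a *: y); rewrite linearZ.
split; first by apply/asboolP; exists 0; rewrite linear0.
by move=> _ _ /asboolP[x <-] /asboolP[y <-]; apply/asboolP; exists (x + y); rewrite linearD.
Qed.
HB.instance Definition _ := GRing.isSubmodClosed.Build A Z in_image in_image_submod.
(** A type for the image of d, on which a map out of the image can be defined
    before it is extended along the inclusion. *)
Record image_module := ImageModule {
  image_val :> Z;
  image_valP : image_val \in in_image
}.
HB.instance Definition _ := [isSub for image_val].
HB.instance Definition _ := [Choice of image_module by <:].
HB.instance Definition _ := [SubChoice_isSubLmodule of image_module by <:].
End Image.

Lemma injective_factor (E Y Z : lmodType A) (d : {linear Y -> Z}) (g : {linear Y -> E}) :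
  injective_module E -> (forall y, d y = 0 -> g y = 0) ->
  exists h : {linear Z -> E}, forall y, h (d y) = g y.
Proof.
move=> Einj dg.
have pre (z : image_module d) : exists y, d y = val z.
  by case: z => z /= /asboolP.
have [s sE] := choice pre.
have gs y z : d y = val z -> g (s z) = g y.
  move=> yz; apply/eqP; rewrite -subr_eq0 -linearB; apply/eqP/dg.
  by rewrite linearB /= sE yz subrr.
have gs_lin : linear (fun z => g (s z)).
  move=> a z1 z2; rewrite (gs (a *: s z1 + s z2)); last first.
    by rewrite linearP !sE.
  by rewrite linearP.
pose gl : {linear image_module d -> E} := HB.pack (fun z => g (s z))
  (GRing.isLinear.Build _ _ _ _ _ gs_lin).
have [h hE] := Einj _ _ (val : {linear image_module d -> Z}) gl val_inj.
exists h => y; have dy : d y \in in_image d by apply/asboolP; exists y.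
by rewrite -[d y]/(val (ImageModule dy)) hE /= (gs y).
Qed.

Lemma injective_bij (E E' : lmodType A) (j : {linear E -> E'}) :
  bijective j -> injective_module E' -> injective_module E.
Proof.
case=> j' jK j'K inj U V i f i_inj.
have [g gE] := inj U V i (j \o f : {linear U -> E'}) i_inj.
have lin : linear (fun v => j' (g v)).
  by move=> a x y; apply: (can_inj jK); rewrite j'K !linearP !j'K.
exists (HB.pack_for {linear V -> E} (fun v => j' (g v))
  (GRing.isLinear.Build _ _ _ _ _ lin)) => x /=.
by rewrite gE /= jK.
Qed.

(** Compare two coresolutions of M, one beginning with I0, I1, I2 and one
    ending with E2. The composite of the comparison maps s and t is homotopic
    to the identity. Correcting t2 s2 by d1 h2, for a homotopy h, gives an
    endomorphism of I2 that fixes the image of d1, and its values lie in this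
    image since E1 maps onto E2. *)
Lemma coresolution_retract (M I0 I1 I2 E0 E1 E2 : lmodType A)
    (eI : {linear M -> I0}) (d0 : {linear I0 -> I1}) (d1 : {linear I1 -> I2})
    (eE : {linear M -> E0}) (c0 : {linear E0 -> E1}) (c1 : {linear E1 -> E2}) :
  injective_module I0 -> injective_module I1 -> injective_module I2 ->
  injective_module E0 -> injective_module E1 -> injective_module E2 ->
  injective eI -> exact eI d0 -> exact d0 d1 ->
  injective eE -> exact eE c0 -> exact c0 c1 -> surj c1 ->
  exists p : {linear I2 -> I2},
    (forall z, exists y, d1 y = p z) /\ forall y, p (d1 y) = d1 y.
Proof.
move=> I0i I1i I2i E0i E1i E2i eIi exI0 exI1 eEi exE0 exE1 c1s.
have ker_inj (U V W : lmodType A) (f : {linear U -> V}) (g : {linear U -> W}) :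
    injective f -> forall y, f y = 0 -> g y = 0.
  by move=> fi y /eqP; rewrite -(linear0 f) => /eqP/fi ->; rewrite linear0.
(* The s_i and t_i are the comparison maps, the h_i a homotopy from the t_i
   s_i to the identity. *)
have [s0 s0E] := injective_factor E0i (ker_inj _ _ _ eI eE eIi).
have [t0 t0E] := injective_factor I0i (ker_inj _ _ _ eE eI eEi).
have step (U V W F : lmodType A) (u : {linear U -> V}) (v : {linear V -> W})
    (g : {linear V -> F}) : injective_module F -> exact u v ->
    (forall x, g (u x) = 0) -> exists h : {linear W -> F}, forall y, h (v y) = g y.
  move=> Fi ex gu; apply: injective_factor => // y /ex[x <-]; exact: gu.
have zero (U V W : lmodType A) (u : {linear U -> V}) (v : {linear V -> W}) :
    exact u v -> forall x, v (u x) = 0.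
  by move=> ex x; apply/ex; exists x.
have [s1 s1E] : exists s1 : {linear I1 -> E1}, forall y, s1 (d0 y) = c0 (s0 y).
  apply: (step _ _ _ _ eI d0 (c0 \o s0 : {linear _ -> _})) => // x /=.
  by rewrite s0E (zero _ _ _ _ _ exE0).
have [s2 s2E] : exists s2 : {linear I2 -> E2}, forall y, s2 (d1 y) = c1 (s1 y).
  apply: (step _ _ _ _ d0 d1 (c1 \o s1 : {linear _ -> _})) => // x /=.
  by rewrite s1E (zero _ _ _ _ _ exE1).
have [t1 t1E] : exists t1 : {linear E1 -> I1}, forall y, t1 (c0 y) = d0 (t0 y).
  apply: (step _ _ _ _ eE c0 (d0 \o t0 : {linear _ -> _})) => // x /=.
  by rewrite t0E (zero _ _ _ _ _ exI0).
have [t2 t2E] : exists t2 : {linear E2 -> I2}, forall y, t2 (c1 y) = d1 (t1 y).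
  apply: (step _ _ _ _ c0 c1 (d1 \o t1 : {linear _ -> _})) => // x /=.
  by rewrite t1E (zero _ _ _ _ _ exI1).
have [h1 h1E] : exists h1 : {linear I1 -> I0}, forall y, h1 (d0 y) = t0 (s0 y) - y.
  apply: (step _ _ _ _ eI d0 (((t0 \o s0) \- idfun) : {linear _ -> _})) => // x /=.
  by rewrite s0E t0E subrr.
have [h2 h2E] : exists h2 : {linear I2 -> I1}, forall y, h2 (d1 y) = t1 (s1 y) - y - d0 (h1 y).
  apply: (step _ _ _ _ d0 d1 (((t1 \o s1) \- idfun) \- (d0 \o h1) : {linear _ -> _})) => // x /=.
  by rewrite s1E t1E h1E linearB /= subrr.
exists ((t2 \o s2) \- (d1 \o h2) : {linear _ -> _}); split=> [z|y] /=.
  have [w <-] := c1s (s2 z); exists (t1 w - h2 z).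
  by rewrite linearB t2E.
rewrite s2E t2E h2E !linearB /= (zero _ _ _ _ _ exI1) !opprK addr0.
by rewrite addrA subrr add0r.
Qed.

End Injectives.

Lemma left_ideal_mulE (B : pzRingType) (e : B) (x : left_ideal e) :
  (val x : B) * e = val x.
Proof. by case: x => x /= /eqP. Qed.

Lemma left_ideal_eq0 (B : pzRingType) (e : B) (x : left_ideal e) :
  e = 0 -> x = 0.
Proof.
move=> e0; apply: val_inj; case: x => x /= /eqP <-.
by rewrite e0 mulr0.
Qed.

Section IdempotentFree.
Variables (B : pzRingType) (J : finType) (eps : J -> B).
Hypothesis eps_idem : forall j, eps j * eps j = eps j.
(** A finite sum of the projective modules generated by idempotents; maps out
    of it are given by elements u_j with eps_j u_j = u_j. *)
Definition idem_free : lmodType B := dsum (fun j => left_ideal (eps j) : lmodType B).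

Lemma idem_scale_val (a : B) (x : idem_free) j :
  (val ((a *: x) j) : B) = a * (val (x j) : B).
Proof. by []. Qed.

Lemma idem_valP (a : B) (x y : idem_free) j :
  (val ((a *: x + y) j) : B^o) = a *: (val (x j) : B^o) + val (y j).
Proof. by []. Qed.

Fact idem_gen_subproof i j : (if j == i then eps i else 0 : B^o) \in in_left_ideal (eps j).
Proof.
rewrite unfold_in; case: (j =P i) => [->|_]; first by rewrite eps_idem.
by rewrite mul0r.
Qed.
Definition idem_gen i : idem_free := fun j => LeftIdeal (idem_gen_subproof i j).

Lemma idem_genE i j : (val (idem_gen i j) : B) = if j == i then eps i else 0.
Proof. by []. Qed.

Lemma idem_sum_val (T : Type) (s : seq T) (P : pred T) (F : T -> idem_free) j :
  (val ((\sum_(t <- s | P t) F t) j) : B) = \sum_(t <- s | P t) (val (F t j) : B).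
Proof. by elim/big_rec2: _ => // t a b _ <-. Qed.

Lemma eps_idem_gen i : eps i *: idem_gen i = idem_gen i.
Proof.
apply: functional_extensionality_dep => j; apply: val_inj.
rewrite -[LHS]/(eps i * (if j == i then eps i else 0) : B) /=.
by case: (j == i); rewrite ?eps_idem ?mulr0.
Qed.

Lemma idem_gen0 i : eps i = 0 -> idem_gen i = 0.
Proof. by move=> e; rewrite -[LHS]eps_idem_gen e scale0r. Qed.

Section Out.
Variables (M : lmodType B) (u : J -> M).
Definition idem_out (x : idem_free) : M := \sum_j (val (x j) : B) *: u j.
Fact idem_out_linear : linear idem_out.
Proof.
move=> a x y; rewrite /idem_out scaler_sumr -big_split; apply: eq_bigr => j _.
by rewrite -[val (_ j)]/(a * val (x j) + val (y j) : B) scalerDl scalerA.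
Qed.
HB.instance Definition _ := GRing.isLinear.Build B idem_free M *:%R idem_out idem_out_linear.
Lemma idem_out_gen i : eps i *: u i = u i -> idem_out (idem_gen i) = u i.
Proof.
move=> ui; rewrite /idem_out (bigD1 i) //= eqxx ui big1 ?addr0 // => j /negPf ji.
by rewrite /= ji scale0r.
Qed.
End Out.

Lemma idem_freeE (x : idem_free) : x = \sum_j (val (x j) : B) *: idem_gen j.
Proof.
apply: functional_extensionality_dep => i; apply: val_inj.
have ev (s : seq J) (F : J -> idem_free) :
    val ((\sum_(j <- s) F j) i) = \sum_(j <- s) (val (F j i) : B).
  by elim/big_rec2: _ => // j a b _ <-.
rewrite ev (bigD1 i) //= big1 ?addr0 => [|j ji].
  rewrite -[RHS]/(val (x i) * (if i == i then eps i else 0) : B) eqxx; exact/esym/(left_ideal_mulE (x i)).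
by rewrite -[LHS]/(val (x j) * (if i == j then eps j else 0) : B) eq_sym (negPf ji) mulr0.
Qed.

Lemma idem_out_ext (M : lmodType B) (f : {linear idem_free -> M}) x :
  f x = idem_out (fun j => f (idem_gen j)) x.
Proof.
by rewrite {1}[x]idem_freeE linear_sum; apply: eq_bigr => j _; rewrite linearZ.
Qed.

Lemma idem_free_projective : projective_module idem_free.
Proof.
move=> U V q f qs; have [w wE] := choice (fun j => qs (f (idem_gen j))).
exists (idem_out w : {linear _ -> _}) => x; rewrite (idem_out_ext f) /=.
by rewrite linear_sum; apply: eq_bigr => j _; rewrite linearZ /= wE.
Qed.

End IdempotentFree.

(** * The inverse translate of the simple projective *)

Section BoundAlgebra.
Variables (K : fieldType) (Q : quiver) (R : finType).
Variables (r : R -> quiver_relation K Q).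
Local Notation vx := (vertex_series K).
Local Notation ar := (arrow_series K).
Local Notation I := (closed_ideal [set f | exists i, f = rel_series (r i)]).
Variables (Lam : kalgType K) (bpi : {rmorphism cpa K Q -> Lam}).
Hypothesis bpiK : forall c, bpi (kmap c) = kmap c.
Hypothesis bpi_eq0 : forall f, bpi f = 0 <-> I f.
Hypothesis bpi_surj : forall u, exists f, bpi f = u.

Lemma bpiD f g : bpi (f + g) = bpi f + bpi g. Proof. exact: rmorphD. Qed.
Lemma bpiB f g : bpi (f - g) = bpi f - bpi g. Proof. exact: rmorphB. Qed.
Lemma bpiM f g : bpi (f * g) = bpi f * bpi g. Proof. exact: rmorphM. Qed.
Lemma bpi1 : bpi 1 = 1. Proof. exact: rmorph1. Qed.
Lemma bpi_sum (T : Type) (s : seq T) (P : pred T) (F : T -> cpa K Q) :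
  bpi (\sum_(i <- s | P i) F i) = \sum_(i <- s | P i) bpi (F i).
Proof. exact: rmorph_sum. Qed.
Lemma bpi_eq f g : bpi f = bpi g <-> I (f - g).
Proof.
rewrite -bpi_eq0 bpiB; split=> [->|/eqP]; first by rewrite subrr.
by rewrite subr_eq0 => /eqP.
Qed.

(** Independent of the lift, as the elements of I have no terms of length
    less than two. *)
Definition const_coef v (x : Lam) : K := sval (cid (bpi_surj x)) (trivial_path v).

Lemma const_coef_bpi v f : const_coef v (bpi f) = f (trivial_path v).
Proof.
have /bpi_eq /ideal_rad2 := svalP (cid (bpi_surj (bpi f))).
by move=> /(_ (trivial_path v) isT); rewrite cpaBE => /eqP; rewrite subr_eq0 => /eqP.
Qed.

Lemma const_coefD v x y : const_coef v (x + y) = const_coef v x + const_coef v y.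
Proof.
have [f <-] := bpi_surj x; have [g <-] := bpi_surj y.
by rewrite -bpiD !const_coef_bpi.
Qed.
Lemma const_coefM v x y : const_coef v (x * y) = const_coef v x * const_coef v y.
Proof.
have [f <-] := bpi_surj x; have [g <-] := bpi_surj y.
by rewrite -bpiM !const_coef_bpi trivM.
Qed.

Section RightAction.
Variable U : lmodType Lam^c.
(** Right modules are modules over the converse ring; ract writes their
    action by series on the usual side, so that it can be computed with
    series. *)
Definition ract (u : U) (f : cpa K Q) : U := (bpi f : Lam^c) *: u.
Lemma ractM u f g : ract u (f * g) = ract (ract u f) g.
Proof. by rewrite /ract scalerA bpiM. Qed.
Lemma ract1 u : ract u 1 = u.
Proof. by rewrite /ract bpi1; exact: (scale1r u). Qed.
Lemma ract_kmap u c : ract u (kmap c) = ckmap Lam c *: u.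
Proof. by rewrite /ract bpiK. Qed.
Lemma ractD u f g : ract u (f + g) = ract u f + ract u g.
Proof. by rewrite /ract bpiD scalerDl. Qed.
Lemma ractB u f g : ract u (f - g) = ract u f - ract u g.
Proof. by rewrite /ract bpiB scalerBl. Qed.
Lemma ract0l f : ract 0 f = 0.
Proof. exact: scaler0. Qed.
Lemma ract_sum u (T : Type) (s : seq T) (P : pred T) (F : T -> cpa K Q) :
  ract u (\sum_(i <- s | P i) F i) = \sum_(i <- s | P i) ract u (F i).
Proof. by rewrite /ract bpi_sum scaler_suml. Qed.
Lemma ract_suml (T : Type) (s : seq T) (P : pred T) (u : T -> U) f :
  ract (\sum_(i <- s | P i) u i) f = \sum_(i <- s | P i) ract (u i) f.
Proof. by rewrite /ract scaler_sumr. Qed.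
Lemma ract_ideal u f : I f -> ract u f = 0.
Proof. by move=> /bpi_eq0 f0; rewrite /ract f0 scale0r. Qed.
Lemma ractE u f : (bpi f : Lam^c) *: u = ract u f. Proof. by []. Qed.
Lemma ract_surj (a : Lam^c) : exists f, forall u, a *: u = ract u f.
Proof. by have [f fa] := bpi_surj a; exists f => u; rewrite /ract fa. Qed.
End RightAction.
Lemma linear_ract (U V : lmodType Lam^c) (h : {linear U -> V}) u f :
  h (ract u f) = ract (h u) f.
Proof. exact: (linearZZ h (bpi f : Lam^c) u). Qed.

Lemma val_ract (J : finType) (eps : J -> Lam^c) (x : idem_free eps) f j :
  (val (ract x f j) : Lam) = (val (x j) : Lam) * bpi f.
Proof. exact: (idem_scale_val (bpi f : Lam^c) x j). Qed.

Section DualAction.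
Variable X : lmodType Lam^c.
Definition lact (f : cpa K Q) (l : rkdual X) : rkdual X := rkdual_scale (bpi f) l.
Lemma lactE f (l : rkdual X) x : lact f l x = l (ract x f).
Proof. by []. Qed.
Lemma lactM f g (l : rkdual X) : lact f (lact g l) = lact (f * g) l.
Proof. by apply: rkdual_eq => x; rewrite !lactE ractM. Qed.
Lemma linear_lact (h : {linear rkdual X -> rkdual X}) f l : h (lact f l) = lact f (h l).
Proof. exact: (linearZZ h (bpi f) l). Qed.
Lemma rkdual0 (l : rkdual X) : l 0 = 0.
Proof. by have := rkdualZ l 0 0; rewrite scaler0 mul0r. Qed.
Lemma rkdual_sum (l : rkdual X) (T : Type) (s : seq T) (G : T -> X) :
  l (\sum_(i <- s) G i) = \sum_(i <- s) l (G i).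
Proof.
elim/big_rec2: _ => [|i a b _ <-]; first exact: rkdual0.
by rewrite rkdualD.
Qed.
End DualAction.

Section SuperfluousKernel.
Variable n : nat.
Hypothesis I_nil : forall f, radical_power n f -> I f.
Variables (X Y : lmodType Lam^c) (f : {linear X -> Y}).
Variable q : {linear rkdual X -> rkdual X}.
Hypothesis q_im : forall l, exists h, rkdual_map f h = q l.
Hypothesis q_id : forall h, q (rkdual_map f h) = rkdual_map f h.
Variables (J : finType) (g : J -> X).
Hypothesis f_rad : forall x, f x = 0 ->
  exists2 y : J -> cpa K Q, x = \sum_i ract (g i) (y i) &
    forall i, radical_power 1 (y i).

Let vanishing_fixed (l : rkdual X) : (forall x, f x = 0 -> l x = 0) -> q l = l.
Proof.
move=> /rkdual_factor[h hE].
have -> : l = rkdual_map f h by apply: rkdual_eq => x; exact/esym/hE.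
exact: q_id.
Qed.

Let q_ker m (l : rkdual X) :
  (forall f, radical_power m f -> lact f l = 0) -> q l = 0 -> l = 0.
Proof.
elim: m l => [|m IH] l hl ql.
  have e : lact 1 l = l by apply: rkdual_eq => x; rewrite lactE ract1.
  by rewrite -e; apply: hl.
apply: (IH) => // u hu; set l' := lact u l.
have ql' : q l' = 0 by rewrite linear_lact ql; apply: rkdual_eq.
have l'0 v : radical_power 1 v -> lact v l' = 0.
  by move=> hv; rewrite lactM; apply: hl; rewrite -add1n; exact: radical_powerM.
rewrite -ql'; apply/esym/vanishing_fixed => x /f_rad[y -> hy].
rewrite rkdual_sum big1 // => i _.
by rewrite -lactE l'0.
Qed.

(** Functionals killed by the radical vanish on the kernel of f, because it
    is contained in X rad, so they lie in the image of D f, where q is the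
    identity. Hence q is injective on the socle of D X, and on D X since the
    radical is nilpotent. As q is idempotent, it is then the identity, D f is
    onto, and f is injective. *)
Lemma retract_kernel0 x : f x = 0 -> x = 0.
Proof.
have q_inj (l : rkdual X) : q l = 0 -> l = 0.
  apply: (q_ker (m := n)) => u /I_nil Iu; apply: rkdual_eq => z.
  by rewrite lactE ract_ideal // rkdual0.
move=> fx; apply: rkdual_separates => l.
have /q_inj/eqP : q (l - q l) = 0.
  rewrite linearB /=; have [h <-] := q_im l; apply/eqP; rewrite subr_eq0.
  by rewrite q_id.
rewrite subr_eq0 => /eqP ->; have [h <-] := q_im l.
by rewrite /= fx rkdual0.
Qed.
End SuperfluousKernel.

Variable k : vert Q.
Local Notation rs i := (rel_series (r i)).
Local Notation Pk := (left_ideal (bpi (vx k)) : lmodType Lam).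
Hypothesis k_source : is_source k.
Variable n : nat.
Hypothesis I_nil : forall f, radical_power n f -> I f.

Definition simple_gen : Pk.
Proof.
exists (bpi (vx k)); rewrite unfold_in; apply/eqP.
by rewrite -bpiM vx_vx eqxx.
Defined.

(** No path of positive length ends at the source k: the module is
    one-dimensional. *)
Lemma simpleE (x : Pk) : x = kmap (const_coef k (val x)) *: simple_gen.
Proof.
apply: val_inj; have [f ef] := bpi_surj (val x).
have e : (val x : Lam) = val x * bpi (vx k) := esym (left_ideal_mulE x).
rewrite [LHS]e -ef const_coef_bpi.
by rewrite -bpiM (Mvx_source k_source) bpiM bpiK.
Qed.

Lemma simple_coefZ f (x : Pk) :
  const_coef k (val (bpi f *: x)) = f (trivial_path k) * const_coef k (val x).
Proof. by rewrite -const_coef_bpi -const_coefM. Qed.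

Fact simple_dual_gen_D (x y : Pk) :
  const_coef k (val (x + y)) = const_coef k (val x) + const_coef k (val y).
Proof. exact: const_coefD. Qed.
Fact simple_dual_gen_Z c (x : Pk) :
  const_coef k (val ((kmap c : Lam) *: x)) = c * const_coef k (val x).
Proof. by rewrite -bpiK simple_coefZ cpa_kmapE. Qed.
Definition simple_dual_gen : kdual Pk := KDual simple_dual_gen_D simple_dual_gen_Z.

Lemma simple_dual_gen1 : simple_dual_gen simple_gen = 1.
Proof.
by rewrite [LHS]const_coef_bpi vertex_seriesE eqxx.
Qed.

Lemma simple_dualE (l : kdual Pk) :
  l = ract simple_dual_gen (kmap (l simple_gen)).
Proof.
apply: kdual_eq => x; rewrite [x in LHS]simpleE kdualZ mulrC.
by rewrite -[RHS]/(simple_dual_gen (bpi _ *: x)) [RHS]simple_coefZ cpa_kmapE.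
Qed.

Lemma ract_simple_dual_gen f x : ract simple_dual_gen f x =
  f (trivial_path k) * simple_dual_gen x.
Proof. exact: simple_coefZ. Qed.

Variables (P1 P0 : lmodType Lam^c).
Variables (f1 : {linear P1 -> P0}) (f0 : {linear P0 -> (kdual Pk : lmodType Lam^c)}).
Hypothesis P1_proj : projective_module P1.
Hypothesis P0_proj : projective_module P0.
Hypothesis f0_surj : surj f0.
Hypothesis f1f0 : exact f1 f0.
Hypothesis f0_ess : forall (U : lmodType Lam^c) (g : {linear U -> P0}),
  surj (f0 \o g) -> surj g.
Hypothesis f1_ess : forall (U : lmodType Lam^c) (g : {linear U -> P1}),
  exact (f1 \o g) f0 -> surj g.

Lemma exists_u0 : exists u : P0, f0 u = simple_dual_gen /\ ract u (vx k) = u.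
Proof.
have [u fu] := f0_surj simple_dual_gen; exists (ract u (vx k)).
split; last by rewrite -ractM vx_vx eqxx.
rewrite linear_ract fu; apply: kdual_eq => x.
by rewrite ract_simple_dual_gen vertex_seriesE eqxx mul1r.
Qed.
Variable u0 : P0.
Hypothesis f0u0 : f0 u0 = simple_dual_gen.
Hypothesis u0k : ract u0 (vx k) = u0.

Lemma f0_u0 f x : f0 (ract u0 f) x = f (trivial_path k) * simple_dual_gen x.
Proof. by rewrite linear_ract f0u0 ract_simple_dual_gen. Qed.

Lemma f0_u0_eq0 f : f0 (ract u0 f) = 0 <-> f (trivial_path k) = 0.
Proof.
split=> [/(congr1 (fun l : kdual Pk => l simple_gen))|h].
  by rewrite f0_u0 simple_dual_gen1 mulr1.
by apply: kdual_eq => x; rewrite f0_u0 h mul0r.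
Qed.

Let eps0 (_ : unit) : Lam^c := bpi (vx k).
Let eps0_idem j : eps0 j * eps0 j = eps0 j.
Proof. by rewrite -[LHS]/(bpi (vx k) * bpi (vx k)) -bpiM vx_vx eqxx. Qed.
Local Notation F0 := (idem_free eps0).
Let g0 : {linear F0 -> P0} := idem_out (eps := eps0) (fun=> u0).

Let g0_gen : g0 (idem_gen eps0_idem tt) = u0.
Proof. exact: (@idem_out_gen _ _ eps0 eps0_idem P0 (fun=> u0) tt u0k). Qed.

Let g0_surj : surj g0.
Proof.
apply: f0_ess => l; exists (ract (idem_gen eps0_idem tt) (kmap (l simple_gen))).
by rewrite /comp linear_ract g0_gen linear_ract f0u0 -simple_dualE.
Qed.

(** The cyclic module generated by u0 maps onto the simple module, which is
    enough as f0 is an essential epimorphism. *)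
Lemma P0_gen u : exists f, u = ract u0 f.
Proof.
have [x <-] := g0_surj u; have [f fE] := bpi_surj (val (x tt)).
exists f; have -> : g0 x = \sum_j (val (x j) : Lam^c) *: u0 by [].
by rewrite (bigD1 tt) //= big1 ?addr0 /ract ?fE // => -[].
Qed.

Lemma exists_section0 : exists s : {linear P0 -> F0}, forall u, g0 (s u) = u.
Proof.
have [s hs] := @P0_proj _ _ g0 (idfun : {linear P0 -> P0}) g0_surj.
by exists s => u; rewrite hs.
Qed.
Variable s0 : {linear P0 -> F0}.
Hypothesis s0E : forall u, g0 (s0 u) = u.

Lemma s0_u0 : val (s0 u0 tt) = bpi (vx k).
Proof.
have e1 : s0 u0 = ract (s0 u0) (vx k) by rewrite -linear_ract u0k.
have e2 : val (s0 u0 tt) = bpi (vx k) * val (s0 u0 tt) :> Lam.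
  exact: (esym (left_ideal_mulE (s0 u0 tt))).
have e3 : (val (s0 u0 tt) : Lam) = (val (s0 u0 tt) : Lam) * bpi (vx k).
  by rewrite {1}e1; exact: val_ract.
have [f fE] := bpi_surj (val (s0 u0 tt)).
have ff : f (trivial_path k) = 1.
  have := congr1 (fun u : P0 => f0 u simple_gen) (s0E u0).
  have -> : g0 (s0 u0) = \sum_j (val (s0 u0 j) : Lam^c) *: u0 by [].
  rewrite (bigD1 tt) //= big1 ?addr0 => [|[] //].
  by rewrite -fE ractE f0_u0 f0u0 simple_dual_gen1 mulr1.
by rewrite e3 -fE -bpiM (Mvx_source k_source) ff kmap1 mul1r.
Qed.

(** The first term of the minimal presentation is the projective right module
    e_k Lambda: its section s0 sends u0 to the idempotent at k. *)
Lemma ract_u0_eq0 f : ract u0 f = 0 <-> I (vx k * f).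
Proof.
split=> [h|h]; last by rewrite -u0k -ractM ract_ideal.
have /(congr1 (fun x : F0 => val (x tt) : Lam)) : s0 (ract u0 f) = 0.
  by rewrite h linear0.
rewrite linear_ract val_ract s0_u0 -bpiM.
by move/bpi_eq0.
Qed.

(** The kernel of f0 is the radical of P0, generated by the u0 a for the
    arrows a out of k; lift these to P1. The value zero for the other arrows
    lets sums range over all arrows. *)
Lemma exists_u1 : exists u : arr Q -> P1,
  [/\ forall a, src a = k -> f1 (u a) = ract u0 (ar a),
      forall a, ract (u a) (vx (tgt a)) = u a &
      forall a, src a != k -> u a = 0].
Proof.
have /choice[u hu] a : exists u : P1, [/\ src a = k -> f1 u = ract u0 (ar a),
    ract u (vx (tgt a)) = u & src a != k -> u = 0].
  have [ak|ak] := eqVneq (src a) k; last first.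
    by exists 0; split=> // [ak'|]; [rewrite ak' eqxx in ak|rewrite ract0l].
  have /f1f0[u fu] : f0 (ract u0 (ar a)) = 0 by apply/f0_u0_eq0/vertex_arrow0.
  exists (ract u (vx (tgt a))); split=> //.
    by move=> _; rewrite linear_ract fu -ractM ar_vx eqxx.
  by rewrite -ractM vx_vx eqxx.
by exists u; split=> a; case: (hu a).
Qed.
Variable u1 : arr Q -> P1.
Hypothesis f1u1 : forall a, src a = k -> f1 (u1 a) = ract u0 (ar a).
Hypothesis u1t : forall a, ract (u1 a) (vx (tgt a)) = u1 a.
Hypothesis u1_0 : forall a, src a != k -> u1 a = 0.

Let eps1 a : Lam^c := if src a == k then bpi (vx (tgt a)) else 0.
Let eps1_idem a : eps1 a * eps1 a = eps1 a.
Proof.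
rewrite /eps1; case: eqP => _; last by rewrite mul0r.
by rewrite -[LHS]/(bpi (vx (tgt a)) * bpi (vx (tgt a))) -bpiM vx_vx eqxx.
Qed.
Local Notation F1 := (idem_free eps1).
Let g1 : {linear F1 -> P1} := idem_out (eps := eps1) u1.

Let g1_gen a : g1 (idem_gen eps1_idem a) = u1 a.
Proof.
apply: (idem_out_gen eps1_idem); rewrite /eps1.
case: eqP => [ak|/eqP ak]; last by rewrite u1_0 // scale0r.
exact: u1t.
Qed.

Lemma vx_source_decomp f : f (trivial_path k) = 0 ->
  vx k * f = \sum_(a | src a == k) ar a * lder a f.
Proof. by move=> fk; rewrite vertex_decomp fk kmap0 mul0r add0r. Qed.

Let g1_surj : surj g1.
Proof.
apply: f1_ess => u; split; last first.
  by move=> [x <-]; apply/f1f0; exists (g1 x).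
have [f ->] := P0_gen u => /f0_u0_eq0 fk.
exists (\sum_(a | src a == k) ract (idem_gen eps1_idem a) (lder a f)).
rewrite -[LHS]/(f1 (g1 _)) (linear_sum g1) (linear_sum f1) -u0k -ractM (vx_source_decomp fk) ract_sum.
by apply: eq_bigr => a /eqP ak; rewrite !linear_ract g1_gen f1u1 // ractM.
Qed.

(** The images of the u_a generate the image of f1, and P1 is a projective
    cover of the latter. *)
Lemma P1_gen u : exists F, u = \sum_a ract (u1 a) (F a).
Proof.
have [x <-] := g1_surj u.
have [F FE] := choice (fun a => ract_surj P1 (val (x a))).
exists F; have -> : g1 x = \sum_a (val (x a) : Lam^c) *: u1 a by [].
by apply: eq_bigr => a _; rewrite FE.
Qed.

Lemma f1_sum F : f1 (\sum_a ract (u1 a) (F a)) =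
  ract u0 (\sum_(a | src a == k) ar a * F a).
Proof.
rewrite linear_sum ract_sum [RHS]big_mkcond; apply: eq_bigr => a _.
rewrite linear_ract; case: eqP => [ak|/eqP ak]; first by rewrite f1u1 // ractM.
by rewrite u1_0 // linear0 ract0l.
Qed.

Lemma vx_sum_ar F : vx k * (\sum_(a | src a == k) ar a * F a) =
  \sum_(a | src a == k) ar a * F a.
Proof.
rewrite mulr_sumr; apply: eq_bigr => a /eqP ak.
by rewrite mulrA vx_ar ak eqxx.
Qed.

Lemma exists_section1 : exists s : {linear P1 -> F1}, forall u, g1 (s u) = u.
Proof.
have [s hs] := @P1_proj _ _ g1 (idfun : {linear P1 -> P1}) g1_surj.
by exists s => u; rewrite hs.
Qed.
Variable s1 : {linear P1 -> F1}.
Hypothesis s1E : forall u, g1 (s1 u) = u.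

Lemma F1E (x : F1) : exists F, x = \sum_a ract (idem_gen eps1_idem a) (F a) /\
  forall a, val (x a) = bpi (F a) :> Lam.
Proof.
have [F FE] := choice (fun a => bpi_surj (val (x a))).
exists F; split; last by move=> a; rewrite FE.
by rewrite [LHS](idem_freeE eps1_idem); apply: eq_bigr => a _; rewrite /ract FE.
Qed.

Lemma idem1_val (x : F1) a : src a = k ->
  (val (x a) : Lam) = bpi (vx (tgt a)) * val (x a).
Proof.
have e : (eps1 a : Lam) * (val (x a) : Lam) = val (x a) := left_ideal_mulE (x a).
by move=> ak; rewrite -[LHS]e; congr (_ * _); rewrite /eps1 ak eqxx.
Qed.

(** The section s1 sends u_b to the generator of index b up to the radical,
    because applying f1 to s1 (u_b) - u_b gives a relation between the arrows
    modulo I, and elements of I have no terms of length one. Hence a relation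
    between the u_a has coefficients which lie in I up to the radical times
    themselves; iterate. *)
Lemma P1_relation F : \sum_a ract (u1 a) (F a) = 0 ->
  forall a, src a = k -> I (vx (tgt a) * F a).
Proof.
move=> F0.
have [W WE] := choice (fun b => F1E (s1 (u1 b))).
have Wrad a b : src a = k -> src b = k ->
    radical_power 1 (vx (tgt a) * W b a - (if a == b then vx (tgt a) else 0)).
  move=> ak bk; have [e _] := WE b.
  have := s1E (u1 b); rewrite e linear_sum.
  under eq_bigr => c _ do rewrite linear_ract g1_gen.
  move/(congr1 f1); rewrite f1_sum f1u1 // => /eqP.
  rewrite -subr_eq0 -ractB => /eqP/ract_u0_eq0.
  rewrite mulrBr vx_sum_ar vx_ar bk eqxx => /ideal_rad2/(radical_power_lder a).
  rewrite raddfB /= lder_sum_ar ak eqxx lder_ar.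
  by case: (a =P b) => [->|].
have hW a : src a = k -> I (\sum_b W b a * F b).
  move=> ak; apply/bpi_eq0.
  have : s1 (\sum_b ract (u1 b) (F b)) = 0 by rewrite F0 linear0.
  move/(congr1 (fun x : F1 => val (x a) : Lam)).
  rewrite linear_sum.
  move=> h0; have h := etrans (esym (@idem_sum_val Lam^c _ eps1 _ _ _ _ a)) h0.
  rewrite bpi_sum -[RHS]h; apply: eq_bigr => b _.
  rewrite linear_ract bpiM -(WE b).2; exact/esym/val_ract.
suff H m a : src a = k -> exists2 G, I G & radical_power m (vx (tgt a) * F a - G).
  move=> a ak; have [G IG /I_nil] := H n a ak.
  by move=> h; rewrite -(subrK G (vx _ * _)); apply: idealD.
elim: m a => [|m IH] a ak.
  by exists 0; [exact: ideal0|].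
have /choice[G GE] : forall b, exists G, src b = k ->
    I G /\ radical_power m (vx (tgt b) * F b - G).
  move=> b; have [bk|bk] := pselect (src b = k); last by exists 0.
  by have [G IG hG] := IH b bk; exists G.
pose E b := vx (tgt b) * F b.
pose V b := vx (tgt a) * W b a - (if a == b then vx (tgt a) else 0).
have VE b : src b = k -> radical_power m.+1 (V b * (E b - G b)).
  move=> bk; rewrite -add1n; apply: radical_powerM; first exact: Wrad.
  by case: (GE b bk).
have WE0 b : bpi (W b a) * bpi (F b) =
    if src b == k then bpi (W b a) * bpi (E b) else 0.
  case: eqP => [bk|/eqP bk].
    rewrite /E bpiM mulrA; congr (_ * _).
    rewrite -(WE b).2 -[u1 b in LHS]u1t linear_ract.
    by rewrite val_ract.
  by rewrite -(WE b).2 u1_0 // linear0 [X in X * _](_ : _ = 0) // mul0r.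
exists (E a + \sum_(b | src b == k) V b * E b - \sum_(b | src b == k) V b * G b).
  apply: idealB; last first.
    apply: ideal_sum => b /eqP bk; apply: idealMl.
    by case: (GE b bk).
  have := idealMl (vx (tgt a)) (hW a ak); move/bpi_eq0 => h; apply/bpi_eq0.
  rewrite -[RHS]h bpiM bpi_sum mulr_sumr.
  have -> : E a + \sum_(b | src b == k) V b * E b =
      \sum_(b | src b == k) vx (tgt a) * W b a * E b.
    rewrite (bigD1 a) ?ak //= [RHS](bigD1 a) ?ak //=.
    rewrite /V eqxx mulrBl addrA; congr (_ + _).
      by rewrite /E [vx _ * (vx _ * _)]mulrA vx_vx eqxx addrC subrK.
    by apply: eq_bigr => b /andP[_ /negPf ba]; rewrite eq_sym ba subr0.
  rewrite bpi_sum big_mkcond; apply: eq_bigr => b _.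
  rewrite [in RHS]bpiM WE0; case: eqP => _; last by rewrite mulr0.
  by rewrite [LHS]bpiM mulrA; congr (_ * _); exact: bpiM.
have eS : \sum_(b | src b == k) V b * E b - \sum_(b | src b == k) V b * G b =
    \sum_(b | src b == k) V b * (E b - G b).
  by rewrite -sumrB; apply: eq_bigr => b _; rewrite mulrBr.
rewrite -/(E a) -addrA eS opprD addrA subrr sub0r.
by apply/radical_powerN/radical_power_sum => b /eqP; exact: VE.
Qed.

Let g1_inj x : g1 x = 0 -> x = 0.
Proof.
have [F [xF vF]] := F1E x; move=> gx.
have /P1_relation rel : \sum_a ract (u1 a) (F a) = 0.
  rewrite -[RHS]gx xF linear_sum; apply: eq_bigr => a _.
  by rewrite linear_ract g1_gen.
apply: functional_extensionality_dep => a; apply: val_inj.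
have [ak|/eqP ak] := pselect (src a = k).
  by rewrite [LHS](idem1_val x ak) vF -bpiM; apply/bpi_eq0/rel.
by rewrite [x a]left_ideal_eq0 // /eps1 (negPf ak).
Qed.

Let s1_u1 b : s1 (u1 b) = idem_gen eps1_idem b.
Proof.
apply/eqP; rewrite -subr_eq0; apply/eqP/g1_inj.
by rewrite linearB s1E g1_gen subrr.
Qed.

Section Cokernel.
Lemma rdual_ract (P : lmodType Lam^c) (g : rdual P) u f :
  (g (ract u f) : Lam) = (g u : Lam) * bpi f.
Proof. exact: (homZE g (bpi f) u). Qed.
Lemma rdual0 (P : lmodType Lam^c) (g : rdual P) : g 0 = 0.
Proof. exact: (linear0 (g : {linear P -> Lam^c^o})). Qed.
Lemma hom_sum (P : lmodType Lam^c) (g : rdual P) (T : Type) (s : seq T) (F : T -> P) :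
  (g (\sum_(i <- s) F i) : Lam) = \sum_(i <- s) (g (F i) : Lam).
Proof. exact: (linear_sum (g : {linear P -> Lam^c^o})). Qed.
Lemma rdual_sumE (P : lmodType Lam^c) (T : Type) (s : seq T) (q : pred T)
    (c : T -> Lam) (g : T -> rdual P) u :
  ((\sum_(i <- s | q i) c i *: g i : rdual P) u : Lam) =
  \sum_(i <- s | q i) c i * (g i u : Lam).
Proof. by elim/big_rec2: _ => // i x y _ <-. Qed.

Fact dual_gen_linear a : linear (fun x : P1 => (val (s1 x a) : Lam^c^o)).
Proof. by move=> c x y; rewrite linearP; exact: idem_valP. Qed.
(** P1 is free on the u_a, up to idempotents, so it has a dual basis. *)
Lemma exists_dual_gen : exists dg : arr Q -> rdual P1,
  (forall a b, (dg a (u1 b) : Lam) = if a == b then (eps1 b : Lam) else 0) /\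
  (forall a v, src a = k -> bpi (vx (tgt a)) * (dg a v : Lam) = dg a v).
Proof.
exists (fun a => mk_hom (dual_gen_linear a)); split=> [a b|a v ak].
  by rewrite -[LHS]/(val (s1 (u1 b) a) : Lam) s1_u1.
by rewrite -[RHS]/(val (s1 v a) : Lam) idem1_val.
Qed.
Variable dg : arr Q -> rdual P1.
Hypothesis dgE : forall a b, (dg a (u1 b) : Lam) = if a == b then (eps1 b : Lam) else 0.
Hypothesis dg_vx : forall a v, src a = k -> bpi (vx (tgt a)) * (dg a v : Lam) = dg a v.

Let dg_expand (g : rdual P1) :
  g = \sum_(a | src a == k) (g (u1 a) : Lam) *: dg a.
Proof.
apply: hom_eq => v; have [F ->] := P1_gen v.
rewrite [LHS]hom_sum [RHS]hom_sum; apply: eq_bigr => b _.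
rewrite [LHS]rdual_ract [RHS]rdual_ract; congr (_ * _).
rewrite [RHS]rdual_sumE.
have [bk|bk] := eqVneq (src b) k.
  rewrite (bigD1 b) ?bk // dgE eqxx big1 => [|a /andP[_ /negPf ab]].
    by rewrite [RHS]addr0 /eps1 bk eqxx -rdual_ract u1t.
  by rewrite dgE ab mulr0.
rewrite big1 => [|a /eqP ak].
  by rewrite u1_0 //; exact: (linear0 (g : {linear _ -> _})).
rewrite dgE; case: eqP => [ab|_]; last by rewrite mulr0.
by move: bk; rewrite -ab ak eqxx.
Qed.

Variables (N : lmodType Lam) (p : {linear rdual P1 -> N}).
Hypothesis p_surj : surj p.
Hypothesis p_ker : forall g : rdual P1,
  p g = 0 <-> exists h : rdual P0, forall x, g x = h (f1 x).

(** The dual of the minimal presentation sends the functional with value f at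
    u0 to the family of the f a; its cokernel is generated by the dual basis,
    with the single relation that the sum of the a nn_a vanishes. As Lambda
    e_k is one-dimensional, only scalar multiples of this relation occur. *)
Lemma cokernel_generators : exists nn : arr Q -> N,
  [/\ forall a, src a = k -> bpi (vx (tgt a)) *: nn a = nn a,
      forall u, exists x : arr Q -> Lam, u = \sum_(a | src a == k) x a *: nn a &
      forall x : arr Q -> Lam, \sum_(a | src a == k) x a *: nn a = 0 <->
        exists c : K, forall a, src a = k ->
          x a * bpi (vx (tgt a)) = kmap c * bpi (ar a)].
Proof.
exists (fun a => p (dg a)); split.
- move=> a ak; rewrite -linearZ; congr (p _); apply: hom_eq => v.
  exact: dg_vx.
- move=> u; have [g <-] := p_surj u; exists (fun a => (g (u1 a) : Lam)).
  rewrite [in LHS](dg_expand g) linear_sum; apply: eq_bigr => a _.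
  by rewrite linearZ.
move=> x; pose g : rdual P1 := \sum_(a | src a == k) x a *: dg a.
have gE b : src b = k -> (g (u1 b) : Lam) = x b * bpi (vx (tgt b)).
  move=> bk; rewrite [LHS]rdual_sumE (bigD1 b) ?bk //= dgE eqxx /eps1 bk eqxx.
  rewrite big1 => [|a /andP[_ /negPf ab]]; first exact: addr0.
  by rewrite dgE ab mulr0.
have -> : \sum_(a | src a == k) x a *: p (dg a) = p g.
  by rewrite linear_sum; apply: eq_bigr => a _; rewrite linearZ.
split=> [/p_ker[h hE]|[c cE]].
  have [f fE] := bpi_surj (h u0 : Lam).
  exists (f (trivial_path k)) => b bk.
  rewrite -gE // [LHS]hE f1u1 // rdual_ract -u0k rdual_ract -fE -!bpiM.
  by rewrite -bpiK -bpiM Mvx_source // -mulrA vx_ar bk eqxx.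
apply/p_ker.
have h_lin : linear (fun x : P0 => (kmap c * (val (s0 x tt) : Lam) : Lam^c^o)).
  move=> d y z; rewrite linearP [val _]idem_valP [LHS]mulrDr; congr (_ + _).
  exact: (@mulrA Lam (kmap c) (val (s0 y tt)) d).
exists (mk_hom h_lin) => v; have [F ->] := P1_gen v.
have fsum : f1 (\sum_a ract (u1 a) (F a)) = \sum_a ract (f1 (u1 a)) (F a).
  by rewrite linear_sum; apply: eq_bigr => a _; rewrite linear_ract.
rewrite fsum [LHS]hom_sum [RHS]hom_sum; apply: eq_bigr => b _.
rewrite [LHS]rdual_ract [RHS]rdual_ract; congr (_ * _).
have [bk|bk] := eqVneq (src b) k; last first.
  by rewrite u1_0 // (linear0 f1) !rdual0.
rewrite [LHS]gE // cE // f1u1 // [RHS]rdual_ract.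
rewrite -[RHS]/(kmap c * (val (s0 u0 tt) : Lam) * bpi (ar b)) s0_u0.
by rewrite -mulrA -bpiM vx_ar bk eqxx.
Qed.

End Cokernel.

Section InjectiveDimension.

Lemma exact_rkdual (X Y Z : lmodType Lam^c) (f : {linear X -> Y}) (g : {linear Y -> Z}) :
  exact f g -> exact (rkdual_map g : {linear rkdual Z -> rkdual Y})
                     (rkdual_map f : {linear rkdual Y -> rkdual X}).
Proof.
move=> fg l; split=> [lf|[h <-]].
  have [|h hE] := @rkdual_factor _ _ _ _ g l.
    move=> y /fg[x <-]; exact: (congr1 (fun m : rkdual X => m x) lf).
  by exists h; apply: rkdual_eq.
apply: rkdual_eq => x /=.
have -> : g (f x) = 0 by apply/fg; exists x.
by have := rkdualZ h 0 0; rewrite scaler0 mul0r.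
Qed.

Fact eval_simple_D (x : Pk) u v : f0 (u + v) x = f0 u x + f0 v x.
Proof. by rewrite linearD. Qed.
Fact eval_simple_Z (x : Pk) c u : f0 (ckmap Lam c *: u) x = c * f0 u x.
Proof. by rewrite linearZ /= -kdualZ. Qed.
Definition eval_simple (x : Pk) : rkdual P0 := RKDual (eval_simple_D x) (eval_simple_Z x).
Fact eval_simple_linear : linear eval_simple.
Proof.
move=> a x y; apply: rkdual_eq => u /=.
by rewrite kdualD; congr (_ + _); rewrite linearZ.
Qed.
HB.instance Definition _ :=
  GRing.isLinear.Build Lam Pk (rkdual P0) *:%R eval_simple eval_simple_linear.

Lemma eval_simple_inj : injective eval_simple.
Proof.
move=> x y /(congr1 (fun l : rkdual P0 => l u0)) /=; rewrite f0u0 => xy.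
by rewrite [x]simpleE [y]simpleE; congr (kmap _ *: _).
Qed.

Lemma exact_eval_simple :
  exact eval_simple (rkdual_map f1 : {linear rkdual P0 -> rkdual P1}).
Proof.
move=> l; split=> [lf1|[x <-]]; last first.
  apply: rkdual_eq => u /=.
  by have -> : f0 (f1 u) = 0 by apply/f1f0; exists u.
exists (kmap (l u0) *: simple_gen); apply: rkdual_eq => u.
have [f ->] := P0_gen u.
rewrite -[f](subrK (kmap (f (trivial_path k)))) ractD !rkdualD; congr (_ + _).
  have /f1f0[w fw] : f0 (ract u0 (f - kmap (f (trivial_path k)))) = 0.
    by apply/f0_u0_eq0; rewrite cpaBE cpa_kmapE subrr.
  rewrite -[LHS]/(f0 _ _) f0_u0 cpaBE cpa_kmapE subrr mul0r -fw.
  exact/esym/(congr1 (fun m : rkdual P1 => m w) lf1).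
rewrite -[LHS]/(f0 _ _) f0_u0 cpa_kmapE ract_kmap rkdualZ.
by rewrite kdualZ simple_dual_gen1 mulr1.
Qed.

(** Without arrows out of k the dual of the simple projective is itself
    projective, and duals of projectives are injective. *)
Lemma no_arrow_injective : (forall a, src a != k) -> injective_module Pk.
Proof.
move=> no_arrow; apply: (@injective_bij _ _ (rkdual P0) (eval_simple : {linear _ -> _})).
  have sE (l : rkdual P0) : exists x, eval_simple x = l.
    apply/exact_eval_simple; apply: rkdual_eq => u.
    have [F ->] := P1_gen u; rewrite big1 => [|a _].
      by have := rkdualZ (rkdual_map f1 l) 0 0; rewrite scaler0 mul0r.
    by rewrite u1_0 // ract0l.
  have [s sK] := choice sE; exists s => // x.
  by apply: eval_simple_inj; rewrite [LHS]sK.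
exact: injective_rkdual.
Qed.

Hypothesis r_min : minimal_relations r.

Let eps2 i : Lam^c := if rel_src (r i) == k then bpi (vx (rel_tgt (r i))) else 0.
Let eps2_idem i : eps2 i * eps2 i = eps2 i.
Proof.
rewrite /eps2; case: eqP => _; last by rewrite mul0r.
rewrite -[LHS]/(bpi (vx (rel_tgt (r i))) * bpi (vx (rel_tgt (r i)))).
by rewrite -bpiM vx_vx eqxx.
Qed.
Local Notation F2 := (idem_free eps2).
Let u2 i : P1 := if rel_src (r i) == k then
  \sum_a ract (u1 a) (lder a (rs i)) else 0.
Let f2 : {linear F2 -> P1} := idem_out (eps := eps2) u2.

Let f2_gen i : f2 (idem_gen eps2_idem i) = u2 i.
Proof.
apply: (idem_out_gen eps2_idem); rewrite /eps2 /u2; case: eqP => _; last by rewrite scale0r.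
rewrite -[LHS]/(ract _ _) ract_suml; apply: eq_bigr => a _.
by rewrite -ractM lder_rel_end.
Qed.

Let F2E (x : F2) : exists y, x = \sum_i ract (idem_gen eps2_idem i) (y i) /\
  forall i, val (x i) = bpi (y i) :> Lam.
Proof.
have [y yE] := choice (fun i => bpi_surj (val (x i))).
exists y; split; last by move=> i; rewrite yE.
by rewrite [LHS](idem_freeE eps2_idem); apply: eq_bigr => i _; rewrite /ract yE.
Qed.

Let f2_sum y : f2 (\sum_i ract (idem_gen eps2_idem i) (y i)) =
  \sum_a ract (u1 a) (rel_comb r k y a).
Proof.
rewrite linear_sum; under eq_bigr => i _ do rewrite linear_ract f2_gen /u2.
under [RHS]eq_bigr => a _ do rewrite ract_sum.
rewrite exchange_big [RHS]big_mkcond /=; apply: eq_bigr => i _.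
case: eqP => _; last by rewrite ract0l.
by rewrite ract_suml; apply: eq_bigr => a _; rewrite -ractM.
Qed.

Let exact_f2 : exact f2 f1.
Proof.
move=> u; split=> [f1u|[x <-]].
  have [F uF] := P1_gen u.
  pose g := \sum_(a | src a == k) ar a * F a.
  have Ig : I g.
    by rewrite /g -vx_sum_ar; apply/ract_u0_eq0; rewrite -f1_sum -uF.
  have [y hy] := lder_ideal k I_nil Ig.
  exists (\sum_i ract (idem_gen eps2_idem i) (y i)).
  rewrite f2_sum uF; apply/eqP; rewrite -subr_eq0 -sumrB big1 // => a _.
  have [ak|/eqP ak] := pselect (src a = k); last first.
    by rewrite u1_0 // !ract0l subr0.
  rewrite -[in X in _ - X]u1t -ractM -ractB -opprB ract_ideal //; apply: idealN.
  by have := hy a ak; rewrite lder_sum_ar ak eqxx.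
have [y [-> _]] := F2E x; rewrite f2_sum f1_sum.
have -> : \sum_(a | src a == k) ar a * rel_comb r k y a =
    \sum_(i | rel_src (r i) == k) rs i * y i.
  under eq_bigr => a _ do rewrite mulr_sumr.
  rewrite (exchange_big_dep (fun i => rel_src (r i) == k)) //=.
  apply: eq_bigr => i /eqP ik.
  rewrite -[in RHS](rel_start r i) ik vx_source_decomp ?(rel_rad2 r) // mulr_suml.
  by rewrite big_mkcondr /=; apply: eq_bigr => a _; rewrite eqxx mulrA.
rewrite ract_sum big1 // => i _; apply: ract_ideal; apply: Defs.idealMr.
exact: rel_in_ideal.
Qed.

(** The relations starting at k define a third projective F2, whose dual
    continues the injective coresolution of P_k. Comparison with a
    coresolution of length two retracts D F2 onto the image of D P1. By
    minimality of the relations the kernel of F2 -> P1 lies in the radical of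
    F2, so that retract_kernel0 makes this map injective. *)
Lemma second_syzygy_free : inj_dim_le 2 Pk -> forall y,
  (forall a, src a = k -> I (rel_comb r k y a)) ->
  forall i, rel_src (r i) = k -> I (vx (rel_tgt (r i)) * y i).
Proof.
case=> E [eE [d [Einj E0 eE_inj exE0 exE]]].
have d1_surj : surj (d 1%N) by move=> z; apply/exE; exact: E0.
have F2_proj : projective_module F2 by exact: idem_free_projective.
have [q [q_im q_id]] := coresolution_retract
  (injective_rkdual P0_proj) (injective_rkdual P1_proj) (injective_rkdual F2_proj)
  (Einj 0%N) (Einj 1%N) (Einj 2%N)
  eval_simple_inj exact_eval_simple (exact_rkdual exact_f2) eE_inj exE0 (exE 0%N) d1_surj.
have f2_rad x : f2 x = 0 -> exists2 y,
    x = \sum_i ract (idem_gen eps2_idem i) (y i) & forall i, radical_power 1 (y i).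
  have [y [-> _]] := F2E x; rewrite f2_sum => h.
  have hy a : src a = k -> I (rel_comb r k y a).
    move=> ak; have := P1_relation h ak; rewrite /rel_comb mulr_sumr.
    by under eq_bigr => i _ do rewrite mulrA lder_start.
  have y0 := minimal_rel_comb r_min hy.
  exists (fun i => if rel_src (r i) == k then vx (rel_tgt (r i)) * y i else 0).
    apply: eq_bigr => i _.
    case: eqP => [ik|/eqP ik].
      rewrite ractM; congr (ract _ _).
      rewrite -[LHS](eps_idem_gen eps2_idem); congr (_ *: _).
      by rewrite /eps2 ik eqxx.
    have e2 : eps2 i = 0 by rewrite /eps2 (negPf ik).
    by rewrite (idem_gen0 eps2_idem e2) !ract0l.
  move=> i; case: eqP => [ik|_] //; apply/radical_power1P => v.
  rewrite trivM vertex_seriesE trivial_path_eq; case: eqP => [->|_]; last by rewrite mul0r.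
  by rewrite y0 // mulr0.
move=> y hy i ik; pose x : F2 := \sum_i ract (idem_gen eps2_idem i) (y i).
have x0 : x = 0.
  apply: (retract_kernel0 I_nil q_im q_id f2_rad).
  rewrite f2_sum big1 // => a _.
  have [ak|/eqP ak] := pselect (src a = k); first by rewrite ract_ideal //; exact: hy.
  by rewrite u1_0 // ract0l.
have vg j : (val (ract (idem_gen eps2_idem j) (y j) i) : Lam) =
    if i == j then (eps2 i : Lam) * bpi (y i) else 0.
  rewrite val_ract idem_genE; case: (i =P j) => [->|_] //.
  exact: (@mul0r Lam).
have e1 : (val (x i) : Lam) = (eps2 i : Lam) * bpi (y i).
  rewrite /x [LHS](@idem_sum_val Lam^c _ eps2).
  rewrite (eq_bigr _ (fun j _ => vg j)) -big_mkcond.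
  by rewrite (big_pred1 i) // => j; rewrite eq_sym.
have e2 : (eps2 i : Lam) * bpi (y i) = 0 by rewrite -e1 x0.
by move: e2; rewrite /eps2 ik eqxx -bpiM => /bpi_eq0.
Qed.

End InjectiveDimension.

End BoundAlgebra.

(** What the endomorphism algebra needs to know about the inverse translate N
    and about the injective dimension of P_k: generators and relations of N,
    and the injectivity of the map given by the derivatives of the
    relations. *)
Lemma tau_inverse_presentation (K : fieldType) (Q : quiver) (R : finType)
    (r : R -> quiver_relation K Q) (Lam : kalgType K)
    (bpi : {rmorphism cpa K Q -> Lam}) (k : vert Q) (n : nat) (N : lmodType Lam) :
  let I := closed_ideal [set f | exists i, f = rel_series (r i)] in
  let Pk : lmodType Lam := left_ideal (bpi (vertex_series K k)) in
  (forall c, bpi (kmap c) = kmap c) -> (forall f, bpi f = 0 <-> I f) ->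
  (forall u, exists f, bpi f = u) -> is_source k ->
  (forall f, radical_power n f -> I f) -> is_tau_inv Pk N ->
  [/\ (forall a, src a != k) -> injective_module Pk,
      minimal_relations r -> inj_dim_le 2 Pk -> forall y,
        (forall a, src a = k -> I (rel_comb r k y a)) ->
        forall i, rel_src (r i) = k -> I (vertex_series K (rel_tgt (r i)) * y i) &
      exists nn : arr Q -> N,
      [/\ forall a, src a = k -> bpi (vertex_series K (tgt a)) *: nn a = nn a,
          forall u, exists x : arr Q -> Lam, u = \sum_(a | src a == k) x a *: nn a &
          forall x : arr Q -> Lam, \sum_(a | src a == k) x a *: nn a = 0 <->
            exists c : K, forall a, src a = k ->
              x a * bpi (vertex_series K (tgt a)) = kmap c * bpi (arrow_series K a)]].
Proof.
move=> I Pk bpiK bpi_eq0 bpi_surj k_source I_nil [P1 [P0 [f1 [f0 [p [[]]]]]]].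
move=> [P1_proj P0_proj] f0_surj f1f0 f0_ess f1_ess p_surj p_ker.
have [u0 [f0u0 u0k]] := exists_u0 bpiK bpi_eq0 bpi_surj f0_surj.
have [s0 s0E] := exists_section0 k_source P0_proj f0_ess f0u0 u0k.
have [u1 [f1u1 u1t u1_0]] := exists_u1 f1f0 f0u0.
have [s1 s1E] := exists_section1 k_source P1_proj f1f0 f0_ess f1_ess f0u0 u0k f1u1 u1t u1_0.
have [dg [dgE dg_vx]] := exists_dual_gen k_source I_nil f0u0 u0k s0E f1u1 u1t u1_0 s1E.
split.
- exact: (no_arrow_injective k_source P0_proj f1f0 f0_ess f1_ess f0u0 u0k f1u1 u1t u1_0).
- exact: (second_syzygy_free k_source I_nil P1_proj P0_proj f1f0 f0_ess f1_ess f0u0 u0k s0E f1u1 u1t u1_0 s1E).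
- exact: (cokernel_generators k_source f1f0 f0_ess f1_ess f0u0 u0k s0E f1u1 u1t u1_0 dgE dg_vx p_surj p_ker).
Qed.

(** * Endomorphisms of the tilting module *)

Section Endomorphisms.
Variables (K : fieldType) (Q : quiver) (R : finType).
Variables (r : R -> quiver_relation K Q) (k : vert Q) (n : nat).
Local Notation vx := (vertex_series K).
Local Notation ar := (arrow_series K).
Local Notation rs i := (rel_series (r i)).
Local Notation I := (closed_ideal [set f | exists i, f = rel_series (r i)]).
Variables (Lam : kalgType K) (bpi : {rmorphism cpa K Q -> Lam}).
Hypothesis bpiK : forall c, bpi (kmap c) = kmap c.
Hypothesis bpi_eq0 : forall f, bpi f = 0 <-> I f.
Hypothesis bpi_surj : forall u, exists f, bpi f = u.
Hypothesis k_source : is_source k.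
Hypothesis rel_tgt_k : forall i, rel_tgt (r i) != k.
Hypothesis I_nil : forall f, radical_power n f -> I f.

Local Notation P i := (left_ideal (bpi (vx i)) : lmodType Lam).
Local Notation P' := (dsum (fun i : {i : vert Q | i != k} => P (val i))).

(** Identifies the sum of the P_i with i different from k with the left ideal
    generated by 1 - e_k; components is the inverse. *)
Definition total (p : P') : Lam := \sum_i (val (p i) : Lam).

Fact comp_subproof (y : Lam) v : (y * bpi (vx v) : Lam^o) \in in_left_ideal (bpi (vx v)).
Proof. by rewrite unfold_in -mulrA -rmorphM vx_vx eqxx. Qed.
Definition components (y : Lam) : P' := fun i => LeftIdeal (comp_subproof y (val i)).

Lemma tot_linear : linear (total : P' -> Lam^o).
Proof.
move=> a p q; rewrite /total scaler_sumr -big_split; apply: eq_bigr => i _.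
by [].
Qed.
HB.instance Definition _ := GRing.isLinear.Build Lam P' Lam^o *:%R total tot_linear.
Lemma comp_linear : linear (components : Lam^o -> P').
Proof.
move=> a p q; apply: functional_extensionality_dep => i; apply: val_inj.
by rewrite -[LHS]/((a * p + q) * bpi (vx (val i))) mulrDl -mulrA.
Qed.
HB.instance Definition _ := GRing.isLinear.Build Lam Lam^o P' *:%R components comp_linear.

Lemma totP a p q : total (a *: p + q) = a * total p + total q.
Proof. exact: (tot_linear a p q). Qed.
Lemma compP a x y : components (a * x + y) = a *: components x + components y.
Proof. exact: (comp_linear a x y). Qed.
Lemma tot0 : total 0 = 0. Proof. exact: (linear0 (total : {linear P' -> Lam^o})). Qed.
Lemma comp0 : components 0 = 0.
Proof. by apply: functional_extensionality_dep => i; apply: val_inj; exact: mul0r. Qed.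
Lemma compM a x : components (a * x) = a *: components x.
Proof. by rewrite -[a * x]addr0 compP comp0 addr0. Qed.
Lemma compD x y : components (x + y) = components x + components y.
Proof. by rewrite -[x in LHS]mul1r compP scale1r. Qed.
Lemma compN x : components (- x) = - components x.
Proof. by rewrite -mulN1r compM scaleN1r. Qed.
Lemma compB x y : components (x - y) = components x - components y.
Proof. by rewrite compD compN. Qed.

Lemma val_vx_orth v (p : P v) u : v != u -> (val p : Lam) * bpi (vx u) = 0.
Proof.
move=> /negPf vu; have e : (val p : Lam) * bpi (vx v) = val p := left_ideal_mulE p.
by rewrite -e -mulrA -rmorphM vx_vx vu rmorph0 mulr0.
Qed.

Lemma tot_k p : total p * bpi (vx k) = 0.
Proof.
rewrite /total mulr_suml big1 // => -[i ik] _ /=.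
exact: val_vx_orth.
Qed.

Lemma comp_tot p : components (total p) = p.
Proof.
apply: functional_extensionality_dep => j; apply: val_inj.
rewrite -[LHS]/(total p * bpi (vx (val j))) /total mulr_suml (bigD1 j) //=.
rewrite big1 => [|i ij]; last by apply: val_vx_orth; rewrite val_eqE.
by rewrite addr0; exact: left_ideal_mulE.
Qed.

Lemma tot_comp y : y * bpi (vx k) = 0 -> total (components y) = y.
Proof.
move=> yk; rewrite /total.
have -> : \sum_i (val (components y i) : Lam) = \sum_(i : {i : vert Q | i != k}) y * bpi (vx (val i)).
  by apply: eq_bigr.
rewrite -(big_sub_cond (fun i => i != k) xpredT (fun i => y * bpi (vx i))).
rewrite -[RHS]mulr1 -(rmorph1 bpi) -(sum_vertex_series K Q) rmorph_sum mulr_sumr.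
rewrite [RHS](bigD1 k) //= yk add0r; apply: eq_bigl => i.
by rewrite andbT.
Qed.

Lemma vx_kk u f : u != k -> bpi (vx u) * bpi f * bpi (vx k) = 0.
Proof.
move=> uk; rewrite -!rmorphM -mulrA (Mvx_source k_source) mulrA -kmapC -mulrA.
by rewrite vx_vx (negPf uk) mulr0 rmorph0.
Qed.

Lemma tot_mul_k p f : total p * bpi f * bpi (vx k) = 0.
Proof.
rewrite -mulrA -(rmorphM bpi f) (Mvx_source k_source) rmorphM bpiK mulrA -kmapC.
by rewrite -mulrA tot_k mulr0.
Qed.

Variables (N : lmodType Lam) (nn : arr Q -> N).
Hypothesis nn_vx : forall a, src a = k -> bpi (vx (tgt a)) *: nn a = nn a.
Hypothesis nn_gen : forall u, exists x : arr Q -> Lam,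
  u = \sum_(a | src a == k) x a *: nn a.
Hypothesis nn_rel : forall x : arr Q -> Lam,
  \sum_(a | src a == k) x a *: nn a = 0 <->
  exists c : K, forall a, src a = k ->
    x a * bpi (vx (tgt a)) = kmap c * bpi (ar a).

Lemma cokernel_ext (M : lmodType Lam) (f g : {linear N -> M}) :
  (forall a, src a = k -> f (nn a) = g (nn a)) -> forall u, f u = g u.
Proof.
move=> fg u; have [x ->] := nn_gen u; rewrite !linear_sum.
by apply: eq_bigr => a /eqP ak; rewrite !linearZZ fg.
Qed.

(** N is presented by its generators nn_a and the relation that the sum of
    the a nn_a vanishes. *)
Lemma cokernel_map (M : lmodType Lam) (m : arr Q -> M) :
  (forall a, src a = k -> bpi (vx (tgt a)) *: m a = m a) ->
  \sum_(a | src a == k) bpi (ar a) *: m a = 0 ->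
  exists g : {linear N -> M}, forall a, src a = k -> g (nn a) = m a.
Proof.
move=> m_vx m_rel; have [x xE] := choice nn_gen.
pose g u := \sum_(a | src a == k) x u a *: m a.
have rel0 (z : arr Q -> Lam) : \sum_(a | src a == k) z a *: nn a = 0 ->
    \sum_(a | src a == k) z a *: m a = 0.
  case/nn_rel => c cE.
  transitivity (kmap c *: \sum_(a | src a == k) bpi (ar a) *: m a); last first.
    by rewrite m_rel scaler0.
  rewrite scaler_sumr; apply: eq_bigr => a /eqP ak.
  by rewrite -[in LHS]m_vx // scalerA cE // -scalerA.
have gE u (z : arr Q -> Lam) : u = \sum_(a | src a == k) z a *: nn a ->
    g u = \sum_(a | src a == k) z a *: m a.
  move=> uz; apply/eqP; rewrite -subr_eq0 -sumrB; apply/eqP.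
  under eq_bigr => a _ do rewrite -scalerBl.
  apply: rel0; under eq_bigr => a _ do rewrite scalerBl.
  by rewrite sumrB -xE -uz subrr.
have g_lin : linear g.
  move=> a u v; rewrite (gE _ (fun b => a * x u b + x v b)).
    rewrite /g scaler_sumr -big_split; apply: eq_bigr => b _.
    by rewrite scalerDl scalerA.
  rewrite {1}[u]xE {1}[v]xE scaler_sumr -big_split; apply: eq_bigr => b _.
  by rewrite scalerDl scalerA.
exists (HB.pack_for {linear N -> M} g (GRing.isLinear.Build _ _ _ _ g g_lin)).
move=> a ak /=; rewrite (gE _ (fun b => if b == a then 1 else 0)).
  rewrite (bigD1 a) ?ak //= eqxx scale1r big1 ?addr0 // => b /andP[_ /negPf ->].
  by rewrite scale0r.
rewrite (bigD1 a) ?ak //= eqxx scale1r big1 ?addr0 // => b /andP[_ /negPf ->].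
by rewrite scale0r.
Qed.

Lemma sum_ar_lder_rel i : rel_src (r i) = k ->
  \sum_(a | src a == k) ar a * lder a (rs i) = rs i.
Proof.
move=> ik; rewrite -[RHS](rel_start r i) ik vertex_decomp (rel_rad2 r) //.
by rewrite kmap0 mul0r add0r.
Qed.

(** Well defined because the sum of the a (lder a r_i) is r_i, which vanishes
    in the algebra. *)
Lemma exists_rho_map : exists G : R -> {linear N -> Lam^o},
  (forall i a, rel_src (r i) = k -> src a = k ->
    (G i (nn a) : Lam) = - bpi (lder a (rs i))) /\
  (forall i u, (G i u : Lam) * bpi (vx (rel_tgt (r i))) = G i u).
Proof.
have /choice[G hG] i : exists G : {linear N -> Lam^o},
    (forall a, rel_src (r i) = k -> src a = k ->
      (G (nn a) : Lam) = - bpi (lder a (rs i))) /\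
    (forall u, (G u : Lam) * bpi (vx (rel_tgt (r i))) = G u).
  have [ik|ik] := eqVneq (rel_src (r i)) k; last first.
    exists (\0 : {linear N -> Lam^o}); split=> [a ik'|u]; last by rewrite mul0r.
    by rewrite ik' eqxx in ik.
  have [||G GE] := @cokernel_map Lam^o (fun a => - bpi (lder a (rs i))).
  - move=> a ak; rewrite -[LHS]/(bpi (vx (tgt a)) * - bpi (lder a (rs i))).
    by rewrite mulrN -rmorphM lder_start.
  - transitivity (- bpi (\sum_(a | src a == k) ar a * lder a (rs i))).
      rewrite rmorph_sum -sumrN; apply: eq_bigr => a _.
      rewrite -[LHS]/(bpi (ar a) * - bpi (lder a (rs i))).
      by rewrite mulrN rmorphM.
    rewrite sum_ar_lder_rel //; apply/eqP; rewrite oppr_eq0; apply/eqP/bpi_eq0.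
    exact: rel_in_ideal.
  exists G; split=> [a _ ak|u]; first exact: GE.
  have [x ->] := nn_gen u; rewrite linear_sum mulr_suml.
  apply: eq_bigr => a /eqP ak; rewrite linearZZ GE //.
  rewrite -[LHS]/(x a * - bpi (lder a (rs i)) * bpi (vx (rel_tgt (r i)))).
  by rewrite -mulrA mulNr -rmorphM lder_rel_end.
by exists G; split=> [i a|i u]; case: (hG i) => h1 h2; [exact: h1|exact: h2].
Qed.

Variable G : R -> {linear N -> Lam^o}.
Hypothesis G_nn : forall i a, rel_src (r i) = k -> src a = k ->
  (G i (nn a) : Lam) = - bpi (lder a (rs i)).
Hypothesis G_vx : forall i u, (G i u : Lam) * bpi (vx (rel_tgt (r i))) = G i u.

Lemma G_mul_k i u f : (G i u : Lam) * bpi f * bpi (vx k) = 0.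
Proof.
by rewrite -G_vx -!mulrA [bpi (vx _) * _]mulrA vx_kk ?rel_tgt_k // mulr0.
Qed.
Lemma G_k i u : (G i u : Lam) * bpi (vx k) = 0.
Proof. by have := G_mul_k i u 1; rewrite rmorph1 mulr1. Qed.

Definition tilt : lmodType Lam := (N * P')%type.
Local Notation T := tilt.

Fact theta_linear (f : cpa K Q) : linear (fun t : T =>
  ((kmap (f (trivial_path k)) : Lam) *: t.1, components (total t.2 * bpi f)) : T).
Proof.
move=> a t u; congr (_, _) => /=.
  by rewrite scalerDr !scalerA kmapC.
by rewrite totP mulrDl -mulrA compP.
Qed.
(** Right multiplication by f on the projective part. On N only the constant
    term at k acts, which makes the arrows out of k act by zero. *)
Definition theta (f : cpa K Q) : endo T := mk_hom (theta_linear f).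
Fact star_linear a : linear (fun t : T => ((total t.2 : Lam) *: nn a, 0 : P') : T).
Proof.
move=> b t u; congr (_, _) => /=; last by rewrite scaler0 addr0.
by rewrite totP scalerDl -scalerA.
Qed.
Definition star a : endo T := mk_hom (star_linear a).
Fact rho_linear i : linear (fun t : T => (0 : N, components (G i t.1 : Lam)) : T).
Proof.
move=> b t u; congr (_, _) => /=; first by rewrite scaler0 addr0.
by rewrite linearP; exact: compP.
Qed.
Definition rho i : endo T := mk_hom (rho_linear i).

Lemma thetaE f t : theta f t =
  ((kmap (f (trivial_path k)) : Lam) *: t.1, components (total t.2 * bpi f)).
Proof. by []. Qed.
Lemma starE a t : star a t = ((total t.2 : Lam) *: nn a, 0 : P').
Proof. by []. Qed.
Lemma rhoE i t : rho i t = (0 : N, components (G i t.1 : Lam)).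
Proof. by []. Qed.
Lemma endoME (f g : endo T) t : (f * g) t = g (f t).
Proof. by []. Qed.
Lemma endoDE (f g : endo T) t : (f + g) t = f t + g t.
Proof. by []. Qed.
Lemma endoNE (f : endo T) t : (- f) t = - f t.
Proof. by []. Qed.

Lemma endo_eq (f g : endo T) : (forall t, f t = g t) -> f = g.
Proof. exact: hom_eq. Qed.

Lemma endo_additive (f : endo T) t u : f (t + u) = f t + f u.
Proof. exact: homDE. Qed.
Lemma endo_scale (f : endo T) a t : f (a *: t) = a *: f t.
Proof. exact: homZE. Qed.

Lemma tot_comp_tot p f : total (components (total p * bpi f)) = total p * bpi f.
Proof. by rewrite tot_comp // tot_mul_k. Qed.
Lemma tot_comp_G i u f : total (components ((G i u : Lam) * bpi f)) = (G i u : Lam) * bpi f.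
Proof. by rewrite tot_comp // G_mul_k. Qed.

Fact theta_zmod : zmod_morphism theta.
Proof.
move=> f g; apply: endo_eq => t.
rewrite [RHS](endoDE (theta f) (- theta g)) endoNE !thetaE; congr (_, _) => /=.
  by rewrite cpaBE kmapD kmapN scalerDl scaleNr.
by rewrite rmorphB mulrBr compB.
Qed.
Fact theta_monoid : monoid_morphism theta.
Proof.
split.
  apply: endo_eq => -[u p]; apply: etrans (thetaE 1 (u, p)) _ => /=.
  rewrite (rmorph1 bpi) mulr1 comp_tot.
  have -> : (1 : cpa K Q) (trivial_path k) = 1.
    by rewrite -(@kmap1 K (cpa K Q)) cpa_kmapE eqxx.
  by rewrite kmap1 scale1r.
move=> f g; apply: endo_eq => t; rewrite [RHS](endoME (theta f) (theta g)) !thetaE /=.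
congr (_, _); first by rewrite trivM mulrC kmapM scalerA.
by rewrite tot_comp_tot rmorphM mulrA.
Qed.
HB.instance Definition _ := GRing.isZmodMorphism.Build _ _ theta theta_zmod.
HB.instance Definition _ := GRing.isMonoidMorphism.Build _ _ theta theta_monoid.

Lemma theta_ideal f : I f -> theta f = 0.
Proof.
move=> If; apply: endo_eq => t; apply: etrans (thetaE f t) _.
rewrite (ideal_rad2 If) // kmap0 scale0r.
have /bpi_eq0 -> := If; rewrite mulr0.
by rewrite comp0.
Qed.

(** A composite a* rho_i* sends p to G_i (p nn_a) = - p (lder a r_i). *)
Definition endo_system : mutated_system r k n (endo T).
Proof.
apply: (@MutatedSystem _ _ _ r k n _ (theta : {rmorphism _ -> _}) star rho) => /=.
- move=> c; apply: endo_eq => -[u p]; apply: etrans (thetaE _ _) _ => /=.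
  rewrite cpa_kmapE eqxx bpiK -kmapC compM comp_tot.
  by [].
- by move=> f /I_nil; exact: theta_ideal.
- move=> a ak; apply: endo_eq => t; apply: etrans (thetaE _ _) _.
  rewrite vertex_arrow0 kmap0 scale0r.
  have -> : ar a = vx k * ar a by rewrite vx_ar ak eqxx.
  by rewrite rmorphM mulrA tot_k mul0r comp0.
- move=> a ak; apply: endo_eq => t; apply: etrans (starE _ _) _.
  rewrite [in RHS]starE; congr (_, _).
  by rewrite thetaE /= tot_comp_tot -scalerA nn_vx.
- move=> a ak; apply: endo_eq => t; apply: etrans (thetaE _ _) _.
  rewrite starE /= vertex_seriesE eqxx kmap1 scale1r tot0 mul0r comp0.
  by [].
- move=> i ik; apply: endo_eq => t; apply: etrans (rhoE _ _) _.
  by rewrite rhoE thetaE /= vertex_seriesE eqxx kmap1 scale1r.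
- move=> i ik; apply: endo_eq => t; apply: etrans (thetaE _ _) _.
  rewrite rhoE /= scaler0 [total _]tot_comp ?G_k //.
  by rewrite G_vx.
- move=> a i ak ik; apply: endo_eq => t; apply: etrans (rhoE _ _) _.
  rewrite starE [RHS]endoNE; apply: etrans _ (congr1 -%R (esym (thetaE _ _))).
  rewrite /= linearZZ -[_ *: G _ _]/(total t.2 * (G i (nn a) : Lam)) G_nn //.
  rewrite lder_rel_rad // kmap0 scale0r mulrN compN.
  by apply: (congr1 (fun u : N => (u, _))); rewrite oppr0.
Defined.

Lemma endo_sumE (J : Type) (s : seq J) (p : pred J) (F : J -> endo T) t :
  (\sum_(i <- s | p i) F i) t = \sum_(i <- s | p i) F i t.
Proof. by elim/big_rec2: _ => [|i x y _ <-]. Qed.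
Lemma fst_sum (J : Type) (s : seq J) (p : pred J) (F : J -> T) :
  (\sum_(i <- s | p i) F i).1 = \sum_(i <- s | p i) (F i).1.
Proof. by elim/big_rec2: _ => [|i x y _ <-]. Qed.
Lemma tot_snd_sum (J : Type) (s : seq J) (p : pred J) (F : J -> T) :
  total (\sum_(i <- s | p i) F i).2 = \sum_(i <- s | p i) total (F i).2.
Proof.
elim/big_rec2: _ => [|i x y _ <-]; first exact: tot0.
by rewrite -[LHS]/(total ((F i).2 + y.2)) -[(F i).2]scale1r totP mul1r scale1r.
Qed.
Lemma totD p q : total (p + q) = total p + total q.
Proof. by rewrite -[p in LHS]scale1r totP mul1r. Qed.
Lemma totZ a p : total (a *: p) = a * total p.
Proof. by rewrite -[a *: p]addr0 totP tot0 addr0. Qed.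

Lemma tilt_eq (t u : T) : t.1 = u.1 -> total t.2 = total u.2 -> t = u.
Proof.
case: t u => [m p] [m' p'] /= -> pp'.
by rewrite -(comp_tot p) pp' comp_tot.
Qed.

Section NormalFormValues.
Variables (x : cpa K Q) (xa : arr Q -> cpa K Q) (y : R -> cpa K Q).
Variable z : R -> arr Q -> cpa K Q.
Local Notation nfT := (nf endo_system x xa y z).

Lemma nf_apply t : nfT t =
  theta x t + \sum_(a | src a == k) star a (theta (xa a) t) +
  (\sum_(i | rel_src (r i) == k) theta (y i) (rho i t) +
   \sum_(i | rel_src (r i) == k) \sum_(a | src a == k) star a (theta (z i a) (rho i t))).
Proof.
rewrite /nf !endoDE !endo_sumE; congr (_ + _ + (_ + _)).
by apply: eq_bigr => i _; rewrite endo_sumE.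
Qed.

Lemma nf_fst t : (nfT t).1 =
  (kmap (x (trivial_path k)) : Lam) *: t.1
  + \sum_(a | src a == k) (total t.2 * bpi (xa a)) *: nn a
  + \sum_(i | rel_src (r i) == k) \sum_(a | src a == k)
      ((G i t.1 : Lam) * bpi (z i a)) *: nn a.
Proof.
rewrite nf_apply.
have dE (u v : T) : (u + v).1 = u.1 + v.1 by [].
rewrite !dE !fst_sum [X in _ + (X + _)]big1 ?add0r; last first.
  by move=> i _; rewrite thetaE rhoE /= scaler0.
congr (_ + _ + _).
  by apply: eq_bigr => a _; rewrite starE thetaE /= tot_comp_tot.
apply: eq_bigr => i _; rewrite fst_sum; apply: eq_bigr => a _.
rewrite starE thetaE rhoE /= [total (components (G i _))]tot_comp ?G_k //.
by rewrite tot_comp_G.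
Qed.

Lemma nf_snd t : total (nfT t).2 =
  total t.2 * bpi x + \sum_(i | rel_src (r i) == k) (G i t.1 : Lam) * bpi (y i).
Proof.
rewrite nf_apply.
have dE (u v : T) : total (u + v).2 = total u.2 + total v.2 by exact: totD.
rewrite !dE !tot_snd_sum [X in _ + X + _]big1 ?addr0; last first.
  by move=> a _; rewrite starE; exact: tot0.
rewrite [X in _ + (_ + X)]big1 ?addr0; last first.
  move=> i _; rewrite tot_snd_sum big1 // => a _.
  by rewrite starE; exact: tot0.
rewrite thetaE; congr (_ + _); first exact: tot_comp_tot.
apply: eq_bigr => i _; rewrite thetaE rhoE /= [total (components (G i _))]tot_comp ?G_k //.
by rewrite tot_comp_G.
Qed.

Local Notation delta := ((0, components 1) : T).
Local Notation nu b := ((nn b, 0) : T).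

Lemma tot_comp1 : total (components 1) = bpi (1 - vx k).
Proof.
rewrite -[LHS](_ : total (components (bpi (1 - vx k))) = _).
  by rewrite tot_comp // -rmorphM mulrBl mul1r vx_vx eqxx subrr rmorph0.
congr (total _); apply: functional_extensionality_dep => i; apply: val_inj.
rewrite -[LHS]/(bpi (1 - vx k) * bpi (vx (val i))) -[RHS]/(1 * bpi (vx (val i))).
rewrite -rmorphM mulrBl !mul1r vx_vx eq_sym (negPf (valP i)) subr0.
by [].
Qed.

Lemma nf_delta_fst : (nfT delta).1 = \sum_(a | src a == k) bpi ((1 - vx k) * xa a) *: nn a.
Proof.
rewrite nf_fst /= scaler0 add0r [X in _ + X]big1 ?addr0 => [|i _].
  by apply: eq_bigr => a _; rewrite tot_comp1 rmorphM.
by rewrite big1 // => a _; rewrite linear0 mul0r scale0r.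
Qed.

Lemma nf_delta_snd : total (nfT delta).2 = bpi ((1 - vx k) * x).
Proof.
rewrite nf_snd /= tot_comp1 rmorphM big1 ?addr0 // => i _.
by rewrite linear0 mul0r.
Qed.

Lemma nf_nu_fst b : src b = k -> (nfT (nu b)).1 =
  (kmap (x (trivial_path k)) : Lam) *: nn b
  - \sum_(a | src a == k) bpi (rel_comb r k (z ^~ a) b) *: nn a.
Proof.
move=> bk; rewrite nf_fst /= tot0 [X in _ + X + _]big1 ?addr0 => [|a _].
  rewrite exchange_big /= -sumrN; congr (_ + _); apply: eq_bigr => a _.
  rewrite /rel_comb rmorph_sum scaler_suml -sumrN; apply: eq_bigr => i /eqP ik.
  by rewrite G_nn // mulNr scaleNr rmorphM.
by rewrite mul0r scale0r.
Qed.

Lemma nf_nu_snd b : src b = k -> total (nfT (nu b)).2 = - bpi (rel_comb r k y b).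
Proof.
move=> bk; rewrite nf_snd /= tot0 mul0r add0r /rel_comb rmorph_sum -sumrN.
by apply: eq_bigr => i /eqP ik; rewrite G_nn // mulNr rmorphM.
Qed.

End NormalFormValues.

Fact tilt_inl_linear : linear (fun u : N => (u, 0) : T).
Proof. by move=> a u v; congr (_, _) => /=; rewrite ?scaler0 ?addr0. Qed.
Definition tilt_inl : {linear N -> T} := mk_hom tilt_inl_linear.

(** N + Lambda (1 - e_k) is generated by the nn_b and the generator 1 - e_k
    of the second summand. *)
Lemma tilt_generated (f g : endo T) :
  f (0, components 1) = g (0, components 1) ->
  (forall b, src b = k -> f (nn b, 0) = g (nn b, 0)) -> f = g.
Proof.
move=> fg1 fg2.
have fgN u : f (u, 0) = g (u, 0).
  apply: (@cokernel_ext T ((f : {linear T -> T}) \o tilt_inl) ((g : {linear T -> T}) \o tilt_inl)).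
  exact: fg2.
apply: endo_eq => -[u p].
have -> : ((u, p) : T) = ((u, 0) : T) + total p *: ((0, components 1) : T).
  congr (_, _) => /=; first by rewrite scaler0 addr0.
  by rewrite add0r -compM mulr1 comp_tot.
by rewrite !endo_additive !endo_scale fgN fg1.
Qed.

(** The value at the generator 1 - e_k contains x and the x_a, the value at
    nn_b contains x(e_k), the z_ia and the y_i, the latter through their
    combinations with the derivatives lder b r_i. The second hypothesis
    allows one to cancel these derivatives. *)
Lemma endo_system_inj :
  (exists b, src b = k) ->
  (forall y, (forall a, src a = k -> I (rel_comb r k y a)) ->
     forall i, rel_src (r i) = k -> I (vx (rel_tgt (r i)) * y i)) ->
  forall x xa y z, nf endo_system x xa y z = 0 ->
  [/\ x (trivial_path k) = 0, I ((1 - vx k) * x),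
      forall a, src a = k -> I ((1 - vx k) * (xa a * vx (tgt a))),
      forall i, rel_src (r i) = k -> I (vx (rel_tgt (r i)) * y i) &
      forall i a, rel_src (r i) = k -> src a = k ->
        I (vx (rel_tgt (r i)) * z i a * vx (tgt a))].
Proof.
move=> [b0 b0k] key x xa y z nf0.
have kk : (1 - vx k) * vx k = 0 by rewrite mulrBl mul1r vx_vx eqxx subrr.
have ee : (1 - vx k) * (1 - vx k) = 1 - vx k.
  by rewrite mulrBr mulr1 kk subr0.
have delta1 := nf_delta_fst x xa y z; have delta2 := nf_delta_snd x xa y z.
have nu1 b bk := @nf_nu_fst x xa y z b bk.
have nu2 b bk := @nf_nu_snd x xa y z b bk.
rewrite nf0 in delta1 delta2 nu1 nu2.
(* In the image of nn_b, the relation of N allows the coefficient of nn_a to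
   be a multiple of the arrow a, which the idempotent at the end of b
   kills. *)
have nu_rel b a : src b = k -> src a = k ->
    I ((if a == b then kmap (x (trivial_path k)) * vx (tgt b) else 0) -
       rel_comb r k (fun i => z i a * vx (tgt a)) b).
  move=> bk ak; have /esym := nu1 b bk.
  have -> : (kmap (x (trivial_path k)) : Lam) *: nn b = \sum_(a | src a == k)
      (if a == b then kmap (x (trivial_path k)) else 0 : Lam) *: nn a.
    rewrite (bigD1 b) ?bk //= eqxx big1 ?addr0 // => c /andP[_ /negPf ->].
    by rewrite scale0r.
  rewrite -sumrB; under eq_bigr => c _ do rewrite -scalerBl.
  case/nn_rel => c' /(_ a ak) /(congr1 (fun u => bpi (vx (tgt b)) * u)).
  rewrite [RHS]mulrA -kmapC -[RHS]mulrA -rmorphM.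
  have -> : vx (tgt b) * ar a = 0.
    by rewrite vx_ar ak eq_sym (negPf (k_source b)).
  rewrite rmorph0 mulr0 => e; apply/bpi_eq0; rewrite -{}[RHS]e.
  rewrite rmorphB mulrBl mulrBr; congr (_ - _).
    case: (a =P b) => [->|_]; last by rewrite rmorph0 mul0r mulr0.
    by rewrite mulrA -kmapC -mulrA -rmorphM vx_vx eqxx rmorphM bpiK.
  rewrite -!rmorphM; congr (bpi _); rewrite /rel_comb mulr_suml mulr_sumr.
  apply: eq_bigr => i _.
  by rewrite !mulrA lder_start.
have x0 : x (trivial_path k) = 0.
  (* The elements of I and the derivatives of the relations have no constant
     terms. *)
  have := nu_rel b0 b0 b0k b0k; rewrite eqxx => /ideal_rad2 /(_ (trivial_path (tgt b0)) isT).
  rewrite cpaBE cpaZE vertex_seriesE eqxx mulr1 /rel_comb cpa_sumE big1 ?subr0 // => i _.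
  by rewrite trivM lder_rel_rad // mul0r.
split=> //.
- by apply/bpi_eq0; rewrite -delta2; exact: tot0.
- move=> a ak; apply/bpi_eq0.
  have /esym/nn_rel[c /(_ a ak)] := delta1; rewrite -rmorphM => e.
  rewrite mulrA -[in LHS]ee -!mulrA rmorphM [_ * (xa a * _)]mulrA e.
  rewrite mulrA -kmapC -mulrA -rmorphM.
  have -> : ar a = vx k * ar a by rewrite vx_ar ak eqxx.
  by rewrite mulrA kk mul0r rmorph0 mulr0.
- move=> i ik; apply: key => // a ak; apply/bpi_eq0/eqP; rewrite -oppr_eq0 -nu2 //.
  by apply/eqP; exact: tot0.
- move=> i a ik ak; rewrite -mulrA; apply: (key (fun i => z i a * vx (tgt a))) => // b bk.
  have := nu_rel b a bk ak; rewrite x0 kmap0 mul0r if_same sub0r => /idealN.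
  by rewrite opprK.
Qed.

(** The image of 1 - e_k is arbitrary. The images of the nn_b satisfy the
    relation of N, which says that certain series lie in I; by lder_ideal
    their derivatives along the arrows out of k are combinations of the lder
    b r_i, and these combinations are the values of the rho_i* y_i and rho_i*
    z_ia a*. A scalar multiple of the identity of N remains, from the
    relations of N itself. *)
Lemma endo_system_surj (f : endo T) : is_nf endo_system f.
Proof.
have kk : (1 - vx k) * vx k = 0 by rewrite mulrBl mul1r vx_vx eqxx subrr.
have ee : (1 - vx k) * (1 - vx k) = 1 - vx k.
  by rewrite mulrBr mulr1 kk subr0.
have e_delta : bpi (1 - vx k) *: ((0, components 1) : T) = (0, components 1).
  congr (_, _); first by rewrite scaler0.
  by rewrite -compM mulr1 -tot_comp1 comp_tot.
have nu_vx b : src b = k -> bpi (vx (tgt b)) *: ((nn b, 0) : T) = (nn b, 0).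
  by move=> bk; congr (_, _); rewrite ?scaler0 ?nn_vx.
have fst_scale (a : Lam) (t : T) : (a *: t).1 = a *: t.1 by [].
have snd_scale (a : Lam) (t : T) : total (a *: t).2 = a * total t.2 by exact: totZ.
have [X0 X0E] := bpi_surj (total (f (0, components 1)).2).
have [xL xLE] := nn_gen (f (0, components 1)).1.
have [xa xaE] := choice (fun a => bpi_surj (xL a)).
have [Y YE] := choice (fun b => bpi_surj (total (f (nn b, 0)).2)).
have [ZL ZLE] := choice (fun b => nn_gen (f (nn b, 0)).1).
have [Z ZE] := choice (fun ba : arr Q * arr Q => bpi_surj (ZL ba.1 ba.2)).
have nn_rel1 : \sum_(b | src b == k) bpi (ar b) *: nn b = 0.
  apply/nn_rel; exists 1 => a ak; rewrite kmap1 mul1r -rmorphM.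
  by rewrite ar_vx eqxx.
pose F : {linear N -> T} := (f : {linear T -> T}) \o tilt_inl.
have f_rel : \sum_(b | src b == k) bpi (ar b) *: f (nn b, 0) = 0.
  transitivity (F (\sum_(b | src b == k) bpi (ar b) *: nn b)).
    by rewrite (linear_sum F); apply: eq_bigr => b _; rewrite (linearZZ F).
  by rewrite nn_rel1 (linear0 F).
have f_vx b : src b = k -> bpi (vx (tgt b)) *: f (nn b, 0) = f (nn b, 0).
  by move=> bk; rewrite -endo_scale nu_vx.
have [yy yyE] : exists y, forall b, src b = k -> total (f (nn b, 0)).2 = bpi (rel_comb r k y b).
  have /(lder_ideal k I_nil)[y yE] : I (\sum_(b | src b == k) ar b * Y b).
    apply/bpi_eq0; rewrite rmorph_sum -[RHS]tot0 -[0 : P']/((0 : T).2) -f_rel tot_snd_sum.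
    by apply: eq_bigr => b _; rewrite snd_scale rmorphM YE.
  exists y => b bk; apply/eqP; rewrite -subr_eq0 -(f_vx b bk) snd_scale -YE -rmorphM -rmorphB.
  by apply/eqP/bpi_eq0; have := yE b bk; rewrite lder_sum_ar bk eqxx.
have [c [zz zzE]] : exists c (z : arr Q -> R -> cpa K Q), forall b, src b = k ->
    (f (nn b, 0)).1 = (kmap c : Lam) *: nn b +
      \sum_(a | src a == k) bpi (rel_comb r k (z a) b) *: nn a.
  have : \sum_(a | src a == k) bpi (\sum_(b | src b == k) ar b * Z (b, a)) *: nn a = 0.
    rewrite -[RHS]/((0 : T).1) -f_rel fst_sum.
    under [RHS]eq_bigr => b _ do rewrite fst_scale ZLE scaler_sumr.
    rewrite exchange_big; apply: eq_bigr => a _; rewrite rmorph_sum scaler_suml.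
    by apply: eq_bigr => b _; rewrite rmorphM ZE scalerA.
  case/nn_rel => c cE; exists c.
  have /choice[z zE] a : exists z, src a = k -> forall b, src b = k ->
      I (vx (tgt b) * (Z (b, a) * vx (tgt a)) -
         (if b == a then kmap c * vx (tgt b) else 0) - rel_comb r k z b).
    have [ak|ak] := eqVneq (src a) k; last by exists (fun=> 0) => ak'; rewrite ak' eqxx in ak.
    have /(lder_ideal k I_nil)[z zE] :
        I (\sum_(b | src b == k) ar b * (Z (b, a) * vx (tgt a)) - kmap c * ar a).
      apply/bpi_eq0; rewrite rmorphB rmorphM bpiK -cE //.
      rewrite -rmorphM mulr_suml -rmorphB; apply/bpi_eq0.
      under [X in _ - X]eq_bigr => b _ do rewrite -mulrA.
      by rewrite subrr; exact: (@ideal0 _ _ I).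
    exists z => _ b bk; have := zE b bk; rewrite raddfB /= lder_sum_ar bk eqxx lderZ lder_ar.
    by case: (b =P a) => [->|_]; rewrite ?mulr0.
  exists z => b bk; rewrite -[LHS](congr1 fst (f_vx b bk)) fst_scale ZLE scaler_sumr.
  have -> : (kmap c : Lam) *: nn b =
      \sum_(a | src a == k) bpi (if b == a then kmap c * vx (tgt b) else 0) *: nn a.
    rewrite (bigD1 b) ?bk //= eqxx big1 ?addr0 => [|a /andP[_]].
      by rewrite rmorphM bpiK -scalerA nn_vx.
    by rewrite eq_sym => /negPf ->; rewrite rmorph0 scale0r.
  rewrite -big_split; apply: eq_bigr => a /eqP ak /=.
  rewrite -scalerDl -rmorphD scalerA -(ZE (b, a)) -rmorphM -(nn_vx ak) !scalerA.
  congr (_ *: _); apply/eqP; rewrite -subr_eq0 -!rmorphM -rmorphB.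
  apply/eqP/bpi_eq0.
  have := Defs.idealMr (vx (tgt a)) (zE a ak b bk).
  rewrite -[in X in X -> _]addrA -opprD mulrBl.
  by rewrite -!mulrA vx_vx eqxx.
exists (kmap c * vx k + (1 - vx k) * X0), xa, (fun i => - yy i), (fun i a => - zz a i).
have x_k : (kmap c * vx k + (1 - vx k) * X0) (trivial_path k) = c.
  rewrite cpaDE cpaZE trivM cpaBE vertex_seriesE eqxx mulr1.
  rewrite (_ : (1 : cpa K Q) (trivial_path k) = 1); last first.
    by rewrite -(@kmap1 K (cpa K Q)) cpa_kmapE eqxx.
  by rewrite subrr mul0r addr0.
apply: tilt_generated => [|b bk]; apply: tilt_eq.
- rewrite nf_delta_fst -[LHS](congr1 fst (congr1 f e_delta)) endo_scale fst_scale.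
  rewrite xLE scaler_sumr; apply: eq_bigr => a _.
  by rewrite rmorphM xaE scalerA.
- rewrite nf_delta_snd -[in LHS]e_delta endo_scale snd_scale -X0E -rmorphM; congr (bpi _).
  by rewrite mulrDr [_ * (kmap c * _)]mulrA -kmapC -mulrA kk mulr0 add0r mulrA ee.
- rewrite nf_nu_fst // x_k zzE //; congr (_ + _); rewrite -sumrN.
  by apply: eq_bigr => a _; rewrite rel_combN rmorphN scaleNr opprK.
- by rewrite nf_nu_snd // yyE // rel_combN rmorphN opprK.
Qed.

End Endomorphisms.

(** * The isomorphism *)

(** The algebra and its idempotents are kept abstract, so that the proof does
    not depend on their construction as a quotient. *)
Lemma apr_endomorphism_iso (K : fieldType) (Q : quiver) (R : finType)
    (r : R -> quiver_relation K Q) (k : vert Q) (n : nat)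
    (Lam : kalgType K) (bpi : {rmorphism cpa K Q -> Lam}) (eps : vert Q -> Lam)
    (N T : lmodType Lam) :
  let I := closed_ideal [set f | exists i, f = rel_series (r i)] in
  let P i : lmodType Lam := left_ideal (eps i) in
  T = (N * dsum (fun i : {i : vert Q | i != k} => P (val i)))%type ->
  (forall i, bpi (vertex_series K i) = eps i) ->
  (forall c, bpi (kmap c) = kmap c) ->
  (forall f, bpi f = 0 <-> I f) ->
  (forall u, exists f, bpi f = u) ->
  is_source k ->
  (forall f, radical_power n f -> I f) ->
  minimal_relations r ->
  ~ injective_module (P k) -> is_tau_inv (P k) N -> inj_dim_le 2 (P k) ->
  kalg_iso (endo T) (trunc_jacobian (mut_qp (X := assoc_qp r) k)).
Proof.
move=> I P -> bpi_vx.
have {bpi_vx} epsE : eps = fun i => bpi (vertex_series K i) by apply/funext.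
rewrite /P {}epsE {P} => bpiK bpi_eq0 bpi_surj k_source I_nil r_min Pk_inj N_tau Pk_dim.
have rel_tgt_k i : rel_tgt (r i) != k by exact: rel_tgt_source.
have [no_arrow key [nn [nn_vx nn_gen nn_rel]]] :=
  tau_inverse_presentation bpiK bpi_eq0 bpi_surj k_source I_nil N_tau.
have [G [G_nn G_vx]] := exists_rho_map bpi_eq0 nn_gen nn_rel.
have k_arrow : exists b, src b = k.
  apply: contra_notP Pk_inj => no_b; apply: no_arrow => a.
  by apply/eqP => ak; apply: no_b; exists a.
apply: (jacobian_iso k_source rel_tgt_k I_nil
  (D := endo_system bpiK bpi_eq0 k_source rel_tgt_k I_nil nn_vx G_nn G_vx)).
- exact: (@theta_ideal _ _ _ _ _ _ _ bpi_eq0).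
- exact: endo_system_surj.
- exact: (endo_system_inj nn_rel k_arrow (key r_min Pk_dim)).
Qed.

Theorem theorem3p1 (K : closedFieldType) (Q : quiver) (R : finType)
    (r : R -> quiver_relation K Q) (k : vert Q)
    (tauP : lmodType (bound_algebra r)) :
  quiver_connected Q ->
  minimal_relations r ->
  finite_dimensional (bound_algebra r) ->
  is_source k ->
  ~ injective_module (indec_projective r k) ->
  is_tau_inv (indec_projective r k) tauP ->
  inj_dim_le 2 (indec_projective r k) ->
  kalg_iso (endo (apr_module k tauP))
           (trunc_jacobian (mut_qp (X := assoc_qp r) k)).
Proof.
move=> _ r_min fin_dim k_source Pk_inj N_tau Pk_dim.
have [n I_nil] := finite_dim_radical_nilpotent fin_dim.
pose I := closed_ideal [set f | exists i, f = rel_series (r i)].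
pose bpi : {rmorphism cpa K Q -> bound_algebra r} := quot_pi I.
have bpi_vx i : bpi (vertex_series K i) = vertex_idempotent r i by [].
have bpiK c : bpi (kmap c) = kmap c by [].
have bpi_eq0 f : bpi f = 0 <-> I f by exact: quot_pi_eq0.
have bpi_surj u : exists f, bpi f = u by exact: quot_pi_surj.
move: bpi bpi_vx bpiK bpi_eq0 bpi_surj => bpi bpi_vx bpiK bpi_eq0 bpi_surj.
exact (@apr_endomorphism_iso K Q R r k n (bound_algebra r) bpi (vertex_idempotent r) tauP
   (apr_module k tauP) erefl bpi_vx bpiK bpi_eq0 bpi_surj k_source I_nil r_min Pk_inj N_tau Pk_dim).
Qed.
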